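(* Let $\mathcal{E}$ and $\mathcal{E}_*$ be complex Hilbert spaces and let $\theta\in M(\mathcal{E},\mathcal{E}_* )$ be purely contractive and inner. Then there is a Hilbert space $\mathcal{H}$ and a pure commuting contractive $n$-tuple of operators $T$ on $\mathcal{H}$ such that the function $\{\mathcal{E},\mathcal{E}_*,\theta\}$ coincides weakly with $\{\mathcal{D}_T,\mathcal{D}_{T^*},\theta_T\}$. Furthermore, the tuple $T\in\mathcal{B}(\mathcal{H})^n$ is uniquely determined up to unitary equivalence (among pure commuting contractive tuples with this property).
   Context: $\mathbb{B}_n$ is the open Euclidean unit ball of $\mathbb{C}^n$. For a Hilbert space $\mathcal{E}$, $H^2_n(\mathcal{E})$ is the Hilbert space of analytic $f=\sum_{k\in\mathbb{N}^n}a_kz^k:\mathbb{B}_n\to\mathcal{E}$ with $\|f\|^2=\sum_k\|a_k\|^2/\gamma_k<\infty$, $\gamma_k=|k|!/k!$. The multiplier space $M(\mathcal{E},\mathcal{E}_* )$ consists of all analytic $\varphi:\mathbb{B}_n\to\mathcal{B}(\mathcal{E},\mathcal{E}_* )$ with $\varphi H^2_n(\mathcal{E})\subset H^2_n(\mathcal{E}_* )$; $M_\varphi$ is the induced bounded multiplication operator. $\varphi$ is purely contractive if $\|\varphi(0)\eta\|<\|\eta\|$ for all non-zero $\eta\in\mathcal{E}$, and inner if $M_\varphi$ is a partial isometry. A commuting contractive $n$-tuple $T=(T_1,\dots,T_n)$ on $\mathcal{H}$ is a tuple of commuting bounded operators with $\sum_{i=1}^nT_iT_i^*\le1_{\mathcal{H}}$.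 With $P_T(X)=\sum_iT_iXT_i^*$ on $\mathcal{B}(\mathcal{H})$, $A_T$ is the strong limit of the decreasing sequence $I\ge P_T(I)\ge P_T^2(I)\ge\cdots\ge0$; $T$ is pure if $A_T=0$. The letter $T$ also denotes the row contraction $\mathcal{H}^n\to\mathcal{H}$, $(h_1,\dots,h_n)\mapsto\sum_iT_ih_i$, with adjoint $T^*:h\mapsto(T_1^*h,\dots,T_n^*h)$. Put $D_{T^*}=(1_{\mathcal{H}}-TT^* )^{1/2}$, $\mathcal{D}_{T^*}=\overline{\mathrm{Ran}}\,D_{T^*}$, $D_T=(1_{\mathcal{H}^n}-T^*T)^{1/2}$, $\mathcal{D}_T=\overline{\mathrm{Ran}}\,D_T\subset\mathcal{H}^n$. The characteristic function of $T$ is $\{\mathcal{D}_T,\mathcal{D}_{T^*},\theta_T\}$, $\theta_T(z)=-T+D_{T^*}(1_{\mathcal{H}}-ZT^* )^{-1}ZD_T$ (restricted to $\mathcal{D}_T$), $z\in\mathbb{B}_n$, with row operator $Z=(z_1I_{\mathcal{H}},\dots,z_nI_{\mathcal{H}})$. Bounded operator valued functions $\{\mathcal{E},\mathcal{E}_*,\varphi\}$ and $\{\mathcal{F},\mathcal{F}_*,\psi\}$ on $\mathbb{B}_n$ coincide weakly if there is a unitary $\tau:\mathcal{E}_*\to\mathcal{F}_*$ with $\psi(w)\psi(z)^*=\tau\varphi(w)\varphi(z)^*\tau^*$ for all $z,w\in\mathbb{B}_n$. Tuples $T$ on $\mathcal{H}$ and $R$ on $\mathcal{K}$ are unitarily equivalent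 if there is a unitary $U:\mathcal{K}\to\mathcal{H}$ with $T_i=UR_iU^*$ for all $i$. *)

(* Defs.v *)
From HB Require Import structures.
From mathcomp Require Import all_boot all_order all_algebra finmap.
From mathcomp Require Import complex.
From mathcomp Require Import all_classical all_reals topology normedtype.
From mathcomp Require summability.
From mathcomp Require Import ring.

Set Implicit Arguments.
Unset Strict Implicit.
Unset Printing Implicit Defensive.

Import Order.TTheory GRing.Theory Num.Theory.
Import numFieldNormedType.Exports.
Local Open Scope classical_set_scope.
Local Open Scope complex_scope.
Local Open Scope ring_scope.

HB.mixin Record NormedModule_hasDot (R : realType) V
    & NormedModule R[i] V := {
  dotp : {dot V for @Num.conj R[i]} ;
  sqr_normE : forall x : V, `|x| ^+ 2 = dotp x x
}.

#[short(type="innerProductType")]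
HB.structure Definition InnerProduct (R : realType) :=
  {V of NormedModule R[i] V & NormedModule_hasDot R V}.

#[short(type="hilbertType")]
HB.structure Definition Hilbert (R : realType) :=
  {V of InnerProduct R V & Complete V}.

Section DotTheory.
Context (C : numClosedFieldType) (V : lmodType C) (f : {dot V for @Num.conj C}).

Lemma dot_schwarz x y : `|f x y| <= sqrtC (f x x) * sqrtC (f y y).
Proof.
rewrite -(@ler_pXn2r _ 2)// ?nnegrE ?mulr_ge0 ?sqrtC_ge0 ?dnorm_ge0//.
rewrite exprMn !sqrtCK.
have [->|y0] := eqVneq y 0; first by rewrite !linear0r normr0 expr0n mulr0.
have fy : 0 < f y y by exact: neq0_dnorm_gt0.
rewrite -(ler_pM2l fy).
have := dnorm_ge0 f (f y y *: x - f x y *: y).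
have fyr : (f y y)^* = f y y by rewrite conj_Creal// gtr0_real.
have fyx : f y x = (f x y)^* by rewrite hermC expr0 mul1r.
rewrite !(linearBl, linearBr)/= !(linearZr_LR, linearZl_LR)/= fyr fyx.
have -> : forall a b c d : C,
  b * (b * a) - d * (b * c) - (b * (c * d) - d * (c * b)) = b * (a * b - c * d).
  by move=> a b c d; ring.
by rewrite (pmulr_rge0 _ fy) subr_ge0 -normCK ler_pM2l.
Qed.

Lemma dot_triangle x y :
  sqrtC (f (x + y) (x + y)) <= sqrtC (f x x) + sqrtC (f y y).
Proof.
rewrite -(@ler_pXn2r _ 2)// ?nnegrE ?addr_ge0 ?sqrtC_ge0 ?dnorm_ge0//.
rewrite sqrrD !sqrtCK linearDl/= !linearDr/= addrA lerD2r -addrA lerD2l.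
rewrite [X in X + _]hermC/= expr0 mul1r.
rewrite addrC -[_ + _](divfK (_ : 2%:R != 0)) ?pnatr_eq0// -ReE mulr_natr lerMn2r/=.
apply: le_trans (real_ler_norm (Creal_Re _)) _.
by rewrite (le_trans (leif_normC_Re_Creal _).1)// mulrC dot_schwarz.
Qed.
End DotTheory.

HB.factory Record Lmodule_hasDot (R : realType) V & GRing.Lmodule R[i] V := {
  dotp : {dot V for @Num.conj R[i]}
}.

HB.builders Context R V & Lmodule_hasDot R V.

Let norm (x : V) := sqrtC (dotp x x).

Let normD x y : norm (x + y) <= norm x + norm y.
Proof. exact: dot_triangle. Qed.

Let normZ l x : norm (l *: x) = `|l| * norm x.
Proof.
rewrite /norm/= linearZl_LR linearZr_LR/= mulrA -normCK sqrtCM ?sqrCK//.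
  by rewrite nnegrE exprn_ge0.
by rewrite nnegrE dnorm_ge0.
Qed.

Let norm0 x : norm x = 0 -> x = 0.
Proof. by move=> /eqP; rewrite /norm sqrtC_eq0 dnorm_eq0 => /eqP. Qed.

HB.instance Definition _ := @Lmodule_isNormed.Build R[i] V norm normD normZ norm0.

Let norm_dot (x : V) : `|x| ^+ 2 = dotp x x.
Proof. by rewrite sqrtCK. Qed.

HB.instance Definition _ := NormedModule_hasDot.Build R V norm_dot.
HB.end.

Section ClosedSubspace.
Context (R : realType) (H : hilbertType R).

Record closed_subspace := ClosedSubspace {
  cs_set :> set H;
  cs_submod : submod_closed [in cs_set];
  cs_closed : closed cs_set
}.

Section Carrier.
Variable S : closed_subspace.

Definition cs_pred : {pred H} := [in cs_set S].
HB.instance Definition _ := GRing.isSubmodClosed.Build R[i] H cs_pred (cs_submod S).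

Definition cs_sort := {x : H | x \in cs_pred}.
HB.instance Definition _ := SubChoice.on cs_sort.
HB.instance Definition _ := [SubChoice_isSubLmodule of cs_sort by <:].

Definition cs_dot (x y : cs_sort) : R[i] := dotp (val x) (val y).

Let cs_dot_bilinear : bilinear_for *%R (Num.conj \; *%R) cs_dot.
Proof.
by split=> [u a x y|u a x y]; rewrite /cs_dot/= (linearPl, linearPr).
Qed.
HB.instance Definition _ := bilinear_isBilinear.Build R[i] _ _ _ _ _ cs_dot cs_dot_bilinear.

Let cs_dot_hermitian x y : cs_dot x y = (-1) ^+ false * (cs_dot y x)^*.
Proof. exact: hermC. Qed.
HB.instance Definition _ := isHermitianSesquilinear.Build R[i] cs_sort false _ cs_dot cs_dot_hermitian.

Let cs_dot_gt0 x : x != 0 -> 0 < cs_dot x x.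
Proof. by move=> x0; exact: neq0_dnorm_gt0. Qed.
HB.instance Definition _ := isDotProduct.Build R[i] cs_sort cs_dot cs_dot_gt0.

HB.instance Definition _ := Lmodule_hasDot.Build R cs_sort cs_dot.

Lemma cs_normE (x : cs_sort) : `|x| = `|val x|.
Proof. by apply/eqP; rewrite -(@eqrXn2 _ 2)// !sqr_normE. Qed.

Let cs_complete (F : set_system cs_sort) :
  ProperFilter F -> cauchy F -> cvg F.
Proof.
move=> FF /cauchyP Fc.
have /cauchy_cvg/cvg_ex[/= l Fl] : cauchy (val @ F).
  apply/cauchyP => e e0; have [x Fx] := Fc _ e0.
  exists (val x); change (F (val @^-1` ball (val x) e)); apply: filterS Fx => y.
  by rewrite -!ball_normE/= cs_normE.
have Sl : l \in cs_pred.
  rewrite inE; apply: (@closed_cvg _ H F FF val _ (@cs_closed S) _ l Fl).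
  by apply: nearW => x; have := valP x; rewrite inE.
apply/cvg_ex; exists (Sub l Sl : cs_sort).
apply/cvgrPdist_lt => e e0.
move/cvgrPdist_lt : Fl => /(_ _ e0); apply: filterS => x.
by rewrite cs_normE raddfB.
Qed.
HB.instance Definition _ := Uniform_isComplete.Build cs_sort cs_complete.
End Carrier.
End ClosedSubspace.

(* The Hilbert space H^n; the l2 norm differs from the sup norm that the library
   puts on products. *)
Definition l2sum (R : realType) (n : nat) (H : hilbertType R) := {ffun 'I_n -> H}.

Section L2sum.
Context (R : realType) (n : nat) (H : hilbertType R).
HB.instance Definition _ := GRing.Lmodule.on (l2sum n H).

Definition l2sum_dot (x y : l2sum n H) : R[i] := \sum_(i < n) dotp (x i) (y i).

Let l2sum_dot_bilinear : bilinear_for *%R (Num.conj \; *%R) l2sum_dot.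
Proof.
split=> [u a x y|u a x y]; rewrite /l2sum_dot/= mulr_sumr -big_split;
  apply: eq_bigr => i _; by rewrite !ffunE (linearPl, linearPr).
Qed.
HB.instance Definition _ := bilinear_isBilinear.Build R[i] _ _ _ _ _ l2sum_dot l2sum_dot_bilinear.

Let l2sum_dot_hermitian x y : l2sum_dot x y = (-1) ^+ false * (l2sum_dot y x)^*.
Proof.
by rewrite expr0 mul1r rmorph_sum; apply: eq_bigr => i _; rewrite hermC expr0 mul1r.
Qed.
HB.instance Definition _ := isHermitianSesquilinear.Build R[i] (l2sum n H) false _ l2sum_dot l2sum_dot_hermitian.

Let l2sum_dot_gt0 x : x != 0 -> 0 < l2sum_dot x x.
Proof.
move=> x0; rewrite lt_neqAle sumr_ge0 ?andbT => [|i _]; last exact: dnorm_ge0.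
apply: contra x0; rewrite eq_sym psumr_eq0 => [/allP x0|i _]; last exact: dnorm_ge0.
apply/eqP/ffunP => i; rewrite ffunE; apply/eqP.
by rewrite -(dnorm_eq0 dotp); apply: x0; rewrite mem_index_enum.
Qed.
HB.instance Definition _ := isDotProduct.Build R[i] (l2sum n H) l2sum_dot l2sum_dot_gt0.

HB.instance Definition _ := Lmodule_hasDot.Build R (l2sum n H) l2sum_dot.

Lemma l2sum_normE (x : l2sum n H) : `|x| ^+ 2 = \sum_(i < n) `|x i| ^+ 2.
Proof. by rewrite sqr_normE; apply: eq_bigr => i _; rewrite sqr_normE. Qed.

Lemma l2sum_norm_le (x : l2sum n H) : `|x| <= \sum_(i < n) `|x i|.
Proof.
rewrite -(@ler_pXn2r _ 2)// ?nnegrE ?sumr_ge0// l2sum_normE.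
rewrite [leRHS]expr2 mulr_suml ler_sum// => i _.
by rewrite expr2 ler_wpM2l// (bigD1 i)//= lerDl sumr_ge0.
Qed.

Lemma l2sum_norm_ge (x : l2sum n H) i : `|x i| <= `|x|.
Proof.
rewrite -(@ler_pXn2r _ 2)// ?nnegrE// l2sum_normE (bigD1 i)//= lerDl.
by rewrite sumr_ge0// => j _; rewrite exprn_ge0.
Qed.

Let l2sum_complete (F : set_system (l2sum n H)) :
  ProperFilter F -> cauchy F -> cvg F.
Proof.
move=> FF /cauchyP Fc.
have Fi i : cvg ((fun x : l2sum n H => x i) @ F).
  apply: cauchy_cvg; apply/cauchyP => e e0; have [x Fx] := Fc _ e0.
  exists (x i); change (F ((fun x : l2sum n H => x i) @^-1` ball (x i) e)).
  apply: filterS Fx => y; rewrite -!ball_normE/=.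
  by apply: le_lt_trans; have := l2sum_norm_ge (x - y) i; rewrite !ffunE.
apply/cvg_ex; exists ([ffun i => lim ((fun x : l2sum n H => x i) @ F)] : l2sum n H).
apply/cvgrPdist_lt => e e0.
have e'0 : 0 < e / n.+1%:R by rewrite divr_gt0.
have : F [set x : l2sum n H | forall i,
    `|lim ((fun x : l2sum n H => x i) @ F) - x i| < e / n.+1%:R].
  apply: filter_forall => i; move: (Fi i) => /cvgrPdist_lt; exact.
apply: filterS => x xe; apply: le_lt_trans (l2sum_norm_le _) _.
apply: (@le_lt_trans _ _ (\sum_(i < n) e / n.+1%:R)).
  by apply: ler_sum => i _; rewrite !ffunE ltW.
rewrite sumr_const card_ord -mulrnAr -[X in X *+ n]mulr1 -mulrnAr -[ltRHS]mulr1 ltr_pM2l//.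
by rewrite mulrC -[_ *+ _]mulr_natr mul1r ltr_pdivrMr// mul1r ltr_nat.
Qed.
HB.instance Definition _ := Uniform_isComplete.Build (l2sum n H) l2sum_complete.
End L2sum.

Section BoundedOperator.
Context (R : realType) (E F : hilbertType R).

Definition bounded_op : {pred E -> F} :=
  fun A => `[< linear A /\ continuous A >].

Let bounded_op_submod : submod_closed bounded_op.
Proof.
split=> [|a A B /asboolP[lA cA] /asboolP[lB cB]]; apply/asboolP; split.
- by move=> a x y; rewrite /= scaler0 addr0.
- by move=> x; exact: cvg_cst.
- move=> b x y; rewrite !fctE lA lB !scalerDr !scalerA addrACA.
  by rewrite [a * b]mulrC.
- by move=> x; apply: cvgD; [apply: cvgZr; exact: cA|exact: cB].
Qed.
HB.instance Definition _ :=
  GRing.isSubmodClosed.Build R[i] (E -> F) bounded_op bounded_op_submod.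

Record bop := Bop { bop_fun :> E -> F; bop_subproof : bounded_op bop_fun }.
HB.instance Definition _ := [isSub for bop_fun].
HB.instance Definition _ := [Choice of bop by <:].
HB.instance Definition _ := [SubChoice_isSubLmodule of bop by <:].

Lemma bop_linear (A : bop) : linear A.
Proof. by have /asboolP[] := bop_subproof A. Qed.
HB.instance Definition _ (A : bop) :=
  GRing.isLinear.Build R[i] E F *:%R A (@bop_linear A).

Lemma bop_continuous (A : bop) : continuous A.
Proof. by have /asboolP[] := bop_subproof A. Qed.

Lemma bopP (A B : bop) : A =1 B <-> A = B.
Proof. by split=> [AB|->//]; apply/val_inj/funext. Qed.

Lemma bop_bounded (A : bop) : exists2 M, 0 <= M & forall x, `|A x| <= M * `|x|.
Proof.
have /linear_boundedP/pinfty_ex_gt0[M M0 AM] :=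
  @continuous_linear_bounded _ _ _ 0 A (@bop_continuous A 0).
by exists M => //; exact: ltW.
Qed.

Definition opnorm (A : bop) : R[i] :=
  (sup [set complex.Re `|A x| | x in [set x | `|x| <= 1]])%:C.

Lemma opnorm_ub (A : bop) x : `|A x| <= opnorm A * `|x|.
Proof.
have [M M0 AM] := bop_bounded A.
have [->|x0] := eqVneq x 0; first by rewrite linear0 !normr0 mulr0.
have xp : 0 < `|x| by rewrite normr_gt0.
rewrite -ler_pdivrMr// mulrC -[X in X * _]ger0_norm ?invr_ge0// -normrZ -linearZ/=.
set y := _ *: x.
have y1 : `|y| <= 1 by rewrite normrZ normfV normr_id mulVf// gt_eqF.
rewrite -[ `|A y| ]RRe_real ?normr_real// /opnorm lecR.
apply: ub_le_sup; last by exists y.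
exists (complex.Re M) => _ [z /= z1 <-].
rewrite -lecR !RRe_real ?normr_real ?ger0_real//.
by apply: le_trans (AM z) _; rewrite ler_piMr.
Qed.

Lemma opnorm_ge0 (A : bop) : 0 <= opnorm A.
Proof.
have : `|A 0| <= opnorm A.
  have [M M0 AM] := bop_bounded A.
  rewrite -[ `|A 0| ]RRe_real ?normr_real// /opnorm lecR.
  apply: ub_le_sup; last by exists 0 => //=; rewrite normr0.
  exists (complex.Re M) => _ [z /= z1 <-].
  rewrite -lecR !RRe_real ?normr_real ?ger0_real//.
  by apply: le_trans (AM z) _; rewrite ler_piMr.
by apply: le_trans; rewrite normr_ge0.
Qed.

Lemma opnorm_le (A : bop) M :
  0 <= M -> (forall x, `|A x| <= M * `|x|) -> opnorm A <= M.
Proof.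
move=> M0 AM; rewrite /opnorm -[M]RRe_real ?ger0_real// lecR.
apply: ge_sup => [|_ [z /= z1 <-]]; first by exists (complex.Re `|A 0|), 0 => //=; rewrite normr0.
rewrite -lecR !RRe_real ?normr_real ?ger0_real//.
by apply: le_trans (AM z) _; rewrite ler_piMr.
Qed.

Let opnormD A B : opnorm (A + B) <= opnorm A + opnorm B.
Proof.
apply: opnorm_le => [|x]; first by rewrite addr_ge0 ?opnorm_ge0.
by rewrite mulrDl (le_trans (ler_normD _ _))// lerD ?opnorm_ub.
Qed.

Let opnormZ_le a A : opnorm (a *: A) <= `|a| * opnorm A.
Proof.
apply: opnorm_le => [|x]; first by rewrite mulr_ge0 ?opnorm_ge0.
by rewrite normrZ -mulrA ler_wpM2l ?opnorm_ub.
Qed.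

Let opnorm0_eq0 A : opnorm A = 0 -> A = 0.
Proof.
move=> A0; apply/bopP => x; apply/eqP; rewrite -normr_le0.
by have := opnorm_ub A x; rewrite A0 mul0r.
Qed.

Let opnormZ a A : opnorm (a *: A) = `|a| * opnorm A.
Proof.
apply/eqP; rewrite eq_le opnormZ_le/=.
have [->|a0] := eqVneq a 0; first by rewrite normr0 mul0r opnorm_ge0.
have := opnormZ_le a^-1 (a *: A).
by rewrite scalerA mulVf// scale1r normfV -ler_pdivrMl ?invr_gt0 ?normr_gt0// invrK.
Qed.

HB.instance Definition _ :=
  @Lmodule_isNormed.Build R[i] bop opnorm opnormD opnormZ opnorm0_eq0.

End BoundedOperator.
Arguments bop {R} E F.

Section Operators.
Context (R : realType).
Implicit Types E F G H : hilbertType R.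

Fact bop_id_subproof E : bounded_op (@id E).
Proof. by apply/asboolP; split=> // x. Qed.
Definition bop_id E : bop E E := Bop (bop_id_subproof E).

Fact bop_comp_subproof E F G (A : bop F G) (B : bop E F) : bounded_op (A \o B).
Proof.
apply/asboolP; split; first by move=> a x y; rewrite /= !linearP.
by move=> x; apply: continuous_comp; exact: bop_continuous.
Qed.
Definition bop_comp E F G (A : bop F G) (B : bop E F) : bop E G :=
  Bop (bop_comp_subproof A B).

Fact l2sum_proj_subproof n H (i : 'I_n) : bounded_op (fun x : l2sum n H => x i).
Proof.
apply/asboolP; split; first by move=> a x y; rewrite !ffunE.
move=> x; apply/(@cvgrPdist_lt _ _ _ (nbhs (x : l2sum n H))) => e e0.
have /cvgrPdist_lt/(_ e e0) := @cvg_id _ (nbhs x).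
apply: filterS => y; apply: le_lt_trans.
by have := l2sum_norm_ge (x - y) i; rewrite !ffunE.
Qed.
Definition l2sum_proj n H (i : 'I_n) : bop (l2sum n H) H :=
  Bop (l2sum_proj_subproof H i).

(* The operators below are unique when they exist, and [xget 0] picks them; the
   default value 0 is not used for the adjoint, which always exists. *)
Definition adj E F (A : bop E F) : bop F E :=
  xget 0 [set B : bop F E | forall x y, dotp (A x) y = dotp x (B y)].

Definition positive_op H (A : bop H H) := forall x, 0 <= dotp (A x) x.

Definition sqrt_op H (A : bop H H) : bop H H :=
  xget 0 [set B : bop H H | positive_op B /\ bop_comp B B = A].

Definition inv_op H (A : bop H H) : bop H H :=
  xget 0 [set B : bop H H | bop_comp A B = bop_id H /\ bop_comp B A = bop_id H].

Definition unitary_op E F (U : bop E F) :=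
  bop_comp (adj U) U = bop_id E /\ bop_comp U (adj U) = bop_id F.

Fact closure_range_submod E F (A : bop E F) : submod_closed [in closure (range A)].
Proof.
split; first by rewrite inE; apply: subset_closure; exists 0; rewrite ?linear0.
move=> a x y; rewrite !inE => Ax Ay B.
have /[apply] : (fun u : F * F => a *: u.1 + u.2) @ (x, y) --> a *: x + y.
  by apply: cvgD; [apply: cvgZr; exact: cvg_fst|exact: cvg_snd].
move=> [[P Q]/= [/Ax[_ [[u _ <-] Pu]] /Ay[_ [[v _ <-] Qv]]] PQB].
exists (A (a *: u + v)); split; first by exists (a *: u + v).
by rewrite linearP; exact: (PQB (A u, A v)).
Qed.
Definition closure_range E F (A : bop E F) : closed_subspace F :=
  ClosedSubspace (closure_range_submod A) (@closed_closure _ (range A)).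

Definition restrict_op E F (S : closed_subspace E) (S' : closed_subspace F)
    (A : bop E F) : bop (cs_sort S) (cs_sort S') :=
  xget 0 [set B : bop (cs_sort S) (cs_sort S') | forall x, val (B x) = A (val x)].
End Operators.

Notation "A ** B" := (bop_comp A B) (at level 40, left associativity).

Section Tuples.
Context (R : realType) (n : nat) (H : hilbertType R).
Implicit Types (T : 'I_n -> bop H H) (z : 'rV[R[i]]_n).

Definition row_op T : bop (l2sum n H) H := \sum_(i < n) T i ** l2sum_proj H i.

Definition le_op (A B : bop H H) := positive_op (B - A).

Definition commuting_contractive T :=
  (forall i j, T i ** T j = T j ** T i) /\
  le_op (\sum_(i < n) T i ** adj (T i)) (bop_id H).

Definition conj_op T (X : bop H H) : bop H H :=
  \sum_(i < n) T i ** X ** adj (T i).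

Definition strong_cvg (u : nat -> bop H H) (A : bop H H) :=
  forall h, u k h @[k --> \oo] --> A h.

Definition pure_tuple T :=
  strong_cvg (fun k => iter k (conj_op T) (bop_id H)) 0.

Definition defect T : bop (l2sum n H) (l2sum n H) :=
  sqrt_op (bop_id (l2sum n H) - adj (row_op T) ** row_op T).
Definition defect_adj T : bop H H :=
  sqrt_op (bop_id H - row_op T ** adj (row_op T)).

Definition defect_space T := closure_range (defect T).
Definition defect_adj_space T := closure_range (defect_adj T).

Definition scalar_row z : bop (l2sum n H) H :=
  row_op (fun i => z 0 i *: bop_id H).

Definition char_fun T z :
    bop (cs_sort (defect_space T)) (cs_sort (defect_adj_space T)) :=
  let Z := scalar_row z in
  restrict_op _ _ (- row_op T +
    defect_adj T ** inv_op (bop_id H - Z ** adj (row_op T)) ** Z ** defect T).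

End Tuples.

Definition unitarily_equivalent (R : realType) (n : nat) (H K : hilbertType R)
    (T : 'I_n -> bop H H) (S : 'I_n -> bop K K) :=
  exists2 U : bop K H, unitary_op U & forall i, T i = U ** S i ** adj U.

Section AnalyticFunctions.
Context (R : realType) (n : nat).
Local Notation C := R[i].
Implicit Types (z w : 'rV[C]_n) (V : normedModType C).

Definition unit_ball : set 'rV[C]_n :=
  [set z | \sum_(i < n) `|z 0 i| ^+ 2 < 1].

Definition multiindex := {ffun 'I_n -> nat}.
HB.instance Definition _ := Choice.on multiindex.

Definition monomial z (k : multiindex) : C := \prod_(i < n) z 0 i ^+ k i.

Definition gamma (k : multiindex) : C :=
  ((\sum_(i < n) k i)`!)%N%:R / (\prod_(i < n) (k i)`!)%N%:R.

Definition has_sum V (a : multiindex -> V) (s : V) :=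
  summability.partial_sum a @ summability.totally --> s.

Definition analytic V (f : 'rV[C]_n -> V) :=
  forall w, unit_ball w -> exists2 r : C, 0 < r &
    exists a : multiindex -> V,
      forall z, \sum_(i < n) `|z 0 i - w 0 i| ^+ 2 < r ^+ 2 ->
        has_sum (fun k => monomial (z - w) k *: a k) (f z).

Definition power_expansion V (f : 'rV[C]_n -> V) (a : multiindex -> V) :=
  forall z, unit_ball z -> has_sum (fun k => monomial z k *: a k) (f z).

End AnalyticFunctions.

(* Functions on the unit ball are represented by functions on the whole of C^n,
   whose values outside of the ball are irrelevant; [coef f] is then the unique
   family of coefficients of the expansion of f on the ball, if there is one. *)
Section H2.
Context (R : realType) (n : nat) (E : hilbertType R).
Local Notation C := R[i].
Implicit Types f g : 'rV[C]_n -> E.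

Definition coef f : multiindex n -> E := xget 0 [set a | power_expansion f a].

Definition H2 : set ('rV[C]_n -> E) := [set f |
  (exists a, power_expansion f a) /\
  exists s : C^o, has_sum (fun k => `|coef f k| ^+ 2 / gamma R k : C^o) s].

Definition H2dot f g : C :=
  @summability.sum _ _ C^o (fun k => dotp (coef f k) (coef g k) / gamma R k).

Definition H2norm f : C := sqrtC (H2dot f f).

End H2.

Section Multipliers.
Context (R : realType) (n : nat) (E F : hilbertType R).
Local Notation C := R[i].
Implicit Types phi : 'rV[C]_n -> bop E F.

Definition mult_op phi (f : 'rV[C]_n -> E) : 'rV[C]_n -> F :=
  fun z => phi z (f z).

Definition multiplier phi :=
  analytic phi /\ forall f, H2 f -> H2 (mult_op phi f).

Definition purely_contractive phi :=
  forall eta : E, eta != 0 -> `|phi 0 eta| < `|eta|.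

(* M_phi is a partial isometry: it is isometric on the orthogonal complement of
   its kernel. *)
Definition inner phi :=
  forall f, H2 f ->
    (forall g, H2 g -> (forall z, unit_ball z -> mult_op phi g z = 0) ->
      H2dot f g = 0) ->
    H2norm (mult_op phi f) = H2norm f.

End Multipliers.

Definition coincide_weakly (R : realType) (n : nat)
    (E Es F Fs : hilbertType R)
    (phi : 'rV[R[i]]_n -> bop E Es) (psi : 'rV[R[i]]_n -> bop F Fs) :=
  exists2 tau : bop Es Fs, unitary_op tau &
    forall z w, unit_ball z -> unit_ball w ->
      psi w ** adj (psi z) = tau ** phi w ** adj (phi z) ** adj tau.

(* Main.v *)
(* Let H be the orthogonal complement of theta H^2(E) in H^2(E_* ) and T the compression
   to H of the coordinate multiplications, so that T_i^* is a backward shift restricted to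
   H.  Since theta is inner, the kernel functions of H are
   k_z eta - theta (k_z theta(z)^* eta), whence H has the reproducing kernel
   (1 - theta(w) theta(z)^* ) / (1 - <w,z>).  On the other hand every row contraction S
   satisfies
     1 - theta_S(w) theta_S(z)^* = (1 - <w,z>) D (1 - W S^* )^-1 (1 - S Z^* )^-1 D,
   with D = D_{S^*}, and for S = T the right-hand side is this same kernel, because
   D_{T^*}^2 is e^* e for the evaluation e at 0.
   Conversely, weak coincidence prescribes the Gram matrix of the vectors
   (1 - S Z^* )^-1 D eta, which are total when S is pure; so two pure tuples with the same
   theta are intertwined on these vectors by a unitary, and comparing coefficients of
   (1 - S Z^* )^-1 D eta = sum_k gamma_k conj(z)^k S^k D eta shows that it intertwines the
   tuples. *)
Require Import Defs.
From HB Require Import structures.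
From mathcomp Require Import all_boot all_order all_algebra finmap.
From mathcomp Require Import complex.
From mathcomp Require Import all_classical all_reals topology normedtype.
From mathcomp Require Import interval_inference sequences.
From mathcomp Require summability.
From mathcomp Require Import ring.

Set Implicit Arguments.
Unset Strict Implicit.
Unset Printing Implicit Defensive.

Import Order.TTheory GRing.Theory Num.Theory.
Import numFieldNormedType.Exports.
Local Open Scope classical_set_scope.
Local Open Scope complex_scope.
Local Open Scope ring_scope.

(** * Hilbert space geometry *)

(** [adj], [sqrt_op], [inv_op] and [restrict_op] are choices with default [0], so [char_fun] can
    only be computed once existence is settled: Riesz gives adjoints, a Neumann series the inverse,
    a polynomial iteration the square root, whose uniqueness also has to be proved. Weak coincidence
    involves only the products [psi w ** adj (psi z)], so characteristic functions enter through
    Gram matrices of their adjoints, and the two unitaries of the proof come from one lemma on total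
    families with equal Gram matrices. One is the intertwiner of the uniqueness part. The other is
    [tau], which sends the value [f(0)] of an element of the model to its image under the defect
    operator; pure contractivity is what makes these values total in the target space. Coefficients
    are compared on the ball [sum_i |z_i| < 1] only: there the resolvent series converges
    absolutely, and this smaller ball already determines a power series. *)

Section DotLemmas.
Context (R : realType) (H : hilbertType R).
Implicit Types (x y z : H) (a : R[i]).

Lemma dotDl x y z : dotp (x + y) z = dotp x z + dotp y z.
Proof. exact: linearDl. Qed.
Lemma dotDr x y z : dotp z (x + y) = dotp z x + dotp z y.
Proof. exact: linearDr. Qed.
Lemma dotNl x z : dotp (- x) z = - dotp x z.
Proof. exact: linearNl. Qed.
Lemma dotNr x z : dotp z (- x) = - dotp z x.
Proof. exact: linearNr. Qed.
Lemma dotBl x y z : dotp (x - y) z = dotp x z - dotp y z.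
Proof. exact: linearBl. Qed.
Lemma dotBr x y z : dotp z (x - y) = dotp z x - dotp z y.
Proof. exact: linearBr. Qed.
Lemma dotZl a x z : dotp (a *: x) z = a * dotp x z.
Proof. exact: linearZl_LR. Qed.
Lemma dotZr a x z : dotp z (a *: x) = a^* * dotp z x.
Proof. exact: linearZr_LR. Qed.
Lemma dot0l z : dotp (0 : H) z = 0.
Proof. exact: linear0l. Qed.
Lemma dot0r z : dotp z (0 : H) = 0.
Proof. exact: linear0r. Qed.
Lemma dot_suml I (r : seq I) (P : pred I) (F : I -> H) z :
  dotp (\sum_(i <- r | P i) F i) z = \sum_(i <- r | P i) dotp (F i) z.
Proof.
apply: (big_morph (fun x => dotp x z)); [by move=> x y; exact: dotDl|exact: dot0l].
Qed.
Lemma dot_sumr I (r : seq I) (P : pred I) (F : I -> H) z :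
  dotp z (\sum_(i <- r | P i) F i) = \sum_(i <- r | P i) dotp z (F i).
Proof.
apply: (big_morph (fun x => dotp z x)); [by move=> x y; exact: dotDr|exact: dot0r].
Qed.
Lemma dot_conj x y : (dotp x y)^* = dotp y x.
Proof. by rewrite (hermC dotp y) expr0 mul1r. Qed.
Lemma dot_norm x : dotp x x = `|x| ^+ 2.
Proof. by rewrite sqr_normE. Qed.
Lemma cauchy_schwarz x y : `|dotp x y| <= `|x| * `|y|.
Proof.
by have := dot_schwarz dotp x y; rewrite !dot_norm !sqrCK ?normr_ge0.
Qed.
Lemma dot_eq0 x : dotp x x = 0 -> x = 0.
Proof. by rewrite dot_norm => /eqP; rewrite sqrf_eq0 normr_eq0 => /eqP. Qed.
Lemma dot_inj x y : (forall z, dotp x z = dotp y z) -> x = y.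
Proof.
move=> xy; apply/eqP; rewrite -subr_eq0; apply/eqP/dot_eq0.
by rewrite dotBl xy subrr.
Qed.
Lemma dot_injr x y : (forall z, dotp z x = dotp z y) -> x = y.
Proof. by move=> xy; apply: dot_inj => z; rewrite -dot_conj xy dot_conj. Qed.
Lemma parallelogram x y :
  `|x + y| ^+ 2 + `|x - y| ^+ 2 = 2 * `|x| ^+ 2 + 2 * `|y| ^+ 2.
Proof. rewrite -!dot_norm dotBl dotDl !dotBr !dotDr; ring. Qed.
Lemma norm_subE x y :
  `|x - y| ^+ 2 = `|x| ^+ 2 + `|y| ^+ 2 - dotp x y - dotp y x.
Proof. rewrite -!dot_norm dotBl !dotBr; ring. Qed.

End DotLemmas.

Section ComplexReals.
Context (R : realType).
Implicit Types (e : R[i]).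

Lemma ge0_realC e : 0 <= e -> exists2 r : R, 0 <= r & e = r%:C.
Proof.
move=> e0; exists (complex.Re e); last by rewrite RRe_real// ger0_real.
by rewrite -lecR RRe_real// ger0_real.
Qed.

Lemma invn_small e : 0 < e -> exists N, forall p, (N <= p)%N -> p.+1%:R^-1 < e.
Proof.
move=> e0; have [r r0 er] := ge0_realC (ltW e0).
have {}r0 : 0 < r by rewrite -ltcR -er.
have [N _ HN] := near_infty_natSinv_lt (PosNum r0).
exists N => p Np; have := HN p Np => /=.
by rewrite er -ltcR fmorphV rmorph_nat.
Qed.

Lemma norm_le_sqr (V : normedModType R[i]) (x : V) (e : R[i]) :
  0 <= e -> `|x| ^+ 2 <= e ^+ 2 -> `|x| <= e.
Proof. by move=> e0; rewrite ler_pXn2r// nnegrE. Qed.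

Lemma norm_lt_sqr (V : normedModType R[i]) (x : V) (e : R[i]) :
  0 <= e -> `|x| ^+ 2 < e ^+ 2 -> `|x| < e.
Proof. by move=> e0; rewrite ltr_pXn2r// nnegrE. Qed.

(** The order of [R[i]] is partial: [x <= y] includes equality of the imaginary parts, which the
    instance [e = 1] provides. What remains concerns real parts. *)
Lemma le_addgt0 (x y : R[i]) : (forall e, 0 < e -> x <= y + e) -> x <= y.
Proof.
case: x => a b; case: y => c d xy.
have := xy 1 ltr01; rewrite !lecE /= addr0 => /andP[-> _] /=.
apply/ler_addgt0Pr => e e0.
by have := xy e%:C; rewrite ltcR => /(_ e0); rewrite lecE /= => /andP[].
Qed.

End ComplexReals.

(** * Orthogonal projection and the Riesz representation *)

Section Projection.
Context (R : realType) (H : hilbertType R).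

Lemma cauchy_seq_lim (u : nat -> H) :
  (forall e : R[i], 0 < e -> exists N, forall p q,
     (N <= p)%N -> (N <= q)%N -> `|u p - u q| < e) ->
  exists l : H, u @ \oo --> l.
Proof.
move=> uc; suff: cvg (u @ \oo) by move=> cu; exists (lim (u @ \oo)).
apply: cauchy_cvg; apply/cauchyP => e e0.
have [N HN] := uc e e0; exists (u N); exists N => // p /= Np.
by rewrite -ball_normE/=; exact: HN.
Qed.

(** A minimising sequence for the distance from [x] to [S] is Cauchy; its limit attains the
    distance, and a variation inside [S] gives orthogonality. *)
Lemma projection_exists (S : closed_subspace H) (x : H) :
  exists2 y, cs_set S y & forall s, cs_set S s -> dotp (x - y) s = 0.
Proof.
have S0 : cs_set S 0 by have [] := cs_submod S; rewrite inE.
have SP a u v : cs_set S u -> cs_set S v -> cs_set S (a *: u + v).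
  by have [_ h] := cs_submod S; have := h a u v; rewrite !inE.
pose D := [set complex.Re (`|x - s| ^+ 2) | s in cs_set S].
have lbD : lbound D 0.
  by move=> _ [s Ss <-]; rewrite -lecR RRe_real ?ger0_real ?exprn_ge0.
have hD : has_inf D by split; [exists (complex.Re (`|x - 0| ^+ 2)), 0|exists 0].
pose d : R[i] := (inf D)%:C.
have dle s : cs_set S s -> d <= `|x - s| ^+ 2.
  move=> Ss; rewrite -[leRHS]RRe_real ?ger0_real ?exprn_ge0// lecR.
  by apply: ge_inf; [exists 0|exists s].
have /choice[s Hs] : forall m : nat, exists s, cs_set S s /\ `|x - s| ^+ 2 < d + m.+1%:R^-1.
  move=> m; have m0 : 0 < m.+1%:R^-1 :> R by rewrite invr_gt0.
  have [_ [s Ss <-] sd] := inf_adherent m0 hD.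
  exists s; split=> //; rewrite -[ltLHS]RRe_real ?ger0_real ?exprn_ge0//.
  by move: sd; rewrite -ltcR rmorphD/= fmorphV rmorph_nat.
have sS m : cs_set S (s m) by have [] := Hs m.
have sd m : `|x - s m| ^+ 2 < d + m.+1%:R^-1 by have [] := Hs m.
(* Parallelogram law for [x - s k] and [x - s l]: the midpoint of [s k] and [s l] lies in [S], so
   half the sum of the two vectors has squared norm at least [d]. *)
have cau k l : `|s k - s l| ^+ 2 <= 2 * k.+1%:R^-1 + 2 * l.+1%:R^-1.
  have := parallelogram (x - s k) (x - s l).
  have -> : x - s k - (x - s l) = s l - s k by rewrite opprB addrC addrA subrK.
  rewrite distrC => eq.
  have /dle : cs_set S (2^-1 *: (s k) + 2^-1 *: s l).
    by rewrite -[X in _ + X]addr0; apply: (SP) => //; apply: SP => //.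
  have -> : x - (2^-1 *: (s k) + 2^-1 *: s l) = 2^-1 *: (x - s k + (x - s l)).
    rewrite addrACA -opprD scalerBr !scalerDr -scalerDl.
    have -> : 2^-1 + 2^-1 = 1 :> R[i] by field.
    by rewrite scale1r.
  rewrite normrZ exprMn => dl.
  have e1 := ltW (sd k); have e2 := ltW (sd l).
  have n2 : `|2^-1 : R[i]| ^+ 2 = 4^-1 by rewrite normfV normr_nat exprVn -natrX.
  rewrite n2 in dl.
  have {}dl : 4 * d <= `|x - s k + (x - s l)| ^+ 2.
    by move: dl; rewrite ler_pdivlMl.
  have -> : `|s k - s l| ^+ 2 = 2 * `|x - s k| ^+ 2 + 2 * `|x - s l| ^+ 2
      - `|x - s k + (x - s l)| ^+ 2 by rewrite -eq; ring.
  rewrite lerBlDr; apply: (@le_trans _ _ (2 * (d + k.+1%:R^-1) + 2 * (d + l.+1%:R^-1))).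
    by apply: lerD; rewrite ler_pM2l.
  have -> : 2 * (d + k.+1%:R^-1) + 2 * (d + l.+1%:R^-1) =
    2 * k.+1%:R^-1 + 2 * l.+1%:R^-1 + 4 * d by ring.
  by rewrite lerD2l.
have [y sy] : exists l : H, s @ \oo --> l.
  apply: cauchy_seq_lim => e e0.
  have [N HN] := @invn_small R (e ^+ 2 / 4) ltac:(by rewrite divr_gt0// exprn_gt0).
  exists N => p q Np Nq; apply: norm_lt_sqr; first exact: ltW.
  apply: le_lt_trans (cau p q) _.
  have -> : e ^+ 2 = 2 * (e ^+ 2 / 4) + 2 * (e ^+ 2 / 4).
    by field.
  by apply: ltrD; rewrite ltr_pM2l// HN.
have Sy : cs_set S y by apply: (closed_cvg (cs_set S) (@cs_closed _ _ S) _ _ sy); exact: nearW.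
have yd : `|x - y| ^+ 2 <= d.
  have xs : (fun m => `|x - s m| ^+ 2 : R[i]^o) @ \oo --> (`|x - y| ^+ 2 : R[i]^o).
    have h : (fun m => `|x - s m| : R[i]^o) @ \oo --> (`|x - y| : R[i]^o).
      by apply: cvg_norm; apply: cvgB => //; exact: cvg_cst.
    by rewrite expr2; under eq_fun do rewrite expr2; apply: cvgM.
  apply: le_addgt0 => e e0.
  move/cvgrPdist_lt : xs => /(_ (e / 2)); rewrite divr_gt0// => /(_ isT)[N _ HN].
  have [M HM] := @invn_small R (e / 2) ltac:(by rewrite divr_gt0).
  pose m := maxn N M; have /= := HN m (leq_maxl _ _) => h1.
  have := HM m (leq_maxr _ _) => h2.
  have {}h1 : `|x - y| ^+ 2 - `|x - s m| ^+ 2 < e / 2.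
    apply: le_lt_trans h1; apply: real_ler_norm.
    by rewrite rpredB// ger0_real// exprn_ge0.
  rewrite -(subrK (`|x - s m| ^+ 2) (`|x - y| ^+ 2)).
  apply: ltW; apply: (lt_trans (ltrD h1 (sd m))).
  have -> : d + e = e / 2 + (d + e / 2) by field.
  by rewrite ltrD2l ltrD2l.
exists y => // v Sv.
have [->|v0] := eqVneq v 0; first by rewrite dot0r.
have nv : 0 < `|v| ^+ 2 by rewrite exprn_gt0// normr_gt0.
(* The coefficient of the projection of [x - y] onto the line of [v]. Moving [y] by [c *: v] would
   lower the squared distance by [|t|^2 / |v|^2], where [t] is the inner product to be killed. *)
pose c := dotp (x - y) v / `|v| ^+ 2.
have /dle : cs_set S (c *: v + y) by exact: SP.
have -> : x - (c *: v + y) = (x - y) - c *: v by rewrite opprD addrCA addrA [- _ + _]addrC addrAC.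
move=> /(le_trans yd); rewrite (norm_subE (x - y)) dotZr dotZl normrZ exprMn.
rewrite -[dotp v (x - y)]dot_conj.
set t := dotp (x - y) v; have ct : `|c| ^+ 2 * `|v| ^+ 2 = t^* * t / `|v| ^+ 2.
  rewrite /c -/t normrM normfV exprMn exprVn normrX normr_id.
  by rewrite normCK [t * _]mulrC; field; rewrite normr_eq0.
have -> : c^* * t = t^* * t / `|v| ^+ 2.
  rewrite /c -/t rmorphM fmorphV rmorphXn /= (@conj_Creal _ `|v|) ?normr_real//.
  by rewrite mulrAC.
have -> : c * t^* = t^* * t / `|v| ^+ 2 by rewrite /c -/t mulrAC [t * _]mulrC.
rewrite ct addrK -subr_ge0 addrAC subrr add0r oppr_ge0.
rewrite pmulr_lle0 ?invr_gt0// mulrC -normCK.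
move=> t0; have : `|t| ^+ 2 == 0 by rewrite eq_le t0 exprn_ge0.
by rewrite sqrf_eq0 normr_eq0 => /eqP.
Qed.

End Projection.

Section ClosedSets.
Context (R : realType) (H : hilbertType R).
Implicit Types (S : set H) (x y : H).

Lemma closureP S x :
  closure S x <-> forall e : R[i], 0 < e -> exists2 y, S y & `|x - y| < e.
Proof.
split=> [cSx e e0|Sx B /nbhs_ballP[e /= e0 eB]].
  have [y [Sy]] := cSx _ (nbhsx_ballx x e e0).
  by rewrite -ball_normE/= => xy; exists y.
have [y Sy xy] := Sx e e0; exists y; split => //; apply: eB.
by rewrite -ball_normE.
Qed.

Lemma closed_epsP S :
  (forall x, (forall e : R[i], 0 < e -> exists2 y, S y & `|x - y| < e) -> S x) ->
  closed S.
Proof. by move=> h x /closureP; exact: h. Qed.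

Lemma submod_setP S :
  S 0 -> (forall a x y, S x -> S y -> S (a *: x + y)) -> submod_closed [in S].
Proof. by move=> S0 SP; split=> [|a x y]; rewrite !inE//; exact: SP. Qed.

(** Dividing by [M + 1] instead of [M] covers [M = 0]. *)
Lemma eps_eq0 (V : normedModType R[i]) (v : V) (M : R[i]) :
  0 <= M -> (forall e : R[i], 0 < e -> `|v| <= M * e) -> v = 0.
Proof.
move=> M0 h; apply/eqP; rewrite -normr_le0; apply: le_addgt0 => e e0.
rewrite add0r; apply: le_trans (h (e / (M + 1)) _) _.
  by rewrite divr_gt0// ltr_wpDl.
by rewrite mulrCA ler_piMr ?(ltW e0)// ler_pdivrMr ?ltr_wpDl// mul1r lerDl.
Qed.

(** [G] is an arbitrary set, so that both a range and a mere family of kernel functions can be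
    inserted. *)
Lemma closed_orthogonal (G : set H) :
  exists S : closed_subspace H, forall x, cs_set S x <-> forall g, G g -> dotp x g = 0.
Proof.
pose S := [set x : H | forall g, G g -> dotp x g = 0].
have Ssub : submod_closed [in S].
  apply: submod_setP => [g _|a x y Sx Sy g Gg]; first by rewrite dot0l.
  by rewrite dotDl dotZl Sx// Sy// mulr0 addr0.
have Sc : closed S.
  apply: closed_epsP => x h g Gg; apply: (@eps_eq0 R[i]^o _ `|g|) => // e e0.
  have [y Sy xy] := h _ e0.
  rewrite -[x](subrK y) dotDl Sy// addr0 (le_trans (cauchy_schwarz _ _))// mulrC.
  by rewrite ler_wpM2l// ltW.
by exists (ClosedSubspace Ssub Sc).
Qed.

(** The closure is a closed subspace, and the error of the projection onto it is orthogonal to [S],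
    hence zero. *)
Lemma closure_total S :
  S 0 -> (forall a x y, S x -> S y -> S (a *: x + y)) ->
  (forall h, (forall s, S s -> dotp h s = 0) -> h = 0) ->
  forall x, closure S x.
Proof.
move=> S0 SP tot.
have Csub : submod_closed [in closure S].
  apply: submod_setP => [|a x y /closureP Sx /closureP Sy]; first exact: subset_closure.
  apply/closureP => e e0; have a1 : 0 < `|a| + 1 by rewrite ltr_wpDl.
  have [x' Sx' xx'] := Sx (e / 2 / (`|a| + 1)) ltac:(by rewrite !divr_gt0).
  have [y' Sy' yy'] := Sy (e / 2) ltac:(by rewrite divr_gt0).
  exists (a *: x' + y'); first exact: SP.
  rewrite opprD addrACA -scalerBr (le_lt_trans (ler_normD _ _))// [e in ltRHS]splitr.
  rewrite ler_ltD// normrZ (le_trans (ler_wpM2l _ (ltW xx')))//.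
  rewrite mulrCA ler_piMr ?divr_ge0 ?(ltW e0)//.
  by rewrite ler_pdivrMr// mul1r lerDl.
pose C := ClosedSubspace Csub (@closed_closure _ S).
move=> x; have [y Cy xy] := projection_exists C x.
suff /eqP : x - y = 0 by rewrite subr_eq0 => /eqP ->.
by apply: tot => s Ss; apply: xy => /=; exact: subset_closure.
Qed.

Lemma riesz (f : H -> R[i]) (M : R[i]) :
  (forall a x y, f (a *: x + y) = a * f x + f y) ->
  (forall x, `|f x| <= M * `|x|) -> exists y, forall x, f x = dotp x y.
Proof.
move=> fP fM.
have f0 : f 0 = 0 by have := fP (-1) 0 0; rewrite scaler0 addr0 mulN1r addNr.
have fZ a x : f (a *: x) = a * f x by have := fP a x 0; rewrite !addr0 f0 addr0.
have fB x y : f (x - y) = f x - f y.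
  by rewrite addrC -scaleN1r fP mulN1r addrC.
have Ksub : submod_closed [in [set x | f x = 0]].
  by apply: submod_setP => //= a x y fx fy; rewrite fP fx fy mulr0 addr0.
have Kcl : closed [set x | f x = 0].
  apply: closed_epsP => x h /=; apply: (@eps_eq0 R[i]^o _ `|M|) => // e e0.
  have [y fy xy] := h _ e0; rewrite -[f x]subr0 -[X in _ - X]fy -fB.
  rewrite (le_trans (fM _))// (le_trans (real_ler_norm _)) ?normrM ?normr_id//.
    apply: ger0_real; apply: le_trans (fM (x - y)); exact: normr_ge0.
  by rewrite ler_wpM2l// ltW.
pose K := ClosedSubspace Ksub Kcl.
have [fz|] := pselect (forall x, f x = 0).
  by exists 0 => x; rewrite dot0r fz.
move=> /existsNP[x fx].
have [y Ky xy] := projection_exists K x.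
have fxy : f (x - y) = f x by rewrite fB Ky subr0.
have nz : `|x - y| != 0.
  by rewrite normr_eq0; apply: contra_notN fx => /eqP xy0; rewrite -fxy xy0.
exists ((f x)^* / `|x - y| ^+ 2 *: (x - y)) => z.
(* This combination of [z] and [x - y] is annihilated by [f]; its orthogonality to [x - y] is the
   representation formula, up to conjugation. *)
have : cs_set K (f x *: z - f z *: (x - y)).
  by rewrite /= fB !fZ fxy mulrC subrr.
move/xy => /eqP; rewrite dotBr !dotZr dot_norm subr_eq0 => /eqP e.
rewrite rmorphM fmorphV rmorphXn /= (@conj_Creal _ `|x - y|) ?normr_real//.
rewrite conjCK -(dot_conj _ z).
have nr : (`|x - y| ^+ 2)^* = `|x - y| ^+ 2.
  by rewrite conj_Creal// ger0_real// exprn_ge0.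
have /(congr1 Num.conj) := e; rewrite rmorphM [RHS]rmorphM /= nr !conjCK => e'.
by rewrite mulrAC e' mulfK// expf_neq0.
Qed.

End ClosedSets.

(** * Construction of bounded operators and adjoints *)

Section Bounded.
Context (R : realType).
Implicit Types E F G : hilbertType R.

Lemma bop_exists E F (f : E -> F) (M : R[i]) : linear f ->
  (forall x, `|f x| <= M * `|x|) -> exists A : bop E F, forall x, A x = f x.
Proof.
move=> lf fM.
have fB x y : f (x - y) = f x - f y.
  by rewrite addrC -scaleN1r lf scaleN1r addrC.
have bf : bounded_op f.
  apply/asboolP; split=> // x; apply/(@cvgrPdist_lt _ _ _ (nbhs (x : E))) => e e0.
  have M1 : 0 < `|M| + 1 by rewrite ltr_wpDl.
  have /cvgrPdist_lt/(_ (e / (`|M| + 1))) := @cvg_id _ (nbhs x).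
  rewrite divr_gt0// => /(_ isT); apply: filterS => y xy.
  rewrite -fB (le_lt_trans (fM _))//.
  rewrite (le_lt_trans (real_ler_norm _))//.
    by apply: ger0_real; apply: le_trans (fM (x - y)); exact: normr_ge0.
  rewrite normrM normr_id; apply: (@le_lt_trans _ _ ((`|M| + 1) * `|x - y|)).
    by rewrite ler_wpM2r// lerDl.
  by rewrite mulrC -ltr_pdivlMr.
by exists (Bop bf).
Qed.

(** Riesz represents [x |-> dotp (A x) y]. The representing vector is linear in [y] because it is
    unique, and pairing it with itself shows that it is bounded. *)
Lemma adjP E F (A : bop E F) x y : dotp (A x) y = dotp x (adj A y).
Proof.
rewrite /adj; case: xgetP => [B -> /= ->//|].
suff [B HB] : exists B : bop F E, forall x y, dotp (A x) y = dotp x (B y).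
  by move=> /(_ B); tauto.
have [M M0 AM] := bop_bounded A.
have /choice[g Hg] : forall y, exists z, forall x, dotp (A x) y = dotp x z.
  move=> z; apply: (@riesz _ _ _ (M * `|z|)) => [a u v|u].
    by rewrite linearP/= dotDl dotZl.
  rewrite (le_trans (cauchy_schwarz _ _))// mulrAC ler_wpM2r//.
have [||B HB] := @bop_exists F E g M.
- by move=> a u v; apply: dot_injr => z; rewrite -Hg !(dotDr, dotZr) !Hg.
- move=> u; have [->|u0] := eqVneq (g u) 0; first by rewrite normr0 mulr_ge0.
  have gu : 0 < `|g u| by rewrite normr_gt0.
  rewrite -(ler_pM2l gu) -expr2 -dot_norm -Hg.
  apply: le_trans (real_ler_norm _) _.
    by rewrite Hg dot_norm ger0_real// exprn_ge0.
  rewrite (le_trans (cauchy_schwarz _ _))// mulrA ler_wpM2r// mulrC; exact: AM.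
by exists B => u v; rewrite HB.
Qed.

Lemma adjPr E F (A : bop E F) x y : dotp (adj A x) y = dotp x (A y).
Proof. by rewrite -dot_conj -adjP dot_conj. Qed.

Lemma adj_eq E F (A : bop E F) (B : bop F E) :
  (forall x y, dotp (A x) y = dotp x (B y)) -> adj A = B.
Proof.
by move=> AB; apply/bopP => y; apply: dot_injr => x; rewrite -adjP AB.
Qed.

Lemma adjK E F (A : bop E F) : adj (adj A) = A.
Proof. by apply: adj_eq => x y; rewrite adjPr. Qed.

Lemma bopD E F (A : bop E F) x y : A (x + y) = A x + A y.
Proof. exact: linearD. Qed.
Lemma bopB E F (A : bop E F) x y : A (x - y) = A x - A y.
Proof. exact: linearB. Qed.
Lemma bopZ E F (A : bop E F) a x : A (a *: x) = a *: A x.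
Proof. exact: linearZ. Qed.
Lemma bop0 E F (A : bop E F) : A 0 = 0.
Proof. exact: linear0. Qed.
Lemma bop_compE E F G (A : bop F G) (B : bop E F) x : (A ** B) x = A (B x).
Proof. by []. Qed.
Lemma bop_addE E F (A B : bop E F) x : (A + B) x = A x + B x.
Proof. by []. Qed.
Lemma bop_oppE E F (A : bop E F) x : (- A) x = - A x.
Proof. by []. Qed.
Lemma bop_scaleE E F a (A : bop E F) x : (a *: A) x = a *: A x.
Proof. by []. Qed.
Lemma bop_sumE E F I (r : seq I) (P : pred I) (A : I -> bop E F) x :
  (\sum_(i <- r | P i) A i) x = \sum_(i <- r | P i) A i x.
Proof. by apply: (big_morph (fun B : bop E F => B x)). Qed.

End Bounded.

(** * Bounded operators *)

Section OperatorLimits.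
Context (R : realType).
Implicit Types E F G : hilbertType R.

Lemma hcvg_unique E (u : nat -> E) (a b : E) :
  u @ \oo --> a -> u @ \oo --> b -> a = b.
Proof. by move=> ua ub; exact: (cvg_unique (@norm_hausdorff _ _) ua ub). Qed.

Lemma bop_cvg E F (A : bop E F) (u : nat -> E) a :
  u @ \oo --> a -> A (u m) @[m --> \oo] --> A a.
Proof. by move=> ua; apply: continuous_cvg => //; exact: bop_continuous. Qed.

(** Majorant principle: the increments of [Y] are dominated by those of a bounded monotone real
    sequence, so [Y m x] is Cauchy for each [x]. It serves both the Neumann series and the square
    root. *)
Lemma op_limit E F (Y : nat -> bop E F) (u : nat -> R) (b : R) :
  (forall m, u m <= u m.+1) -> (forall m, u m <= b) ->
  (forall m x, `|Y m.+1 x - Y m x| <= (u m.+1 - u m)%:C * `|x|) ->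
  exists L : bop E F, forall x, Y m x @[m --> \oo] --> L x.
Proof.
move=> ui ub Yu.
have unM p k : u p <= u (p + k)%N.
  by elim: k => [|k IH]; rewrite ?addn0// addnS (le_trans IH).
have Yk p k x : `|Y (p + k)%N x - Y p x| <= (u (p + k)%N - u p)%:C * `|x|.
  elim: k => [|k IH]; first by rewrite addn0 !subrr normr0 mul0r.
  rewrite addnS -(subrK (Y (p + k)%N x) (Y (p + k).+1 x)) -addrA.
  rewrite (le_trans (ler_normD _ _))// (le_trans (lerD (Yu _ _) IH))//.
  by rewrite -mulrDl -rmorphD/= addrA subrK.
have ucv : cvgn u.
  apply: nondecreasing_is_cvgn; last by exists b => _ [m _ <-].
  by move=> p q pq; rewrite -(subnKC pq).
have uc (e : R) : 0 < e -> exists N, forall k, u (N + k)%N - u N < e.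
  move=> e0; have e2 : 0 < e / 2 by rewrite divr_gt0.
  move/cvgrPdist_lt : ucv => /(_ _ e2)[N _ HN]; exists N => k.
  have h1 := HN N (leqnn _); have h2 := HN (N + k)%N (leq_addr _ _).
  rewrite (le_lt_trans (real_ler_norm _))// ?num_real//.
  rewrite -(subrK (limn u) (u (N + k)%N)) -addrA (le_lt_trans (ler_normD _ _))//.
  by rewrite [e]splitr ltrD// distrC.
have /choice[L HL] : forall x, exists l : F, Y m x @[m --> \oo] --> l.
  move=> x; apply: cauchy_seq_lim => e e0.
  have [r r0 er] := ge0_realC (ltW e0).
  have {}r0 : 0 < r by rewrite -ltcR -er.
  have [s s0 es] := ge0_realC (normr_ge0 x).
  have [N HN] := uc (r / 2 / (s + 1)) ltac:(by rewrite !divr_gt0// ltr_wpDl).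
  have H p : (N <= p)%N -> `|Y p x - Y N x| < (r / 2)%:C.
    move=> Np; rewrite -(subnKC Np) (le_lt_trans (Yk _ _ _))// es -rmorphM ltcR/=.
    have := HN (p - N)%N; rewrite ltr_pdivlMr ?ltr_wpDl//; apply: le_lt_trans.
    by rewrite ler_wpM2l// ?lerDl// subr_ge0.
  exists N => p q Np Nq.
  rewrite -(subrK (Y N x) (Y p x)) -addrA (le_lt_trans (ler_normD _ _))//.
  by rewrite er [r]splitr rmorphD/= ltrD ?H// distrC H.
have lL : linear L.
  move=> a x y; apply: hcvg_unique (HL _) _.
  under eq_fun do rewrite linearP.
  by apply: cvgD; [apply: cvgZl_tmp; exact: HL|exact: HL].
have [|B HB] := @bop_exists _ _ _ L (opnorm (Y 0%N) + (b - u 0%N)%:C) lL.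
  move=> x; apply: le_addgt0 => e e0.
  have /cvgrPdist_lt/(_ _ e0)[N _ /(_ N (leqnn _))/= HN] := HL x.
  rewrite -(subrK (Y N x) (L x)) (le_trans (ler_normD _ _))// addrC lerD// ?(ltW HN)//.
  rewrite -(subrK (Y 0%N x) (Y N x)) (le_trans (ler_normD _ _))// addrC mulrDl.
  rewrite lerD ?opnorm_ub//; have := Yk 0%N N x; rewrite add0n => /le_trans; apply.
  by rewrite ler_wpM2r// lecR lerB.
by exists B => x; rewrite HB.
Qed.

(* B is the Neumann series of A; its partial sums satisfy Y (m+1) = 1 + A Y m = 1 + Y m A. *)
Lemma neumann E (A : bop E E) (r : R) : 0 <= r -> r < 1 ->
  (forall x, `|A x| <= r%:C * `|x|) ->
  exists B : bop E E, (forall x, B x - A (B x) = x) /\ (forall x, B (x - A x) = x).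
Proof.
move=> r0 r1 Ar.
pose Y := fix Y m := if m is k.+1 then bop_id E + A ** Y k else 0 : bop E E.
(* The partial sums of the geometric series majorise the increments of [Y]. *)
pose u := fix u m := if m is k.+1 then 1 + r * u k else 0 : R.
have u0 m : 0 <= u m by elim: m => //= m IH; rewrite addr_ge0 ?mulr_ge0.
have ub m : u m <= (1 - r)^-1.
  elim: m => [|m IH] /=; first by rewrite invr_ge0 subr_ge0 ltW.
  apply: (@le_trans _ _ (1 + r / (1 - r))); first by rewrite lerD2l ler_wpM2l.
  by rewrite le_eqVlt; apply/orP; left; apply/eqP; field; rewrite subr_eq0 gt_eqF.
have ui m : u m <= u m.+1.
  elim: m => [|m IH]; first by rewrite /= mulr0 addr0 ler01.
  by rewrite [leRHS]/= [leLHS]/= lerD2l ler_wpM2l.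
have [|L HL] := @op_limit _ _ Y u (1 - r)^-1 ui ub.
  elim=> [|m IH] x.
    have -> : Y 1%N x - Y 0%N x = x + A 0 - 0 by [].
    by rewrite /= linear0 mulr0 !addr0 !subr0 mul1r.
  have -> : Y m.+2 x - Y m.+1 x = A (Y m.+1 x - Y m x).
    have -> : Y m.+2 x - Y m.+1 x = x + A (Y m.+1 x) - (x + A (Y m x)) by [].
    by rewrite linearB opprD addrACA subrr add0r.
  rewrite (le_trans (Ar _))// (le_trans (ler_wpM2l _ (IH x))) ?lecR//.
  by rewrite mulrA -rmorphM/= ler_wpM2r// lecR opprD addrACA subrr add0r -mulrBr.
have YA m x : Y m.+1 x = x + Y m (A x).
  elim: m x => [|m IH] x; first by change (x + A 0 = x + 0); rewrite linear0.
  by change (x + A (Y m.+1 x) = x + (A x + A (Y m (A x)))); rewrite IH linearD.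
exists L; split=> x.
  suff e : L x = x + A (L x) by rewrite {1}e addrK.
    apply: hcvg_unique (HL x) _; rewrite -(cvg_shiftS (fun m => Y m x)).
    by apply: cvgD; [exact: cvg_cst|apply: bop_cvg].
rewrite linearB /=; suff {1}-> : L x = x + L (A x) by rewrite addrK.
apply: hcvg_unique (HL x) _; rewrite -(cvg_shiftS (fun m => Y m x)).
under eq_fun do rewrite YA.
by apply: cvgD; [exact: cvg_cst|].
Qed.

End OperatorLimits.

(** * Positive square roots *)

Section SquareRoots.
Context (R : realType).
Implicit Types E F : hilbertType R.

Lemma real_norm_le (x y : R[i]) : 0 <= x -> `|x| <= y -> x <= y.
Proof. by move=> x0; rewrite ger0_norm. Qed.

Lemma conj_i : ('i : R[i])^* = - 'i.
Proof. exact: conjCi. Qed.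

(** Polarisation in abstract form: [e = 0] removes [a], the values [1] and [-1] give [b + c = 0],
    and ['i] and [- 'i] give [c - b = 0]. *)
Lemma polar_eq0 (a b c d : R[i]) :
  (forall e : R[i], a + e^* * b + e * c + e * e^* * d = 0) -> b = 0.
Proof.
move=> h.
have a0 : a = 0 by have := h 0; rewrite rmorph0 !mul0r !addr0.
have h1 := h 1; have hm := h (-1); have hi := h 'i; have hmi := h (- 'i).
move: h1 hm hi hmi; rewrite a0 rmorph1 rmorphN1 rmorphN /= conj_i !add0r => h1 hm hi hmi.
have e1 : 2 * (b + c) = 0.
  transitivity ((1 * b + 1 * c + 1 * 1 * d) - (-1 * b + -1 * c + -1 * -1 * d)).
    by ring.
  by rewrite h1 hm subrr.
have e2 : 2 * 'i * (c - b) = 0.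
  transitivity ((- 'i * b + 'i * c + 'i * (- 'i) * d) - (- - 'i * b + - 'i * c + - 'i * (- - 'i) * d)).
    by ring.
  by rewrite hi hmi subrr.
have {}e1 : c = - b.
  move/eqP : e1; rewrite mulf_eq0 pnatr_eq0/= addrC addr_eq0 => /eqP ->//.
move/eqP : e2; rewrite !mulf_eq0 pnatr_eq0 (negbTE (@neq0Ci _)) /= e1 -opprD oppr_eq0.
by rewrite -mulr2n mulrn_eq0 /= => /eqP.
Qed.

(** Over the complex numbers self-adjointness follows from [dotp (A u) u] being real for all [u], by
    polarisation along [x + e *: y]. *)
Lemma positive_selfadj E (A : bop E E) : positive_op A ->
  forall x y, dotp (A x) y = dotp x (A y).
Proof.
move=> A0 x y; apply/eqP; rewrite -subr_eq0; apply/eqP.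
have hx u : dotp (A u) u - dotp u (A u) = 0.
  by rewrite -[X in _ - X]dot_conj conj_Creal ?subrr// ger0_real// A0.
apply: (@polar_eq0 (dotp (A x) x - dotp x (A x)) _ (dotp (A y) x - dotp y (A x))
  (dotp (A y) y - dotp y (A y))) => e.
rewrite -[RHS](hx (x + e *: y)) bopD bopZ !(dotDl, dotDr) !(dotZl, dotZr).
ring.
Qed.

(** Positivity at [x - t *: A x] yields [t a (2 - t M) <= 0] with [a = |A x|^2]; the choice
    [t = (M + 1)^-1] makes the bracket positive. *)
Lemma positive_dot_eq0 E (A : bop E E) x :
  positive_op A -> dotp (A x) x = 0 -> A x = 0.
Proof.
move=> A0 Ax.
have [M M0 AM] := bop_bounded A.
have M1 : 0 < M + 1 by rewrite ltr_wpDl.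
have sa := positive_selfadj A0.
apply/eqP; rewrite -normr_eq0 -sqrf_eq0; set a := _ ^+ 2.
pose t := (M + 1)^-1; have t0 : 0 < t by rewrite invr_gt0.
have tr : t^* = t by rewrite conj_Creal// gtr0_real.
have := A0 (x - t *: A x).
rewrite bopB bopZ dotBl !dotBr !dotZl !dotZr Ax tr [dotp (A (A x)) x]sa dot_norm -/a sub0r.
have le : dotp (A (A x)) (A x) <= M * a.
  apply: real_norm_le (A0 _) _; rewrite (le_trans (cauchy_schwarz _ _))//.
  by rewrite /a expr2 mulrA ler_wpM2r.
have a0 : 0 <= a by rewrite /a exprn_ge0.
move=> h.
have : 0 <= - (t * a) - (t * a - t * (t * (M * a))).
  apply: le_trans h _; rewrite lerD2l lerN2 lerD2l lerN2 ler_wpM2l ?(ltW t0)//.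
  by rewrite ler_wpM2l// ltW.
have -> : - (t * a) - (t * a - t * (t * (M * a))) = - (t * a * (2 - t * M)) by ring.
rewrite oppr_ge0.
have tM : t * M < 1 by rewrite /t mulrC ltr_pdivrMr// mul1r ltrDl.
rewrite pmulr_lle0 ?(pmulr_rle0 a t0)//; last first.
  rewrite subr_gt0 (lt_trans tM)//; exact: ltr1n.
by move=> a0'; rewrite eq_le a0 a0'.
Qed.

(** [A - A^2 = (1 - A) A (1 - A) + A (1 - A) A] is a sum of two positive operators. *)
Lemma selfadj_norm_le E (A : bop E E) x : positive_op A -> positive_op (bop_id E - A) ->
  `|A x| ^+ 2 <= dotp (A x) x.
Proof.
move=> A0 A1; have sa := positive_selfadj A0.
have := A1 (A x); have := A0 (x - A x).
have -> : (bop_id E - A) (A x) = A x - A (A x) by [].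
rewrite bopB !(dotBl, dotBr) [dotp (A (A x)) x]sa => h1 h2.
rewrite -dot_norm -subr_ge0; have := addr_ge0 h1 h2.
by congr (0 <= _); ring.
Qed.

Section Construction.
Variables (E : hilbertType R) (X : bop E E).
Hypothesis Xsa : forall x y, dotp (X x) y = dotp x (X y).
Hypothesis X1 : forall x, `|X x| <= `|x|.

(* Y |-> (X + Y^2) / 2 has the fixed point 1 - (1 - X)^(1/2); its iterates from 0 are
   dominated in norm by those of the same iteration for X = 1. *)
Fixpoint sqrt_seq m : bop E E :=
  if m is k.+1 then 2^-1 *: (X + sqrt_seq k ** sqrt_seq k) else 0.

Let sqrt_seqS m x :
  sqrt_seq m.+1 x = 2^-1 *: (X x + sqrt_seq m (sqrt_seq m x)).
Proof. by []. Qed.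

Let half_norm (x : E) : `|2^-1 *: x| = 2^-1 * `|x|.
Proof. by rewrite normrZ normfV normr_nat. Qed.

Lemma sqrt_seq_cvg :
  exists L : bop E E, forall x, sqrt_seq m x @[m --> \oo] --> L x.
Proof.
(* The scalar iteration for [X = 1]; it increases and stays below its fixed point [1]. *)
pose u := fix u m := if m is k.+1 then (1 + u k * u k) / 2 else 0 : R.
have u0 m : 0 <= u m by elim: m => //= m IH; rewrite divr_ge0// addr_ge0 ?mulr_ge0.
have u1 m : u m <= 1.
  elim: m => //= m IH; rewrite ler_pdivrMr// mul1r -[2]/(1 + 1) lerD2l.
  by rewrite mulr_ile1.
have ui m : u m <= u m.+1.
  elim: m => [|m IH]; first exact: u0.
  by rewrite [leRHS]/= [leLHS]/= ler_pM2r ?invr_gt0// lerD2l ler_pM.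
have Yn m x : `|sqrt_seq m x| <= (u m)%:C * `|x|.
  elim: m x => [|m IH] x; first by rewrite normr0 mul0r.
  rewrite sqrt_seqS half_norm ler_pdivrMl// (le_trans (ler_normD _ _))//.
  rewrite /= [(1 + _) / 2]mulrC rmorphM/= fmorphV rmorph_nat mulrA mulVKf//.
  rewrite rmorphD/= rmorph1 mulrDl mul1r lerD// rmorphM/= -mulrA.
  by rewrite (le_trans (IH _))// ler_wpM2l// lecR.
apply: (@op_limit _ _ _ _ u 1 ui u1) => m x.
elim: m x => [|m IH] x; first by rewrite subr0 [u 0%N]/= subr0; exact: (Yn 1%N).
rewrite 2!sqrt_seqS -scalerBr half_norm ler_pdivrMl// opprD addrACA subrr add0r.
(* A difference of squares [P^2 - Q^2 = P (P - Q) + (P - Q) Q], in a form that asks for no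
   commutation. *)
have -> : sqrt_seq m.+1 (sqrt_seq m.+1 x) - sqrt_seq m (sqrt_seq m x) =
  sqrt_seq m.+1 (sqrt_seq m.+1 x - sqrt_seq m x) +
  (sqrt_seq m.+1 (sqrt_seq m x) - sqrt_seq m (sqrt_seq m x)).
  by rewrite linearB addrA subrK.
rewrite (le_trans (ler_normD _ _))//.
apply: (@le_trans _ _ ((u m.+1)%:C * ((u m.+1 - u m)%:C * `|x|)
  + (u m.+1 - u m)%:C * ((u m)%:C * `|x|))).
  rewrite lerD//; first by rewrite (le_trans (Yn _ _))// ler_wpM2l ?lecR.
  by rewrite (le_trans (IH _))// ler_wpM2l ?lecR ?subr_ge0.
rewrite le_eqVlt; apply/orP; left; apply/eqP.
have -> : u m.+2 - u m.+1 = (u m.+1 * u m.+1 - u m * u m) / 2.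
  transitivity ((1 + u m.+1 * u m.+1) / 2 - (1 + u m * u m) / 2) => //.
  by move: (u m.+1) => v; field.
by rewrite !(rmorphM, rmorphB)/= fmorphV rmorph_nat; field.
Qed.

Lemma sqrt_seq_selfadj m x y : dotp (sqrt_seq m x) y = dotp x (sqrt_seq m y).
Proof.
elim: m x y => [|m IH] x y; first by rewrite dot0l dot0r.
rewrite 2!sqrt_seqS dotZl dotZr dotDl dotDr Xsa !IH.
by rewrite fmorphV rmorph_nat.
Qed.

Lemma sqrt_seq_norm m x : `|sqrt_seq m x| <= `|x|.
Proof.
elim: m x => [|m IH] x; first by rewrite normr0.
rewrite sqrt_seqS half_norm ler_pdivrMl// (le_trans (ler_normD _ _))//.
by rewrite -[2]/(1 + 1) mulrDl mul1r lerD// (le_trans (IH _)).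
Qed.

(** The limit satisfies [2 L = X + L^2], that is [(1 - L)^2 = 1 - X]; positivity of [1 - L] holds
    because [L] is a self-adjoint contraction. *)
Lemma sqrt_seq_root (L : bop E E) :
  (forall x, sqrt_seq m x @[m --> \oo] --> L x) ->
  positive_op (bop_id E - L) /\
  (bop_id E - L) ** (bop_id E - L) = bop_id E - X.
Proof.
move=> HL.
have L1 x : `|L x| <= `|x|.
  apply: le_addgt0 => e e0.
  have /cvgrPdist_lt/(_ _ e0)[N _ /(_ N (leqnn _))/= HN] := HL x.
  rewrite -(subrK (sqrt_seq N x) (L x)) (le_trans (ler_normD _ _))// addrC.
  by rewrite lerD ?sqrt_seq_norm// ltW.
have Lsa x y : dotp (L x) y = dotp x (L y).
  apply/eqP; rewrite -subr_eq0; apply/eqP.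
  apply: (@eps_eq0 _ R[i]^o _ (`|y| + `|x|)); first by rewrite addr_ge0.
  move=> e e0.
  have /cvgrPdist_lt/(_ _ e0)[N _ HN] := HL x.
  have /cvgrPdist_lt/(_ _ e0)[M _ HM] := HL y.
  pose m := maxn N M; have := HN m (leq_maxl _ _) => /= hN.
  have := HM m (leq_maxr _ _) => /= hM.
  have -> : dotp (L x) y - dotp x (L y) =
    dotp (L x - sqrt_seq m x) y - dotp x (L y - sqrt_seq m y).
    by rewrite dotBl dotBr sqrt_seq_selfadj; ring.
  rewrite (le_trans (ler_normB _ _))// mulrDl lerD//.
    by rewrite (le_trans (cauchy_schwarz _ _))// mulrC ler_wpM2l// ltW.
  by rewrite (le_trans (cauchy_schwarz _ _))// ler_wpM2l// ltW.
split=> [x|].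
  have -> : (bop_id E - L) x = x - L x by [].
  rewrite dotBl dot_norm subr_ge0 (le_trans (real_ler_norm _))//.
    by rewrite CrealE dot_conj Lsa.
  by rewrite (le_trans (cauchy_schwarz _ _))// expr2 ler_wpM2r.
have Lfix x : L x = 2^-1 *: (X x + L (L x)).
  apply: hcvg_unique (HL x) _; rewrite -(cvg_shiftS (fun m => sqrt_seq m x)).
  suff h : (fun m => X x + sqrt_seq m (sqrt_seq m x)) @ \oo --> X x + L (L x).
    by have := cvgZl_tmp (k := 2^-1) h; apply.
  apply: cvgD; first exact: cvg_cst.
  (* The squares converge strongly to the square of the limit because the iterates are uniformly
     contractive. *)
  apply/cvgrPdist_lt => e e0; have e2 : 0 < e / 2 by rewrite divr_gt0.
  have /cvgrPdist_lt/(_ _ e2)[N _ HN] := HL (L x).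
  have /cvgrPdist_lt/(_ _ e2)[M _ HM] := HL x.
  exists (maxn N M) => // m /=; rewrite geq_max => /andP[/HN /= h1 /HM /= h2].
  rewrite -(subrK (sqrt_seq m (L x)) (L (L x))) -addrA (le_lt_trans (ler_normD _ _))//.
  rewrite [e]splitr ltrD// -bopB; apply: le_lt_trans h2; exact: sqrt_seq_norm.
apply/bopP => x.
have -> : ((bop_id E - L) ** (bop_id E - L)) x = x - L x - L (x - L x) by [].
have -> : (bop_id E - X) x = x - X x by [].
rewrite bopB; have := Lfix x => /(congr1 (fun v => 2 *: v)).
rewrite scalerA divff ?pnatr_eq0// scale1r => e.
rewrite -[X x](addrK (L (L x))) -e -[2]/(1 + 1) scalerDl scale1r.
by rewrite !opprB opprD !addrA [x - L x + _]addrAC.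
Qed.

(** [B] commutes with [B^2], hence with [X], with the iterates and with [S]. For [y = B x - S x]
    this gives [(B + S) y = (B^2 - S^2) x = 0], so [B y = S y = 0] by positivity, and
    [|y|^2 = dotp y (B x - S x) = 0]. *)
Lemma sqrt_unique (S B : bop E E) :
  (forall x, x - sqrt_seq m x @[m --> \oo] --> S x) ->
  positive_op S -> S ** S = bop_id E - X ->
  positive_op B -> B ** B = bop_id E - X -> B = S.
Proof.
move=> HS S0 SS B0 BB.
have BBx x : B (B x) = x - X x by change ((B ** B) x = (bop_id E - X) x); rewrite BB.
have SSx x : S (S x) = x - X x by change ((S ** S) x = (bop_id E - X) x); rewrite SS.
have BX x : B (X x) = X (B x).
  have e v : X v = v - B (B v) by rewrite BBx opprB addrC subrK.
  by rewrite !e bopB.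
have Bm m x : B (sqrt_seq m x) = sqrt_seq m (B x).
  elim: m x => [|m IH] x; first by rewrite bop0.
  by rewrite 2!sqrt_seqS bopZ bopD BX !IH.
have BS x : B (S x) = S (B x).
  apply: hcvg_unique (HS (B x)).
  have := @bop_cvg _ _ _ B _ _ (HS x).
  by under eq_fun do rewrite bopB Bm.
apply/bopP => x; apply/eqP; rewrite -subr_eq0.
set y := B x - S x.
have By : dotp (B y) y + dotp (S y) y = 0.
  rewrite -dotDl /y !bopB BBx SSx BS.
  by rewrite addrA subrK subrr dot0l.
have /eqP := By; rewrite paddr_eq0; [|exact: B0|exact: S0].
move=> /andP[/eqP /(positive_dot_eq0 B0) By0 /eqP /(positive_dot_eq0 S0) Sy0].
apply/eqP/dot_eq0; rewrite {2}/y dotBr -(positive_selfadj B0) By0.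
by rewrite -(positive_selfadj S0) Sy0 !dot0l subrr.
Qed.

(** The third clause exhibits the root as a strong limit of polynomials in [X], from which
    intertwining relations are inherited. *)
Lemma sqrt_op_spec :
  [/\ positive_op (sqrt_op (bop_id E - X)),
      (forall x, sqrt_op (bop_id E - X) (sqrt_op (bop_id E - X) x) = x - X x) &
      forall x, x - sqrt_seq m x @[m --> \oo] --> sqrt_op (bop_id E - X) x].
Proof.
have [L HL] := sqrt_seq_cvg.
have [L0 LL] := sqrt_seq_root HL.
have HS x : x - sqrt_seq m x @[m --> \oo] --> (bop_id E - L) x.
  by apply: cvgB => //; exact: cvg_cst.
have -> : sqrt_op (bop_id E - X) = bop_id E - L.
  rewrite /sqrt_op; case: xgetP => [B -> [B0 BB]|].
    exact: sqrt_unique HS L0 LL B0 BB.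
  by move=> /(_ (bop_id E - L))[].
split=> // x; change (((bop_id E - L) ** (bop_id E - L)) x = (bop_id E - X) x).
by rewrite LL.
Qed.
End Construction.

Lemma sqrt_intertwine E F (X : bop E E) (Y : bop F F) (C : bop E F) :
  (forall x y, dotp (X x) y = dotp x (X y)) -> (forall x, `|X x| <= `|x|) ->
  (forall x y, dotp (Y x) y = dotp x (Y y)) -> (forall x, `|Y x| <= `|x|) ->
  (forall x, C (X x) = Y (C x)) ->
  forall x, C (sqrt_op (bop_id E - X) x) = sqrt_op (bop_id F - Y) (C x).
Proof.
move=> Xsa X1 Ysa Y1 CX x.
have [_ _ HX] := sqrt_op_spec Xsa X1; have [_ _ HY] := sqrt_op_spec Ysa Y1.
apply: hcvg_unique (HY (C x)).
have := @bop_cvg _ _ _ C _ _ (HX x).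
have h m v : C (sqrt_seq X m v) = sqrt_seq Y m (C v).
  elim: m v => [|m IH] v; first exact: bop0.
  change (C (2^-1 *: (X v + sqrt_seq X m (sqrt_seq X m v))) =
    2^-1 *: (Y (C v) + sqrt_seq Y m (sqrt_seq Y m (C v)))).
  by rewrite bopZ bopD CX !IH.
by under eq_fun do rewrite bopB h.
Qed.
End SquareRoots.

(** * Unitaries determined by Gram matrices *)

Section Unitaries.
Context (R : realType).
Implicit Types E F : hilbertType R.

(** Polarisation on a subspace [P], for a linear map that need not be bounded: multiplication by
    [theta] is isometric only on the complement of its kernel. *)
Lemma isometry_dot E F (P : set E) (f : E -> F) :
  (forall a x y, P x -> P y -> P (a *: x + y)) ->
  linear f -> (forall x, P x -> `|f x| = `|x|) ->
  forall x y, P x -> P y -> dotp (f x) (f y) = dotp x y.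
Proof.
move=> PP lf fn x y Px Py; apply/eqP; rewrite -subr_eq0; apply/eqP.
apply: (@polar_eq0 _ (dotp (f x) (f x) - dotp x x) _ (dotp (f y) (f x) - dotp y x)
  (dotp (f y) (f y) - dotp y y)) => e.
have := fn _ (PP e _ _ Py Px) => /(congr1 (fun r => r ^+ 2)).
rewrite -!dot_norm lf !(dotDl, dotDr) !(dotZl, dotZr) => /eqP.
by rewrite -subr_eq0 => /eqP <-; ring.
Qed.

Lemma unitary_of_isometry E F (U : bop E F) :
  (forall x, `|U x| = `|x|) -> (forall y, exists x, U x = y) -> unitary_op U.
Proof.
move=> Un Us.
have Ud x y : dotp (U x) (U y) = dotp x y.
  by apply: (@isometry_dot _ _ setT U) => //; exact: bop_linear.
have UU x : adj U (U x) = x by apply: dot_inj => y; rewrite adjPr Ud.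
split; apply/bopP => x; first exact: UU.
by have [y <-] := Us x; rewrite bop_compE UU.
Qed.

(** The linear relation generated by the pairs of [u i] and [v i]. As a relation it raises no
    question of well-definedness when the [u i] are linearly dependent. *)
Inductive pair_span E F (I : Type) (u : I -> E) (v : I -> F) : E -> F -> Prop :=
| pair_span0 : pair_span u v 0 0
| pair_spanP a i x y :
    pair_span u v x y -> pair_span u v (a *: u i + x) (a *: v i + y).

Section Gram.
Context (E F : hilbertType R) (I : Type) (u : I -> E) (v : I -> F).
Local Notation ps := (pair_span u v).

Lemma pair_span_gen i : ps (u i) (v i).
Proof.
by have := pair_spanP 1 i (pair_span0 u v); rewrite !scale1r !addr0.
Qed.

Lemma pair_span_lin a x y x' y' : ps x y -> ps x' y' -> ps (a *: x + x') (a *: y + y').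
Proof.
move=> p p'; elim: p => [|b i h k _ IH]; first by rewrite !scaler0 !add0r.
by rewrite !scalerDr !scalerA -!addrA; exact: pair_spanP.
Qed.

Lemma pair_span_sym x y : ps x y -> pair_span v u y x.
Proof. by elim=> [|a i h k _]; [exact: pair_span0|exact: pair_spanP]. Qed.

Hypothesis gram : forall i j, dotp (u i) (u j) = dotp (v i) (v j).

Lemma pair_span_norm x y : ps x y -> `|x| = `|y|.
Proof.
have gx i x' y' : ps x' y' -> dotp (u i) x' = dotp (v i) y'.
  elim=> [|a j h k _ IH]; first by rewrite !dot0r.
  by rewrite !dotDr !dotZr gram IH.
have g x' y' : ps x' y' -> forall x'' y'', ps x'' y'' -> dotp x' x'' = dotp y' y''.
  elim=> [|a j h k _ IH] x'' y'' p''; first by rewrite !dot0l.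
  by rewrite !dotDl !dotZl (gx _ _ _ p'') (IH _ _ p'').
move=> p; apply/eqP; rewrite -(@eqrXn2 _ 2)// -!dot_norm.
by rewrite (g _ _ p _ _ p).
Qed.

(* The graph of the unitary that is to map u i to v i. *)
Definition closed_pair_span x y := forall e : R[i], 0 < e ->
  exists x' y', [/\ ps x' y', `|x - x'| < e & `|y - y'| < e].

Lemma closed_pair_span_norm x y : closed_pair_span x y -> `|x| = `|y|.
Proof.
move=> p; apply/eqP; rewrite -subr_eq0; apply/eqP.
apply: (@eps_eq0 _ R[i]^o _ 2) => // e e0.
have [x' [y' [p' xx' yy']]] := p e e0.
rewrite -(subrK (`|x'|) (`|x|)) (pair_span_norm p') -addrA -(pair_span_norm p').
rewrite (le_trans (ler_normD _ _))// mulrC mulr_natr mulr2n lerD//.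
  by rewrite (le_trans (ler_dist_dist _ _))// ltW.
by rewrite (pair_span_norm p') distrC in yy' *; rewrite (le_trans (ler_dist_dist _ _))// ltW// distrC.
Qed.

Lemma closed_pair_span_lin a x y x' y' : closed_pair_span x y ->
  closed_pair_span x' y' -> closed_pair_span (a *: x + x') (a *: y + y').
Proof.
move=> p p' e e0; have a1 : 0 < `|a| + 1 by rewrite ltr_wpDl.
have e2 : 0 < e / 2 by rewrite divr_gt0.
have [z [w [q xz yw]]] := p (e / 2 / (`|a| + 1)) ltac:(by rewrite divr_gt0).
have [z' [w' [q' xz' yw']]] := p' _ e2.
have est (V : normedModType R[i]) (s t s' t' : V) : `|s - t| < e / 2 / (`|a| + 1) ->
    `|s' - t'| < e / 2 -> `|a *: s + s' - (a *: t + t')| < e.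
  move=> st st'; rewrite opprD addrACA -scalerBr (le_lt_trans (ler_normD _ _))//.
  rewrite [e in ltRHS]splitr ler_ltD// normrZ (le_trans (ler_wpM2l _ (ltW st)))//.
  by rewrite mulrCA ler_piMr ?(ltW e2)// ler_pdivrMr// mul1r lerDl.
by exists (a *: z + z'), (a *: w + w'); split; [exact: pair_span_lin|exact: est|exact: est].
Qed.

(** Totality of [u] approximates [x] by left members of the relation; their partners are Cauchy
    because the relation is isometric. *)
Lemma closed_pair_span_total :
  (forall h, (forall i, dotp h (u i) = 0) -> h = 0) ->
  forall x, exists y, closed_pair_span x y.
Proof.
move=> tot x.
have cl : closure [set x | exists y, ps x y] x.
  apply: closure_total => [|a h k [y p] [y' p']|h hs].
  - by exists 0; exact: pair_span0.
  - by exists (a *: y + y'); exact: pair_span_lin.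
  - by apply: tot => i; apply: hs; exists (v i); exact: pair_span_gen.
move/closureP : cl => cl.
have /choice[w Hw] : forall m : nat, exists w : E * F, ps w.1 w.2 /\ `|x - w.1| < m.+1%:R^-1.
  move=> m; have [|x' [y' p] xx'] := cl m.+1%:R^-1; first by rewrite invr_gt0.
  by exists (x', y').
have wN (e : R[i]) : 0 < e -> exists N, forall p, (N <= p)%N -> `|x - (w p).1| < e.
  move=> /invn_small[N HN]; exists N => p /HN; apply: lt_trans.
  by have [] := Hw p.
have [y wy] : exists y : F, (w m).2 @[m --> \oo] --> y.
  apply: cauchy_seq_lim => e e0.
  have [|N HN] := wN (e / 2); first by rewrite divr_gt0.
  exists N => p q Np Nq.
  have -> : `|(w p).2 - (w q).2| = `|(w p).1 - (w q).1|.
    have := pair_span_norm (pair_span_lin (-1) (Hw q).1 (Hw p).1).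
    by rewrite !scaleN1r [- _ + _]addrC [X in _ = `|X|]addrC => <-.
  rewrite -(subrK x (w p).1) -addrA (le_lt_trans (ler_normD _ _))//.
  by rewrite [e]splitr ltrD ?HN// distrC HN.
exists y => e e0.
have [N HN] := wN e e0; move/cvgrPdist_lt : wy => /(_ _ e0)[M _ HM].
exists (w (maxn N M)).1, (w (maxn N M)).2; split; first exact: (Hw _).1.
  by rewrite HN ?leq_maxl.
exact: (HM _ (leq_maxr _ _)).
Qed.
End Gram.

Lemma closed_pair_span_sym E F I (u : I -> E) (v : I -> F) x y :
  closed_pair_span u v x y -> closed_pair_span v u y x.
Proof.
move=> p e e0; have [x' [y' [q ? ?]]] := p e e0.
by exists y', x'; split=> //; exact: pair_span_sym.
Qed.

(** The closed relation is isometric, hence single-valued; it is everywhere defined since [u] is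
    total, and onto by the same argument with [u] and [v] exchanged. *)
Lemma gram_unitary E F I (u : I -> E) (v : I -> F) :
  (forall i j, dotp (u i) (u j) = dotp (v i) (v j)) ->
  (forall h, (forall i, dotp h (u i) = 0) -> h = 0) ->
  (forall h, (forall i, dotp h (v i) = 0) -> h = 0) ->
  exists2 U : bop E F, unitary_op U & forall i, U (u i) = v i.
Proof.
move=> gram totu totv.
have /choice[f Hf] := closed_pair_span_total gram totu.
have inj x y y' : closed_pair_span u v x y -> closed_pair_span u v x y' -> y = y'.
  move=> p p'; apply/eqP; rewrite -subr_eq0 -normr_eq0 addrC -scaleN1r.
  rewrite -(closed_pair_span_norm gram (closed_pair_span_lin (-1) p' p)).
  by rewrite scaleN1r addNr normr0.
have lf : linear f by move=> a x y; apply: inj (Hf _) _; exact: closed_pair_span_lin.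
have [|U HU] := @bop_exists _ _ _ f 1 lf.
  by move=> x; rewrite mul1r (closed_pair_span_norm gram (Hf x)).
exists U; last first.
  move=> i; rewrite HU; apply: inj (Hf _) _ => e e0.
  by exists (u i), (v i); split; [exact: pair_span_gen|rewrite subrr normr0|rewrite subrr normr0].
apply: unitary_of_isometry => [x|y].
  by rewrite HU (closed_pair_span_norm gram (Hf x)).
have gram' i j : dotp (v i) (v j) = dotp (u i) (u j) by [].
have [x /closed_pair_span_sym p] := closed_pair_span_total gram' totv y.
by exists x; rewrite HU; exact: inj (Hf x) p.
Qed.

Lemma unitary_dot E F (U : bop E F) : unitary_op U ->
  (forall x y, dotp (U x) (U y) = dotp x y) /\ (forall x y, dotp (adj U x) (adj U y) = dotp x y).
Proof.
move=> [UU UV]; split=> x y.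
  by rewrite adjP -[adj U (U y)]/((adj U ** U) y) UU.
by rewrite adjPr -[U (adj U y)]/((U ** adj U) y) UV.
Qed.

End Unitaries.

(** * Characteristic functions *)

Section AdjointNorms.
Context (R : realType).
Implicit Types E F : hilbertType R.

Lemma adj_norm_le E F (A : bop E F) (r : R[i]) : 0 <= r ->
  (forall y, `|adj A y| <= r * `|y|) -> forall x, `|A x| <= r * `|x|.
Proof.
move=> r0 h x; have [->|Ax0] := eqVneq (A x) 0; first by rewrite normr0 mulr_ge0.
have Ax : 0 < `|A x| by rewrite normr_gt0.
rewrite -(ler_pM2l Ax) -expr2 -dot_norm adjP.
apply: real_norm_le; first by rewrite -adjP dot_norm exprn_ge0.
rewrite (le_trans (cauchy_schwarz _ _))// mulrC mulrCA mulrA.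
by rewrite ler_wpM2r// mulrC.
Qed.

(** Mapping [S] into [S'] is exactly what excludes the default value of [restrict_op]. *)
Lemma val_restrict_op E F (S : closed_subspace E) (S' : closed_subspace F)
    (A : bop E F) : (forall x, cs_set S x -> cs_set S' (A x)) ->
  forall x, val (restrict_op S S' A x) = A (val x).
Proof.
move=> AS; rewrite /restrict_op; case: xgetP => [B -> //|].
have SA (x : cs_sort S) : A (val x) \in cs_pred S'.
  by rewrite inE; apply: AS; have := valP x; rewrite inE.
suff [B HB] : exists B : bop (cs_sort S) (cs_sort S'), forall x, val (B x) = A (val x).
  by move=> /(_ B).
have [||B HB] := @bop_exists R (cs_sort S) (cs_sort S') (fun x : cs_sort S => Sub (A (val x)) (SA x) : cs_sort S') (opnorm A).
- by move=> a x y; apply: val_inj; rewrite /= bopD bopZ.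
- by move=> x; rewrite !cs_normE /= opnorm_ub.
by exists B => x; rewrite HB.
Qed.

Lemma closed_map E F (A : bop E F) (P : set E) (Q : set F) :
  (forall x, P x -> Q (A x)) -> forall x, closure P x -> closure Q (A x).
Proof.
move=> PQ x /closureP Px; apply/closureP => e e0.
have [M M0 AM] := bop_bounded A; have M1 : 0 < M + 1 by rewrite ltr_wpDl.
have [y Py xy] := Px (e / (M + 1)) ltac:(by rewrite divr_gt0).
exists (A y); first exact: PQ.
rewrite -bopB (le_lt_trans (AM _))//.
apply: (@le_lt_trans _ _ ((M + 1) * `|x - y|)); first by rewrite ler_wpM2r// lerDl.
by rewrite mulrC -ltr_pdivlMr.
Qed.

Lemma inv_opP E (A B : bop E E) :
  (forall x, B x - A (B x) = x) -> (forall x, B (x - A x) = x) ->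
  (forall x, inv_op (bop_id E - A) x - A (inv_op (bop_id E - A) x) = x) /\
  (forall x, inv_op (bop_id E - A) (x - A x) = x).
Proof.
move=> h1 h2; rewrite /inv_op; case: xgetP => [C -> [/bopP C1 /bopP C2]//|].
by move=> /(_ B) []; split; apply/bopP => x; [exact: h1|exact: h2].
Qed.

End AdjointNorms.

Section Rows.
Context (R : realType) (n : nat) (H : hilbertType R).
Implicit Types (T : 'I_n -> bop H H) (z w : 'rV[R[i]]_n).

Lemma row_opE T (x : l2sum n H) : row_op T x = \sum_(i < n) T i (x i).
Proof. by rewrite /row_op bop_sumE. Qed.

Lemma l2sum_dotE (x y : l2sum n H) : dotp x y = \sum_(i < n) dotp (x i) (y i).
Proof. by []. Qed.

Lemma adj_row_opE T h : adj (row_op T) h = [ffun i => adj (T i) h] :> l2sum n H.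
Proof.
apply: dot_injr => x; rewrite -adjP row_opE dot_suml l2sum_dotE.
by apply: eq_bigr => i _; rewrite ffunE adjP.
Qed.

Lemma adj_scalar_rowE z h :
  adj (scalar_row H z) h = [ffun i => (z 0 i)^* *: h] :> l2sum n H.
Proof.
rewrite adj_row_opE; apply/ffunP => i; rewrite !ffunE.
by apply: dot_injr => x; rewrite -adjP dotZr conjCK bop_scaleE dotZl.
Qed.

Lemma adj_row_norm T h : `|adj (row_op T) h| ^+ 2 = \sum_(i < n) `|adj (T i) h| ^+ 2.
Proof. by rewrite adj_row_opE l2sum_normE; apply: eq_bigr => i _; rewrite ffunE. Qed.

Lemma le_opP T : le_op (\sum_(i < n) T i ** adj (T i)) (bop_id H) <->
  forall h, \sum_(i < n) `|adj (T i) h| ^+ 2 <= `|h| ^+ 2.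
Proof.
have e h : dotp ((bop_id H - \sum_(i < n) T i ** adj (T i)) h) h =
    `|h| ^+ 2 - \sum_(i < n) `|adj (T i) h| ^+ 2.
  rewrite bop_addE bop_oppE dotBl dot_norm bop_sumE dot_suml; congr (_ - _).
  by apply: eq_bigr => i _; rewrite bop_compE adjP dot_norm.
by split=> h k; have := h k; rewrite e subr_ge0.
Qed.

(** This is [<w, z>] of the usual notation: the conjugate falls on the first argument. *)
Definition ball_ip z w : R[i] := \sum_(i < n) (z 0 i)^* * w 0 i.

(** [W Z^*] is the scalar [<w, z>]; the factor [1 - <w, z>] of the kernel identity originates
    here. *)
Lemma adj_scalar_dot z w x y :
  dotp (adj (scalar_row H z) x) (adj (scalar_row H w) y) = ball_ip z w * dotp x y.
Proof.
rewrite !adj_scalar_rowE l2sum_dotE mulr_suml; apply: eq_bigr => i _.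
by rewrite !ffunE dotZl dotZr conjCK mulrA.
Qed.

Lemma dot_row_adj_scalar T z x y :
  dotp x (row_op T (adj (scalar_row H z) y)) = \sum_(i < n) z 0 i * dotp (adj (T i) x) y.
Proof.
rewrite -adjPr adj_scalar_rowE adj_row_opE l2sum_dotE.
by apply: eq_bigr => i _; rewrite !ffunE dotZr conjCK.
Qed.

Lemma unit_ball_sqrt z : unit_ball z ->
  exists r : R, [/\ 0 <= r, r < 1 & \sum_(i < n) `|z 0 i| ^+ 2 = (r%:C) ^+ 2].
Proof.
rewrite /unit_ball /= => z1.
have z0 : 0 <= \sum_(i < n) `|z 0 i| ^+ 2 by rewrite sumr_ge0// => i _; rewrite exprn_ge0.
have [s s0 es] := ge0_realC z0; exists (Num.sqrt s).
rewrite sqrtr_ge0 es -rmorphXn/= sqr_sqrtr//; split=> //.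
by rewrite -sqrtr1 ltr_sqrt// -ltcR -es.
Qed.

Lemma scalar_row_norm z x : `|adj (scalar_row H z) x| ^+ 2 = (\sum_(i < n) `|z 0 i| ^+ 2) * `|x| ^+ 2.
Proof.
rewrite -!dot_norm adj_scalar_dot; congr (_ * _); apply: eq_bigr => i _.
by rewrite normCK mulrC.
Qed.

End Rows.

Section CharacteristicFunction.
Context (R : realType) (n : nat) (H : hilbertType R) (T : 'I_n -> bop H H).
Hypothesis T1 : forall h, \sum_(i < n) `|adj (T i) h| ^+ 2 <= `|h| ^+ 2.

Local Notation row := (row_op T).
Local Notation D := (defect T).
Local Notation Ds := (defect_adj T).
Implicit Types z w : 'rV[R[i]]_n.

Lemma adj_row_le h : `|adj row h| <= `|h|.
Proof. by apply: norm_le_sqr => //; rewrite adj_row_norm. Qed.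

Lemma row_le h : `|row h| <= `|h|.
Proof.
rewrite -[leRHS]mul1r; apply: adj_norm_le => // y; rewrite mul1r; exact: adj_row_le.
Qed.

Let X := adj row ** row.
Let Y := row ** adj row.

Let Xsa x y : dotp (X x) y = dotp x (X y).
Proof. by rewrite !bop_compE adjPr adjP. Qed.
Let Ysa x y : dotp (Y x) y = dotp x (Y y).
Proof. by rewrite !bop_compE adjP -[RHS]adjPr. Qed.
Let X1 x : `|X x| <= `|x|.
Proof. by rewrite bop_compE (le_trans (adj_row_le _))// row_le. Qed.
Let Y1 x : `|Y x| <= `|x|.
Proof. by rewrite bop_compE (le_trans (row_le _))// adj_row_le. Qed.

Lemma defect_sa x y : dotp (D x) y = dotp x (D y).
Proof. by have [h _ _] := sqrt_op_spec Xsa X1; exact: positive_selfadj. Qed.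
Lemma defect_adj_sa x y : dotp (Ds x) y = dotp x (Ds y).
Proof. by have [h _ _] := sqrt_op_spec Ysa Y1; exact: positive_selfadj. Qed.
Lemma defect_sqr x : D (D x) = x - adj row (row x).
Proof. by have [_ h _] := sqrt_op_spec Xsa X1; exact: h. Qed.
Lemma defect_adj_sqr x : Ds (Ds x) = x - row (adj row x).
Proof. by have [_ h _] := sqrt_op_spec Ysa Y1; exact: h. Qed.
(** [row] intertwines [X] and [Y], hence the square roots of [1 - X] and [1 - Y]. *)
Lemma row_defect x : row (D x) = Ds (row x).
Proof. exact: sqrt_intertwine. Qed.
Lemma adj_row_defect x : adj row (Ds x) = D (adj row x).
Proof. exact: sqrt_intertwine. Qed.

Lemma defect_adj_norm x : `|Ds x| ^+ 2 = `|x| ^+ 2 - \sum_(i < n) `|adj (T i) x| ^+ 2.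
Proof.
by rewrite -[LHS]dot_norm defect_adj_sa defect_adj_sqr dotBr dot_norm
  -[dotp x (row _)]adjPr dot_norm adj_row_norm.
Qed.

(** [inv_pencil z] is [(1 - Z T^* )^-1] and [resolvent z] its adjoint [(1 - T Z^* )^-1]; the latter
    occurs in the adjoint of the characteristic function. *)
Definition inv_pencil z := inv_op (bop_id H - scalar_row H z ** adj row).
Definition resolvent z := adj (inv_pencil z).

(** [Z T^*] has norm at most the Euclidean norm of [z], so the Neumann series applies. *)
Lemma inv_pencilP z : unit_ball z ->
  (forall x, inv_pencil z x - scalar_row H z (adj row (inv_pencil z x)) = x) /\
  (forall x, inv_pencil z (x - scalar_row H z (adj row x)) = x).
Proof.
move=> /unit_ball_sqrt[r [r0 r1 er]].
have [|B [B1 B2]] := @neumann _ _ (scalar_row H z ** adj row) r r0 r1; last first.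
  exact: inv_opP B1 B2.
move=> x; rewrite bop_compE; apply: (@le_trans _ _ (r%:C * `|adj row x|)).
  apply: adj_norm_le; first by rewrite lecR.
  move=> y; apply: norm_le_sqr; first by rewrite mulr_ge0// lecR.
  by rewrite scalar_row_norm er exprMn.
by rewrite ler_wpM2l ?lecR// adj_row_le.
Qed.

Lemma resolventP z x : unit_ball z ->
  resolvent z x - row (adj (scalar_row H z) (resolvent z x)) = x.
Proof.
move=> /inv_pencilP[_ h]; apply: dot_injr => y.
rewrite dotBr -[dotp y (row _)]adjPr -(adjP (scalar_row H z)) -dotBl -adjP.
by rewrite h.
Qed.

(** Used to recognise the resolvent: its power series and the kernel functions of the model are both
    identified through this equation. *)
Lemma resolvent_eq z x y : unit_ball z ->
  y - row (adj (scalar_row H z) y) = x -> y = resolvent z x.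
Proof.
move=> /inv_pencilP[h _] <-; apply: dot_injr => v.
rewrite -adjP dotBr -[dotp _ (row _)]adjPr -(adjP (scalar_row H z)) -dotBl.
by rewrite h.
Qed.

Let Theta z := - row + Ds ** inv_pencil z ** scalar_row H z ** D.

(** Both summands end in the range of [Ds], the first one by [row D = Ds row]; this makes the
    restriction to the defect spaces meaningful. *)
Let ThetaD z x : exists y, Theta z (D x) = Ds y.
Proof.
exists (inv_pencil z (scalar_row H z (D (D x))) - row x).
have -> : Theta z (D x) = - row (D x) + Ds (inv_pencil z (scalar_row H z (D (D x)))) by [].
by rewrite bopB row_defect addrC.
Qed.

Let Theta_adjE z x :
  adj (Theta z) x = - adj row x + D (adj (scalar_row H z) (resolvent z (Ds x))).
Proof.
apply: dot_injr => y; rewrite -adjP.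
have -> : Theta z y = - row y + Ds (inv_pencil z (scalar_row H z (D y))) by [].
by rewrite dotDl dotDr dotNl dotNr adjP defect_adj_sa (adjP (inv_pencil z))
  (adjP (scalar_row H z)) defect_sa.
Qed.

Let Theta_map z x : cs_set (defect_space T) x -> cs_set (defect_adj_space T) (Theta z x).
Proof.
apply: closed_map => _ [y _ <-]; have [v ->] := ThetaD z y; by exists v.
Qed.

Let Theta_adj_map z x : cs_set (defect_adj_space T) x -> cs_set (defect_space T) (adj (Theta z) x).
Proof.
apply: closed_map => _ [y _ <-]; rewrite Theta_adjE adj_row_defect -[X in X + _]scaleN1r -bopZ -bopD.
by eexists.
Qed.

(** [Theta z] and its adjoint both respect the defect spaces, so the adjoint of the restriction is
    the restriction of the adjoint. *)
Lemma val_adj_char_fun z x : unit_ball z ->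
  val (adj (char_fun T z) x) =
  - adj row (val x) + D (adj (scalar_row H z) (resolvent z (Ds (val x)))).
Proof.
move=> zb; rewrite -Theta_adjE.
rewrite -(val_restrict_op (@Theta_adj_map z)); congr (val _).
apply: dot_injr => y; rewrite -adjP.
have e (K : hilbertType R) (S : closed_subspace K) (a b : cs_sort S) :
  dotp a b = dotp (val a) (val b) by [].
rewrite !e (val_restrict_op (@Theta_adj_map z)).
by rewrite (val_restrict_op (@Theta_map z)) adjP.
Qed.

(** This is the kernel identity tested on [x] and [y], in terms of adjoints alone. *)
Lemma char_fun_gram z w (x y : cs_sort (defect_adj_space T)) :
  unit_ball z -> unit_ball w ->
  dotp (adj (char_fun T z) x) (adj (char_fun T w) y) =
  dotp x y - (1 - ball_ip z w) *
    dotp (resolvent z (Ds (val x))) (resolvent w (Ds (val y))).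
Proof.
move=> zb wb.
have -> : dotp (adj (char_fun T z) x) (adj (char_fun T w) y) =
  dotp (val (adj (char_fun T z) x)) (val (adj (char_fun T w) y)) by [].
rewrite !val_adj_char_fun//.
have -> : dotp x y = dotp (val x) (val y) by [].
set p := resolvent z _; set q := resolvent w _.
move: (val x) (val y) @p @q => a b p q.
(* The resolvent equation. With [D] moved through [row] by the intertwining relation, it eliminates
   [row] from every cross term. *)
have pE : row (adj (scalar_row H z) p) = p - Ds a.
  by rewrite -[X in _ - X](resolventP (Ds a) zb) opprB addrC subrK.
have qE : row (adj (scalar_row H w) q) = q - Ds b.
  by rewrite -[X in _ - X](resolventP (Ds b) wb) opprB addrC subrK.
have dd : dotp (Ds a) (Ds b) = dotp a b - dotp (adj row a) (adj row b).
  by rewrite defect_adj_sa defect_adj_sqr dotBr adjPr.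
have t1 : dotp (adj row a) (D (adj (scalar_row H w) q)) = dotp (Ds a) q - dotp (Ds a) (Ds b).
  by rewrite -defect_sa -adj_row_defect adjPr qE dotBr.
have t2 : dotp (D (adj (scalar_row H z) p)) (adj row b) = dotp p (Ds b) - dotp (Ds a) (Ds b).
  by rewrite defect_sa -adj_row_defect -adjP pE dotBl.
have t3 : dotp (D (adj (scalar_row H z) p)) (D (adj (scalar_row H w) q)) =
    ball_ip z w * dotp p q - dotp (p - Ds a) (q - Ds b).
  by rewrite defect_sa defect_sqr dotBr adj_scalar_dot -(adjP row) pE qE.
rewrite !(dotDl, dotDr) !(dotNl, dotNr) t1 t2 t3 !(dotBl, dotBr) dd; ring.
Qed.

End CharacteristicFunction.

(** * Unconditional sums *)

Section ComplexComplete.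
Context (R : realType).
Local Notation C := (R[i]^o : normedModType R[i]).

Lemma norm_Re (x : R[i]) : `|complex.Re x|%:C <= `|x|.
Proof.
case: x => a b; rewrite normc_def lecR -sqrtr_sqr ler_wsqrtr//= lerDl exprn_even_ge0//.
Qed.

Lemma norm_Im (x : R[i]) : `|complex.Im x|%:C <= `|x|.
Proof.
case: x => a b; rewrite normc_def lecR -sqrtr_sqr ler_wsqrtr//= lerDr exprn_even_ge0//.
Qed.

Lemma norm_ReIm (x : R[i]) : `|x| <= (`|complex.Re x| + `|complex.Im x|)%:C.
Proof.
case: x => a b; rewrite normc_def lecR /= -[leRHS]ger0_norm ?addr_ge0// -sqrtr_sqr.
rewrite ler_wsqrtr// sqrrD !real_normK ?num_real// lerD2r lerDl mulrn_wge0 ?mulr_ge0//.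
Qed.

Lemma complex_complete (F : set_system C) : ProperFilter F -> cauchy F -> cvg F.
Proof.
move=> FF /cauchyP Fc.
have part (p : C -> R) : (forall x y, `|p x - p y|%:C <= `|x - y|) -> cvg (p @ F).
  move=> pn; apply: cauchy_cvg; apply/cauchyP => e e0.
  have [x Fx] := Fc e%:C ltac:(by rewrite ltcR).
  exists (p x); change (F (p @^-1` ball (p x) e)); apply: filterS Fx => y.
  by rewrite -!ball_normE/= => xy; rewrite -ltcR (le_lt_trans (pn _ _)).
have reF : cvg (@complex.Re R @ F).
  by apply: part => x y; apply: le_trans (norm_Re _); case: x y => [? ?] [? ?].
have imF : cvg (@complex.Im R @ F).
  by apply: part => x y; apply: le_trans (norm_Im _); case: x y => [? ?] [? ?].
apply/cvg_ex; exists (Complex (lim (@complex.Re R @ F)) (lim (@complex.Im R @ F)) : C).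
apply/cvgrPdist_lt => e e0.
have [r r0 er] := ge0_realC (ltW e0); have {}r0 : 0 < r by rewrite -ltcR -er.
have r2 : 0 < r / 2 by rewrite divr_gt0.
move/cvgrPdist_lt : reF => /(_ _ r2); move/cvgrPdist_lt : imF => /(_ _ r2).
apply: filterS2 => -[a b] /= h1 h2.
rewrite (le_lt_trans (norm_ReIm _))// er ltcR /= [r]splitr.
by rewrite ltrD.
Qed.

End ComplexComplete.

Section HasSum.
Context (R : realType) (n : nat).
Local Notation C := R[i].
Local Notation I := (multiindex n).
Implicit Types (V : normedModType C) (J K : {fset I}).

Local Existing Instance summability.totally_filter.
Local Notation psum a J := (\sum_(i <- enum_fset J) a i).

Lemma partial_sumE V (a : I -> V) J : summability.partial_sum a J = psum a J.
Proof. by rewrite /summability.partial_sum big_seq_fsetE. Qed.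

Lemma has_sumP V (a : I -> V) s : has_sum a s <->
  forall e : C, 0 < e -> exists J, forall J', (J `<=` J')%fset -> `|s - psum a J'| < e.
Proof.
split=> [/cvgrPdist_lt h e e0|h].
  by have [J _ HJ] := h e e0; exists J => J' JJ'; rewrite -partial_sumE; exact: HJ.
apply/cvgrPdist_lt => e e0; have [J HJ] := h e e0.
by exists J => // J' JJ'; rewrite /= partial_sumE; exact: HJ.
Qed.

Lemma has_sum_unique V (a : I -> V) s t : has_sum a s -> has_sum a t -> s = t.
Proof. by move=> sa ta; exact: (cvg_unique (@norm_hausdorff _ _) sa ta). Qed.

Lemma eq_has_sum V (a b : I -> V) s : a =1 b -> has_sum a s -> has_sum b s.
Proof. by move=> /funext ->. Qed.

Lemma has_sum_lin V (c : C) (a b : I -> V) s t :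
  has_sum a s -> has_sum b t -> has_sum (fun k => c *: a k + b k) (c *: s + t).
Proof.
move=> sa tb; rewrite /has_sum.
have -> : summability.partial_sum (fun k => c *: a k + b k) =
   (fun J => c *: summability.partial_sum a J + summability.partial_sum b J).
  by apply/funext => J; rewrite !partial_sumE scaler_sumr big_split.
by apply: cvgD => //; apply: cvgZl_tmp.
Qed.

Lemma has_sum0 V : has_sum (fun _ : I => 0 : V) 0.
Proof.
apply/has_sumP => e e0; exists fset0 => J _.
by rewrite big1// subrr normr0.
Qed.

Lemma has_sumZ V (c : C) (a : I -> V) s :
  has_sum a s -> has_sum (fun k => c *: a k) (c *: s).
Proof.
move=> h; have := has_sum_lin (c := c) h (@has_sum0 V); rewrite addr0.
by apply: eq_has_sum => k; rewrite addr0.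
Qed.

Lemma has_sumD V (a b : I -> V) s t :
  has_sum a s -> has_sum b t -> has_sum (fun k => a k + b k) (s + t).
Proof.
move=> h g; have := has_sum_lin (c := 1) h g; rewrite scale1r.
by apply: eq_has_sum => k; rewrite scale1r.
Qed.

Lemma has_sum_sum V m (a : 'I_m -> I -> V) (s : 'I_m -> V) :
  (forall i, has_sum (a i) (s i)) ->
  has_sum (fun k => \sum_(i < m) a i k) (\sum_(i < m) s i).
Proof.
elim: m a s => [|m IH] a s h.
  by rewrite big_ord0; apply: eq_has_sum (@has_sum0 V) => k; rewrite big_ord0.
rewrite big_ord_recl; apply: eq_has_sum (has_sumD (h ord0) (IH _ _ (fun i => h (lift ord0 i)))).
by move=> k; rewrite big_ord_recl.
Qed.

(** Only additivity is asked of [f], so that conjugation is covered too. *)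
Lemma has_sum_map V (W : normedModType C) (f : V -> W) (M : C) (a : I -> V) s :
  {morph f : x y / x + y} -> (forall x, `|f x| <= M * `|x|) -> 0 <= M ->
  has_sum a s -> has_sum (fun k => f (a k)) (f s).
Proof.
move=> fD fM M0 /has_sumP h; apply/has_sumP => e e0.
have M1 : 0 < M + 1 by rewrite ltr_wpDl.
have f0 : f 0 = 0 by apply: (addrI (f 0)); rewrite -fD !addr0.
have fN x : f (- x) = - f x by apply: (addrI (f x)); rewrite -fD !subrr.
have [|J HJ] := h (e / (M + 1)); first by rewrite divr_gt0.
exists J => J' /HJ {}h; rewrite -(big_morph f fD f0) -fN -fD.
apply: le_lt_trans (fM _) _; apply: (@le_lt_trans _ _ ((M + 1) * `|s - psum a J'|)).
  by rewrite ler_wpM2r// lerDl.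
by rewrite mulrC -ltr_pdivlMr.
Qed.

Lemma has_sum_bop (E F : hilbertType R) (A : bop E F) (a : I -> E) s :
  has_sum a s -> has_sum (fun k => A (a k)) (A s).
Proof.
have [M M0 AM] := bop_bounded A; apply: has_sum_map AM M0.
by move=> x y; exact: bopD.
Qed.

Lemma has_sum_dotl (E : hilbertType R) (a : I -> E) s (v : E) :
  has_sum a s -> has_sum (fun k => dotp (a k) v : C^o) (dotp s v).
Proof.
apply: (@has_sum_map _ C^o (fun x => dotp x v) `|v|) => // [x y|x].
  exact: dotDl.
by rewrite mulrC; exact: cauchy_schwarz.
Qed.

Lemma has_sum_single V (k0 : I) (v : V) : has_sum (fun k => if k == k0 then v else 0) v.
Proof.
apply/has_sumP => e e0; exists [fset k0]%fset => J' kJ.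
have k0J : k0 \in enum_fset J' by apply: (fsubsetP kJ); rewrite inE.
rewrite (bigD1_seq k0) ?fset_uniq//= eqxx big1 ?addr0 ?subrr ?normr0//.
by move=> k /negbTE ->.
Qed.

(** [f] is a bijection from all indices onto those satisfying [p], with inverse [g]. Raising one
    exponent is such a map, which turns multiplication by a coordinate into a reindexing. *)
Lemma has_sum_reindex V (a : I -> V) s (p : pred I) (f g : I -> I) :
  (forall k, p (f k)) -> (forall k, g (f k) = k) -> (forall l, p l -> f (g l) = l) ->
  has_sum a s -> has_sum (fun l => if p l then a (g l) else 0) s.
Proof.
move=> pf gf fg /has_sumP h; apply/has_sumP => e e0.
have [J HJ] := h e e0; exists (f @` J)%fset => J' fJ.
have -> : psum (fun l => if p l then a (g l) else 0) J' =
          psum a (g @` [fset l in J' | p l])%fset.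
  rewrite big_imfset/= => [|x y]; last first.
    by rewrite !inE /= => /andP[_ px] /andP[_ py] /(congr1 f); rewrite !fg.
  by rewrite -big_mkcond big_fset_condE.
apply: HJ; apply/fsubsetP => k kJ; apply/imfsetP; exists (f k); rewrite ?gf//.
by rewrite !inE pf andbT; apply: (fsubsetP fJ); apply: in_imfset.
Qed.

End HasSum.

(** * Absolute convergence *)

Section AbsoluteSums.
Context (R : realType) (n : nat).
Local Notation C := R[i].
Local Notation I := (multiindex n).
Implicit Types (V : normedModType C) (J K : {fset I}).
Local Existing Instance summability.totally_filter.
Local Notation psum a J := (\sum_(i <- enum_fset J) a i).

Lemma psum_sub (V : zmodType) (a : I -> V) J K : (J `<=` K)%fset ->
  psum a K = psum a J + psum a (K `\` J)%fset.
Proof.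
move=> JK; rewrite (big_fsetID _ (mem J)) /=; congr (_ + _); apply: eq_fbigl => k.
  rewrite !inE /=; apply/andP/idP => [[]//|kJ]; split=> //; exact: (fsubsetP JK).
by rewrite !inE /= andbC.
Qed.

Lemma psum_le (a : I -> C) J K : (forall k, 0 <= a k) -> (J `<=` K)%fset ->
  psum a J <= psum a K.
Proof. by move=> a0 /psum_sub ->; rewrite lerDl sumr_ge0. Qed.

(** [J0] attains the supremum of the partial sums up to [e]. *)
Lemma bounded_tail (c : I -> C) M : (forall k, 0 <= c k) ->
  (forall J, psum c J <= M) ->
  forall e : C, 0 < e -> exists J0, forall J, (J0 `<=` J)%fset -> psum c (J `\` J0)%fset < e.
Proof.
move=> c0 cM e e0; have [r r0 er] := ge0_realC (ltW e0).
have {}r0 : 0 < r by rewrite -ltcR -er.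
have p0 J : 0 <= psum c J by rewrite sumr_ge0.
have pR J : psum c J = (complex.Re (psum c J))%:C by rewrite RRe_real ?ger0_real.
pose S := [set complex.Re (psum c J) | J in [set: {fset I}]].
have uS : ubound S (complex.Re M).
  move=> _ [J _ <-]; have := cM J; rewrite lecE => /andP[_]; exact.
have hS : has_sup S by split; [exists (complex.Re (psum c fset0)), fset0|exists (complex.Re M)].
have [_ [J0 _ <-] h] := sup_adherent r0 hS.
exists J0 => J J0J; have := psum_sub c J0J => e1.
have -> : psum c (J `\` J0)%fset = psum c J - psum c J0 by rewrite e1 addrAC subrr add0r.
rewrite pR [X in _ - X]pR er -rmorphB/= ltcR ltrBlDr -ltrBlDl.
by apply: le_lt_trans h; rewrite lerB//; apply: ub_le_sup; [exists (complex.Re M)|exists J].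
Qed.

(** Completeness is passed as a hypothesis so that one argument serves Hilbert spaces and the
    scalars. *)
Lemma abs_has_sum V (a : I -> V) M :
  (forall F : set_system V, ProperFilter F -> cauchy F -> cvg F) ->
  (forall J, psum (fun k => `|a k|) J <= M) -> exists s, has_sum a s.
Proof.
move=> cV aM; suff: cvg (summability.partial_sum a @ summability.totally).
  by move=> cs; exists (lim (summability.partial_sum a @ summability.totally)).
apply: cV; apply/cauchyP => e e0.
have [J0 HJ] := bounded_tail (fun k => normr_ge0 (a k)) aM e0.
exists (psum a J0); exists J0 => // J /= J0J.
rewrite -ball_normE/= partial_sumE (psum_sub a J0J) opprD addNKr normrN.
by apply: le_lt_trans (HJ J J0J); exact: ler_norm_sum.
Qed.

Lemma abs_has_sum_hilbert (E : hilbertType R) (a : I -> E) M :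
  (forall J, psum (fun k => `|a k|) J <= M) -> exists s, has_sum a s.
Proof. by apply: abs_has_sum => F FF; exact: cauchy_cvg. Qed.

Lemma abs_has_sum_complex (a : I -> C^o) M :
  (forall J, psum (fun k => `|a k|) J <= M) -> exists s, has_sum a s.
Proof. by apply: abs_has_sum => F FF; exact: complex_complete. Qed.

Lemma has_sum_conj (a : I -> C^o) s : has_sum a s -> has_sum (fun k => (a k)^* : C^o) (s^*).
Proof.
apply: (@has_sum_map _ _ C^o C^o (fun x : C => x^*) 1) => // [x y|x].
  exact: rmorphD.
by rewrite mul1r norm_conjC.
Qed.

Lemma has_sum_ge (c : I -> C^o) s : (forall k, 0 <= c k) -> has_sum c s ->
  forall J, psum c J <= s.
Proof.
move=> c0 cs J.
(* The order being partial, [s] has to be real before it can be compared: it equals its conjugate by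
   uniqueness of sums. *)
have sR : s \is Num.real.
  apply/CrealP; apply: has_sum_unique (has_sum_conj cs) _.
  by apply: eq_has_sum cs => k; rewrite conj_Creal// ger0_real.
apply: le_addgt0 => e e0; have [J0 HJ] := (has_sumP c s).1 cs e e0.
apply: (@le_trans _ _ (psum c (J `|` J0)%fset)); first by rewrite psum_le ?fsubsetUl.
have := HJ (J `|` J0)%fset (fsubsetUr _ _); rewrite distrC => h.
rewrite -lerBlDl; apply: le_trans (ltW h); apply: real_ler_norm.
by rewrite rpredB// ger0_real// sumr_ge0.
Qed.

Lemma has_sum_norm_le V (a : I -> V) s M : has_sum a s ->
  (forall J, `|psum a J| <= M) -> `|s| <= M.
Proof.
move=> /has_sumP h aM; apply: le_addgt0 => e e0; have [J HJ] := h e e0.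
rewrite -(subrK (psum a J) s) (le_trans (ler_normD _ _))// addrC lerD// ltW//.
exact: HJ.
Qed.

Lemma has_sum_le (c : I -> C^o) s M : (forall k, 0 <= c k) -> has_sum c s ->
  (forall J, psum c J <= M) -> s <= M.
Proof.
move=> c0 cs cM; have := has_sum_ge c0 cs fset0; rewrite big_seq_fset0 => s0.
rewrite -(ger0_norm s0); apply: (has_sum_norm_le cs) => J.
by rewrite ger0_norm ?sumr_ge0.
Qed.

Lemma has_sum_ge0 (c : I -> C^o) s : (forall k, 0 <= c k) -> has_sum c s -> 0 <= s.
Proof. by move=> c0 cs; have := has_sum_ge c0 cs fset0; rewrite big_seq_fset0. Qed.

Lemma ge0_has_sum (c : I -> C^o) M : (forall k, 0 <= c k) ->
  (forall J, psum c J <= M) -> exists2 s, has_sum c s & s <= M.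
Proof.
move=> c0 cM; have [|s cs] := @abs_has_sum_complex c M.
  by move=> J; under eq_bigr do rewrite ger0_norm//.
by exists s => //; exact: has_sum_le cs cM.
Qed.

(* Unconditional convergence of scalars is absolute: sums over sets that avoid a
   finite set are bounded, and so are the sums of the positive and of the negative
   real and imaginary parts. *)
Lemma has_sum_abs_bounded (a : I -> C^o) s : has_sum a s ->
  exists2 M, 0 <= M & forall J, psum (fun k => `|a k|) J <= M.
Proof.
move=> /has_sumP/(_ 1 ltr01)[J0 HJ].
(* The [2] accounts for indices outside [J0]: a sum over them is a difference of two errors, each
   below [1]. *)
pose B := psum (fun k => `|a k|) J0 + 2.
have B0 : 0 <= B by rewrite addr_ge0// sumr_ge0.
have sub J : `|psum a J| <= B.
  rewrite (big_fsetID _ (mem J0)) /= (le_trans (ler_normD _ _))// lerD//.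
    rewrite (le_trans (ler_norm_sum _ _ _))//; apply: psum_le => //.
    by apply/fsubsetP => k; rewrite !inE => /andP[].
  set J' := [fset x in J | x \notin J0]%fset.
  have -> : psum a J' = (s - psum a J0) - (s - psum a (J0 `|` J')%fset).
    rewrite [X in _ - (_ - X)](@psum_sub _ _ J0) ?fsubsetUl//.
    have -> : ((J0 `|` J') `\` J0 = J')%fset.
      apply/fsetP => k; rewrite !inE.
      by case: (k \in J0) => //=; rewrite ?andbF ?andbT.
    by rewrite opprB addrC subrKA addrAC subrr add0r.
  rewrite (le_trans (ler_normB _ _))// -[2]/(1 + 1) lerD// ltW// HJ//.
  exact: fsubsetUl.
have part (p : {additive C -> R}) : (forall x, `|p x|%:C <= `|x|) ->
    forall J, (\sum_(k <- enum_fset J) `|p (a k)|)%:C <= B + B.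
  move=> pn J; rewrite (big_fsetID _ (fun k => 0 <= p (a k))) /= rmorphD/= lerD//.
    apply: le_trans (sub [fset k in J | 0 <= p (a k)]%fset).
    apply: le_trans (pn _); rewrite lecR raddf_sum.
    rewrite big_seq [X in _ <= `|X|]big_seq; apply: le_trans (ler_norm _).
    by apply: ler_sum => k; rewrite !inE/= => /andP[_ k0]; rewrite ger0_norm.
  apply: le_trans (sub [fset k in J | ~~ (0 <= p (a k))]%fset).
  apply: le_trans (pn _); rewrite lecR raddf_sum -normrN -sumrN.
  rewrite big_seq [X in _ <= `|X|]big_seq; apply: le_trans (ler_norm _).
  apply: ler_sum => k; rewrite !inE/= => /andP[_]; rewrite -ltNge => k0.
  by rewrite ltr0_norm.
exists (B + B + (B + B)); first by apply: addr_ge0; apply: addr_ge0.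
move=> J; apply: (@le_trans _ _ (psum (fun k => (`|complex.Re (a k)| + `|complex.Im (a k)|)%:C) J)).
  by apply: ler_sum => k _; exact: norm_ReIm.
rewrite -rmorph_sum/= big_split rmorphD/= lerD//.
  exact: (part (@complex.Re R) (@norm_Re R)).
exact: (part (@complex.Im R) (@norm_Im R)).
Qed.

End AbsoluteSums.

(** * Power series *)

Section PowerSeries.
Context (R : realType) (n : nat).
Local Notation C := R[i].
Local Notation I := (multiindex n).
Implicit Types (J K : {fset I}) (z w x : 'rV[C]_n) (k l : I) (i j : 'I_n).
Local Notation psum a J := (\sum_(i <- enum_fset J) a i).

Definition incr k i : I := [ffun j => (k j + (j == i))%N].
(** Truncated subtraction leaves [l] unchanged when [l i = 0]; hence the guards [0 < l i] below. *)
Definition decr l i : I := [ffun j => (l j - (j == i))%N].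
Definition mdeg k : nat := (\sum_(i < n) k i)%N.

Lemma incrK k i : decr (incr k i) i = k.
Proof. by apply/ffunP => j; rewrite !ffunE addnK. Qed.

Lemma decrK l i : (0 < l i)%N -> incr (decr l i) i = l.
Proof.
move=> li; apply/ffunP => j; rewrite !ffunE subnK//.
by case: eqP => [->|].
Qed.

Lemma incr_gt0 k i : (0 < incr k i i)%N.
Proof. by rewrite ffunE eqxx addn1. Qed.

Lemma mdeg_incr k i : mdeg (incr k i) = (mdeg k).+1.
Proof.
rewrite /mdeg; under eq_bigr do rewrite ffunE.
rewrite big_split /= -addn1; congr addn.
by rewrite (bigD1 i)//= eqxx big1 ?addn0// => j /negbTE ->.
Qed.

Lemma monomial_incr z k i : monomial z (incr k i) = z 0 i * monomial z k.
Proof.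
rewrite /monomial; under eq_bigr do rewrite ffunE exprD.
rewrite big_split /= mulrC; congr (_ * _).
by rewrite (bigD1 i)//= eqxx expr1 big1 ?mulr1// => j /negbTE ->; rewrite expr0.
Qed.

Lemma gamma_incr k i :
  gamma R k * (mdeg k).+1%:R = gamma R (incr k i) * (k i).+1%:R.
Proof.
have := mdeg_incr k i; rewrite /gamma /mdeg => ->; rewrite factS.
have -> : (\prod_(j < n) (incr k i j)`! = (k i).+1 * \prod_(j < n) (k j)`!)%N.
  rewrite (bigD1 i)//= [in RHS](bigD1 i)//= ffunE eqxx addn1 factS mulnA.
  by congr muln; apply: eq_bigr => j /negbTE ji; rewrite ffunE ji addn0.
rewrite !natrM; field; rewrite ?pnatr_eq0/=.
by rewrite -lt0n prodn_gt0 => [|j]; rewrite ?fact_gt0// nat1r pnatr_eq0.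
Qed.

Lemma gamma_gt0 k : 0 < gamma R k.
Proof.
rewrite /gamma divr_gt0 ?ltr0n ?fact_gt0// prodn_gt0// => j; exact: fact_gt0.
Qed.

Lemma mdeg_gt0 l i : (0 < l i)%N -> (0 < mdeg l)%N.
Proof. by move=> li; rewrite /mdeg (bigD1 i)//= addn_gt0 li. Qed.

Lemma gamma_decr l i : (0 < l i)%N ->
  gamma R (decr l i) = gamma R l * (l i)%:R / (mdeg l)%:R.
Proof.
move=> li; have := gamma_incr (decr l i) i; rewrite -(mdeg_incr _ i) decrK//.
have -> : (decr l i i).+1 = l i by rewrite ffunE eqxx subn1 prednK.
by move=> <-; rewrite mulfK// pnatr_eq0 -lt0n (mdeg_gt0 li).
Qed.

(** Pascal's rule for multinomial coefficients; it amounts to [sum_i l_i = mdeg l]. *)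
Lemma gamma_pascal l : (0 < mdeg l)%N ->
  gamma R l = \sum_(i < n) (if (0 < l i)%N then gamma R (decr l i) else 0).
Proof.
move=> l0.
rewrite (eq_bigr (fun i => gamma R l / (mdeg l)%:R * (l i)%:R)) => [|i _].
  by rewrite -mulr_sumr -natr_sum -/(mdeg l) divfK// pnatr_eq0 -lt0n.
case: ltnP => [li|]; first by rewrite gamma_decr// mulrAC.
by rewrite leqn0 => /eqP ->; rewrite mulr0.
Qed.

Lemma mdeg_eq0 l : mdeg l = 0%N -> l = [ffun=> 0%N].
Proof.
move=> l0; apply/ffunP => j; rewrite ffunE.
by move/eqP: l0; rewrite /mdeg sum_nat_eq0 => /forallP/(_ j)/eqP.
Qed.

Lemma mdeg0 : mdeg [ffun=> 0%N] = 0%N.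
Proof. by rewrite /mdeg big1// => j _; rewrite ffunE. Qed.

Lemma monomial0 z : monomial z [ffun=> 0%N] = 1.
Proof. by rewrite /monomial big1// => j _; rewrite ffunE expr0. Qed.

Lemma gamma0 : gamma R ([ffun=> 0%N] : I) = 1.
Proof.
rewrite /gamma big1 => [|j _]; last by rewrite ffunE.
by rewrite big1 ?fact0 ?divr1// => j _; rewrite ffunE fact0.
Qed.

Lemma monomial_decr z l i : (0 < l i)%N -> monomial z l = z 0 i * monomial z (decr l i).
Proof. by move=> li; rewrite -monomial_incr decrK. Qed.

Lemma monomial_ge0 x k : (forall i, 0 <= x 0 i) -> 0 <= monomial x k.
Proof. by move=> x0; rewrite prodr_ge0// => i _; rewrite exprn_ge0. Qed.

Lemma has_sum_shift (V : normedModType C) (a : I -> V) s i : has_sum a s ->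
  has_sum (fun l => if (0 < l i)%N then a (decr l i) else 0) s.
Proof.
apply: (has_sum_reindex (fun k => incr_gt0 k i) (fun k => incrK k i)).
by move=> l; exact: decrK.
Qed.

(** The full series is geometric, with sum [1 / (1 - sum_i x_i)]. Finite sums are bounded by
    induction on the degree: Pascal's rule reduces a sum over [J] to at most [1 + r s], where [s]
    bounds the sums of lower degree, and [(1 - r)^-1] is the fixed point of [s = 1 + r s]. *)
Lemma gamma_monomial_bounded x (r : C) : (forall i, 0 <= x 0 i) ->
  \sum_(i < n) x 0 i <= r -> r < 1 ->
  forall J, psum (fun k => gamma R k * monomial x k) J <= (1 - r)^-1.
Proof.
move=> x0 xr r1 J.
have r0 : 0 <= r by apply: le_trans xr; rewrite sumr_ge0.
have i0 : 0 <= (1 - r)^-1 by rewrite invr_ge0 subr_ge0 ltW.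
pose c k : C := gamma R k * monomial x k.
have c0 k : 0 <= c k by rewrite mulr_ge0 ?monomial_ge0// ltW// gamma_gt0.
have [m Hm] : exists m, forall k, k \in J -> (mdeg k < m)%N.
  exists (\max_(k <- enum_fset J) mdeg k).+1 => k kJ; rewrite ltnS.
  exact: (@leq_bigmax_seq _ (enum_fset J) predT mdeg).
elim: m J Hm => [|m IH] J Hm.
  by rewrite big_seq big1// => k /Hm.
have cE l : c l <= (if l == [ffun=> 0%N] then 1 else 0) +
    \sum_(i < n) x 0 i * (if (0 < l i)%N then c (decr l i) else 0).
  have [l0|] := posnP (mdeg l).
    rewrite (mdeg_eq0 l0) eqxx /c monomial0 gamma0 mulr1 lerDl sumr_ge0// => i _.
    apply: mulr_ge0; first exact: x0.
    by case: ifP => _; [exact: c0|exact: lexx].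
  move=> l0; have -> : (l == [ffun=> 0%N]) = false.
    by apply/negbTE; apply: contraL l0 => /eqP ->; rewrite mdeg0.
  rewrite add0r {1}/c gamma_pascal// mulr_suml ler_sum// => i _.
  case: ltnP => li; last by rewrite mul0r mulr0.
  by rewrite (monomial_decr _ li) /c mulrCA.
apply: (le_trans (ler_sum _ (fun l _ => cE l))).
rewrite big_split /= exchange_big /=.
have eI : (1 - r)^-1 = 1 + r * (1 - r)^-1.
  by field; rewrite subr_eq0 gt_eqF.
rewrite eI lerD//.
  rewrite -big_mkcond /= big_fset_condE.
  apply: (@le_trans _ _ (\sum_(k <- [fset ([ffun=> 0%N] : I)]%fset) 1)).
    rewrite [leRHS](psum_sub _ (J := [fset x in J | x == [ffun=> 0%N]]%fset)); last first.
      by apply/fsubsetP => k; rewrite !inE => /andP[].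
    by rewrite lerDl sumr_ge0.
  by rewrite big_seq_fset1.
apply: (@le_trans _ _ (\sum_(i < n) x 0 i * (1 - r)^-1)); last first.
  by rewrite -mulr_suml ler_wpM2r.
apply: ler_sum => i _; rewrite -mulr_sumr ler_wpM2l//.
rewrite -big_mkcond /= big_fset_condE.
have -> : \sum_(l <- [fset l in J | (0 < l i)%N]%fset) c (decr l i) =
    psum c ((fun l => decr l i) @` [fset l in J | (0 < l i)%N])%fset.
  rewrite [RHS]big_imfset/= => [|k l]; last first.
    rewrite !inE /= => /andP[_ pk] /andP[_ pl].
    by move=> /(congr1 (fun v => incr v i)); rewrite !decrK.
  by [].
apply: IH => k /imfsetP[l /=]; rewrite !inE => /andP[lJ li] ->.
by have := Hm l lJ; rewrite -{1}(decrK li) mdeg_incr ltnS.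
Qed.

(* As t -> 0, the lowest-degree slice of sum_k t^(d k) c_k dominates. *)
Lemma has_sum_slice (c : I -> C^o) (d : I -> nat) (B : C) : 0 <= B ->
  (forall J, psum (fun k => `|c k|) J <= B) ->
  (forall t : C, 0 < t -> t <= 1 -> has_sum (fun k => t ^+ d k * c k : C^o) 0) ->
  forall m, has_sum (fun k => if d k == m then c k else 0 : C^o) 0.
Proof.
move=> B0 cB ct m; have [p le_mp] := ubnP m; elim: p m le_mp => // p IH m.
rewrite ltnS => mp; apply/has_sumP => e e0.
have B1 : 0 < B + 1 by rewrite ltr_wpDl.
have e2 : 0 < e / 2 by rewrite divr_gt0.
(* [t * B <= e / 2] controls the terms with [d k > m], which carry a factor [t ^+ m.+1]; the summand
   [e / 2] in the denominator ensures [t <= 1]. *)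
have [t [t0 t1 tB]] : exists t : C, [/\ 0 < t, t <= 1 & t * B <= e / 2].
  have B2 : 0 < B + 1 + e / 2 by exact: addr_gt0.
  exists (e / 2 / (B + 1 + e / 2)); split.
  - exact: divr_gt0.
  - by rewrite ler_pdivrMr// mul1r lerDr ltW.
  - rewrite mulrAC ler_pdivrMr// ler_wpM2l ?(ltW e2)//.
    by rewrite -addrA lerDl addr_ge0// ltW.
(* The slices below [m] vanish by induction and are subtracted from the series. *)
have hlow : has_sum (fun k => \sum_(q < m) (t ^+ q *: (if d k == q then c k else 0) : C^o)) 0.
  have h0 (q : 'I_m) : has_sum (fun k => t ^+ q *: (if d k == q then c k else 0 : C^o)) 0.
    rewrite -[X in has_sum _ X](scaler0 _ (t ^+ q)); apply: (@has_sumZ R n C^o); apply: IH.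
    exact: leq_trans (ltn_ord q) mp.
  by have := has_sum_sum h0; rewrite big1.
have htot := has_sum_lin (c := -1) hlow (ct t t0 t1).
have {htot} /has_sumP h : has_sum (fun k => if (d k < m)%N then 0 else t ^+ d k * c k : C^o) 0.
  move: htot; rewrite scaler0 addr0; apply: eq_has_sum => k; case: ltnP => dm.
    rewrite (bigD1 (Ordinal dm))//= eqxx big1 ?addr0 ?scaleN1r ?addNr// => q.
    by rewrite -val_eqE/= eq_sym => /negbTE ->; rewrite scaler0.
  rewrite big1 ?scaler0 ?add0r// => q _.
  by rewrite gtn_eqF ?scaler0//; exact: leq_trans (ltn_ord q) dm.
have tm : 0 < t ^+ m by rewrite exprn_gt0.
have [|J0 HJ] := h (t ^+ m * (e / 2)); first by rewrite mulr_gt0.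
exists J0 => J /HJ; rewrite !sub0r !normrN => hJ.
rewrite -(ltr_pM2l tm) -[X in X * `|_|](ger0_norm (ltW tm)) -normrM mulr_sumr.
have -> : \sum_(k <- enum_fset J) t ^+ m * (if d k == m then c k else 0) =
   \sum_(k <- enum_fset J) (if (d k < m)%N then 0 else t ^+ d k * c k) -
   \sum_(k <- enum_fset J) (if (m < d k)%N then t ^+ d k * c k else 0).
  rewrite -sumrB; apply: eq_bigr => k _.
  by case: ltngtP => [||->]; rewrite ?mulr0 ?subrr ?subr0.
rewrite (le_lt_trans (ler_normB _ _))// [e in ltRHS]splitr mulrDr ltr_leD//.
rewrite (le_trans (ler_norm_sum _ _ _))//.
apply: (@le_trans _ _ (\sum_(k <- enum_fset J) t ^+ m.+1 * `|c k|)).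
  apply: ler_sum => k _; case: ltnP => md; last first.
    by rewrite normr0 mulr_ge0// exprn_ge0// ltW.
  rewrite normrM ler_wpM2r// normrX ger0_norm ?(ltW t0)//.
  by rewrite ler_wiXn2l// ltW.
rewrite -mulr_sumr exprSr -mulrA ler_wpM2l ?(ltW tm)// (le_trans _ tB)//.
by rewrite ler_wpM2l// ltW.
Qed.

(** On this ball [sum_k gamma_k |z^k|] converges, which suffices for the absolute convergence of the
    resolvent series of contractive powers. *)
Definition l1_ball z := \sum_(i < n) `|z 0 i| < 1.

Lemma l1_ball_unit z : l1_ball z -> unit_ball z.
Proof.
move=> z1; rewrite /unit_ball /=; apply: le_lt_trans (z1); apply: ler_sum => i _.
have [h|h] := boolP (`|z 0 i| <= 1); first by rewrite expr2 ler_piMr.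
move: z1; rewrite /l1_ball (bigD1 i)//= => z1.
have : `|z 0 i| <= 1.
  by apply/ltW; apply: le_lt_trans z1; rewrite lerDl sumr_ge0.
by rewrite (negbTE h).
Qed.

(** Scaling only the [j]-th coordinate by [t] grades the series by the exponent [k j] and stays
    inside the ball. *)
Lemma has_sum_coord_slice (a : I -> C^o) j m :
  (forall z, l1_ball z -> has_sum (fun k => monomial z k * a k : C^o) 0) ->
  forall z, l1_ball z ->
    has_sum (fun k => monomial z k * (if k j == m then a k else 0) : C^o) 0.
Proof.
move=> h z zD; have [B B0 HB] := has_sum_abs_bounded (h z zD).
have := @has_sum_slice (fun k => monomial z k * a k) (fun k => k j) B B0 HB _ m.
move=> h'; apply: eq_has_sum (h' _) => [k|t t0 t1].
  by case: ifP; rewrite ?mulr0.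
pose z' : 'rV[C]_n := \row_i (if i == j then t * z 0 i else z 0 i).
apply: eq_has_sum (h z' _) => [k|].
  rewrite mulrA; congr (_ * _); rewrite /monomial (bigD1 j)//= [in RHS](bigD1 j)//=.
  rewrite mxE eqxx exprMn mulrA; congr (_ * _).
  by apply: eq_bigr => i /negbTE ij; rewrite mxE ij.
apply: le_lt_trans zD; apply: ler_sum => i _; rewrite mxE; case: eqP => // _.
by rewrite normrM ler_piMl// ger0_norm// ltW.
Qed.

(** Slicing along every coordinate in turn isolates the single term of index [k0]. *)
Lemma scalar_power_series_unique (a : I -> C^o) :
  (forall z, l1_ball z -> has_sum (fun k => monomial z k * a k : C^o) 0) ->
  forall k, a k = 0.
Proof.
move=> h k0.
have hs (s : seq 'I_n) z : l1_ball z ->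
    has_sum (fun k => monomial z k * (if all (fun j => k j == k0 j) s then a k else 0) : C^o) 0.
  elim: s z => [|j s IH] z zD; first exact: h.
  apply: eq_has_sum (@has_sum_coord_slice _ j (k0 j) IH z zD) => k /=.
  by case: eqP.
(* All coordinates are nonzero, and [n.+1] in place of [n] keeps their sum below [1]. *)
pose z : 'rV[C]_n := const_mx n.+1%:R^-1.
have zD : l1_ball z.
  rewrite /l1_ball (eq_bigr (fun=> n.+1%:R^-1)) => [|i _].
    rewrite sumr_const card_ord -[ltLHS]mulr_natr mulrC ltr_pdivrMr// mul1r ltr_nat//.
  by rewrite mxE ger0_norm.
have := hs (enum 'I_n) z zD; set g := fun k => _.
have -> : g = (fun k => if k == k0 then monomial z k0 * a k0 else 0).
  apply/funext => k; rewrite /g; case: eqP => [->|kk].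
    by have -> : all (fun j => k0 j == k0 j) (enum 'I_n) by apply/allP => j _.
  case: allP => [kk'|]; last by rewrite mulr0.
  by case: kk; apply/ffunP => j; apply/eqP/kk'; rewrite mem_enum.
have h1 := @has_sum_single R n C^o k0 (monomial z k0 * a k0).
move=> h2; have /esym/eqP := has_sum_unique h2 h1; rewrite mulf_eq0 => /orP[|/eqP//].
rewrite /monomial => /eqP mz; exfalso; move: mz; apply/eqP.
by apply/prodf_neq0 => i _; rewrite mxE expf_neq0// invr_eq0 pnatr_eq0.
Qed.

Lemma power_series_unique (E : hilbertType R) (a : I -> E) :
  (forall z, l1_ball z -> has_sum (fun k => monomial z k *: a k) 0) ->
  forall k, a k = 0.
Proof.
move=> h k0; apply: dot_inj => v; rewrite dot0l; move: k0.
apply: (@scalar_power_series_unique (fun k => dotp (a k) v)) => z.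
move=> /h /(has_sum_dotl (v := v)); rewrite dot0l.
by apply: eq_has_sum => k; rewrite dotZl.
Qed.

End PowerSeries.

(** * The space H^2 *)

Section H2Space.
Context (R : realType) (n : nat) (E : hilbertType R).
Local Notation C := R[i].
Local Notation I := (multiindex n).
Implicit Types (J : {fset I}) (k : I).
Local Existing Instance summability.totally_filter.
Local Notation psum a J := (\sum_(i <- enum_fset J) a i).

(** The elements of [H2] are functions with arbitrary values off the ball, where [H2dot] cannot
    separate them; the Hilbert space is therefore built from coefficient families. *)
Definition h2_bounded : {pred I -> E} := fun a =>
  `[< exists M : C, forall J, psum (fun k => `|a k| ^+ 2 / gamma R k) J <= M >].

Lemma gamma_inv_ge0 k : 0 <= (gamma R k)^-1.
Proof. by rewrite invr_ge0 ltW// gamma_gt0. Qed.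

Lemma sqr_norm_lin (c : C) (x y : E) :
  `|c *: x + y| ^+ 2 <= 2 * `|c| ^+ 2 * `|x| ^+ 2 + 2 * `|y| ^+ 2.
Proof.
have := parallelogram (c *: x) y; rewrite normrZ exprMn mulrA => <-.
by rewrite lerDl exprn_ge0.
Qed.

Let h2_submod : submod_closed h2_bounded.
Proof.
split=> [|c a b /asboolP[M HM] /asboolP[N HN]]; apply/asboolP.
  by exists 0 => J; rewrite big1// => k _; rewrite normr0 expr0n mul0r.
exists (2 * `|c| ^+ 2 * M + 2 * N) => J.
apply: (@le_trans _ _ (\sum_(k <- enum_fset J) (2 * `|c| ^+ 2 * (`|a k| ^+ 2 / gamma R k)
   + 2 * (`|b k| ^+ 2 / gamma R k)))).
  apply: ler_sum => k _; rewrite 2![_ * (_ / gamma R k)]mulrA -mulrDl ler_wpM2r ?gamma_inv_ge0//.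
  exact: (sqr_norm_lin c (a k) (b k)).
rewrite big_split /= -!mulr_sumr lerD//.
  by rewrite ler_wpM2l// ?mulr_ge0// ?exprn_ge0.
by rewrite ler_wpM2l.
Qed.
HB.instance Definition _ :=
  GRing.isSubmodClosed.Build C (I -> E) h2_bounded h2_submod.

Record h2space := H2Space { h2_fun :> I -> E; h2_subproof : h2_bounded h2_fun }.
HB.instance Definition _ := [isSub for h2_fun].
HB.instance Definition _ := [Choice of h2space by <:].
HB.instance Definition _ := [SubChoice_isSubLmodule of h2space by <:].
Implicit Types a b : h2space.

Lemma h2P a b : a =1 b -> a = b.
Proof. by move=> ab; apply/val_inj/funext. Qed.

Lemma h2_bound a : exists M : C, forall J, psum (fun k => `|a k| ^+ 2 / gamma R k) J <= M.
Proof. by have /asboolP := h2_subproof a. Qed.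

Definition h2dot a b : C :=
  @summability.sum _ _ C^o (fun k => dotp (a k) (b k) / gamma R k).

Lemma sum_has_sum (V : normedModType C) (u : I -> V) s :
  has_sum u s -> summability.sum u = s.
Proof. by move=> us; apply: (cvg_lim (@norm_hausdorff _ _)). Qed.

Lemma h2dotP a b : has_sum (fun k => dotp (a k) (b k) / gamma R k : C^o) (h2dot a b).
Proof.
suff [s hs] : exists s, has_sum (fun k => dotp (a k) (b k) / gamma R k : C^o) s.
  by rewrite /h2dot (sum_has_sum hs).
have [M HM] := h2_bound a; have [N HN] := h2_bound b.
apply: (@abs_has_sum_complex _ _ _ (M + N)) => J.
apply: le_trans (lerD (HM J) (HN J)); rewrite -big_split; apply: ler_sum => k _ /=.
rewrite -mulrDl normrM normfV (ger0_norm (ltW (gamma_gt0 _ _))).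
rewrite ler_wpM2r ?gamma_inv_ge0// (le_trans (cauchy_schwarz _ _))//.
have [ab|ab] : `|a k| <= `|b k| \/ `|b k| <= `|a k|.
- by apply/orP; rewrite real_leVge// normr_real.
- apply: (@le_trans _ _ (`|b k| ^+ 2)); first by rewrite expr2 ler_wpM2r.
  by rewrite lerDr exprn_ge0.
- apply: (@le_trans _ _ (`|a k| ^+ 2)); first by rewrite expr2 ler_wpM2l.
  by rewrite lerDl exprn_ge0.
Qed.

Arguments h2dotP : clear implicits.

Lemma h2dotE a b s :
  has_sum (fun k => dotp (a k) (b k) / gamma R k : C^o) s -> h2dot a b = s.
Proof. exact: sum_has_sum. Qed.

Let h2dot_bilinear : bilinear_for *%R (Num.conj \; *%R) h2dot.
Proof.
split=> u c a b.
  apply: h2dotE; have := has_sum_lin (c := c) (h2dotP a u) (h2dotP b u).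
  by apply: eq_has_sum => k; rewrite dotDl dotZl mulrDl -mulrA.
apply: h2dotE; have := has_sum_lin (c := c^*) (h2dotP u a) (h2dotP u b).
by apply: eq_has_sum => k; rewrite dotDr dotZr mulrDl -mulrA.
Qed.
HB.instance Definition _ := bilinear_isBilinear.Build C _ _ _ _ _ h2dot h2dot_bilinear.

Let h2dot_hermitian a b : h2dot a b = (-1) ^+ false * (h2dot b a)^*.
Proof.
rewrite expr0 mul1r; apply: h2dotE; have := has_sum_conj (h2dotP b a).
apply: eq_has_sum => k.
by rewrite rmorphM /= dot_conj conj_Creal// ger0_real ?gamma_inv_ge0.
Qed.
HB.instance Definition _ := isHermitianSesquilinear.Build C h2space false _ h2dot h2dot_hermitian.

Let h2term_ge0 a k : 0 <= dotp (a k) (a k) / gamma R k.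
Proof. by rewrite mulr_ge0 ?gamma_inv_ge0// dot_norm exprn_ge0. Qed.

Let h2dot_gt0 a : a != 0 -> 0 < h2dot a a.
Proof.
move=> a0; have hs := h2dotP a a.
have h0 : 0 <= h2dot a a := has_sum_ge0 (h2term_ge0 a) hs.
rewrite lt_neqAle h0 andbT; apply: contra a0 => /eqP e.
apply/eqP/h2P => k; apply: dot_eq0.
have := has_sum_ge (h2term_ge0 a) hs [fset k]%fset; rewrite big_seq_fset1 -e.
rewrite pmulr_lle0 ?invr_gt0 ?gamma_gt0// => le0.
by apply/eqP; rewrite eq_le le0 dot_norm exprn_ge0.
Qed.
HB.instance Definition _ := isDotProduct.Build C h2space h2dot h2dot_gt0.

HB.instance Definition _ := Lmodule_hasDot.Build R h2space h2dot.

Lemma h2_norm_has_sum a : has_sum (fun k => `|a k| ^+ 2 / gamma R k : C^o) (`|a| ^+ 2).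
Proof.
rewrite sqr_normE; apply: eq_has_sum (h2dotP a a) => k.
by rewrite dot_norm.
Qed.

Arguments h2_norm_has_sum : clear implicits.

Lemma h2_psum_le a J : psum (fun k => `|a k| ^+ 2 / gamma R k) J <= `|a| ^+ 2.
Proof.
apply: has_sum_ge (h2_norm_has_sum a) J => k.
by rewrite mulr_ge0 ?gamma_inv_ge0// exprn_ge0.
Qed.

Lemma h2_coord_le a k : `|a k| ^+ 2 <= gamma R k * `|a| ^+ 2.
Proof.
have := h2_psum_le a [fset k]%fset; rewrite big_seq_fset1.
by rewrite ler_pdivrMr ?gamma_gt0// mulrC.
Qed.

Lemma h2_norm_le a (M : C) : 0 <= M ->
  (forall J, psum (fun k => `|a k| ^+ 2 / gamma R k) J <= M ^+ 2) -> `|a| <= M.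
Proof.
move=> M0 h; apply: norm_le_sqr => //.
apply: has_sum_le (h2_norm_has_sum a) h => k.
by rewrite mulr_ge0 ?gamma_inv_ge0// exprn_ge0.
Qed.

Lemma cvg_seq_sum (T : Type) (F : set_system T) (X : Type) (s : seq X)
    (f : X -> T -> C^o) (a : X -> C^o) : Filter F ->
  (forall x, f x @ F --> a x) ->
  (fun t => \sum_(x <- s) f x t : C^o) @ F --> (\sum_(x <- s) a x : C^o).
Proof.
move=> FF fa; elim: s => [|x s IH].
  have -> : (fun t => \sum_(x <- [::]) f x t : C^o) = fun=> 0.
    by apply/funext => t; rewrite big_nil.
  by rewrite big_nil; exact: cvg_cst.
have -> : (fun t => \sum_(y <- x :: s) f y t : C^o) = f x \+ (fun t => \sum_(y <- s) f y t : C^o).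
  by apply/funext => t; rewrite big_cons.
rewrite big_cons; exact: (@cvgD C C^o T F FF (f x) (fun t => \sum_(y <- s) f y t) (a x)
  (\sum_(y <- s) a y) (fa x) IH).
Qed.

Let h2_complete (F : set_system h2space) : ProperFilter F -> cauchy F -> cvg F.
Proof.
move=> FF /cauchyP Fc.
have Fk k : cvg ((fun a : h2space => a k) @ F).
  apply: cauchy_cvg; apply/cauchyP => e e0.
  have g1 : 0 < gamma R k + 1 by rewrite ltr_wpDl// ltW// gamma_gt0.
  have [x Fx] := Fc (e / (gamma R k + 1)) ltac:(by rewrite divr_gt0).
  exists (x k); change (F ((fun a : h2space => a k) @^-1` ball (x k) e)).
  apply: filterS Fx => y; rewrite -!ball_normE/= => xy.
  apply: le_lt_trans (_ : (gamma R k + 1) * `|x - y| < e); last first.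
    by rewrite mulrC -ltr_pdivlMr.
  apply: norm_le_sqr; first by rewrite mulr_ge0// ltW.
  rewrite (le_trans (h2_coord_le (x - y) k))// exprMn ler_wpM2r ?exprn_ge0//.
  apply: (@le_trans _ _ (gamma R k + 1)); first by rewrite lerDl.
  by rewrite expr2 ler_peMr ?(ltW g1)// lerDr ltW// gamma_gt0.
pose l k := lim ((fun a : h2space => a k) @ F).
(* A Fatou argument: the estimate holds for each finite partial sum along the filter and survives
   the coordinatewise limit. *)
have est (e : C) (x : h2space) : 0 < e -> F (ball x e) ->
    forall J, psum (fun k => `|l k - x k| ^+ 2 / gamma R k) J <= e ^+ 2.
  move=> e0 Fx J.
  have yl : (fun y : h2space => psum (fun k => `|y k - x k| ^+ 2 / gamma R k) J : C^o) @ F -->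
      (psum (fun k => `|l k - x k| ^+ 2 / gamma R k) J : C^o).
    apply: cvg_seq_sum => k; apply: cvgM; last exact: cvg_cst.
    have h : (fun y : h2space => `|y k - x k| : C^o) @ F --> (`|l k - x k| : C^o).
      by apply: cvg_norm; apply: cvgB; [exact: Fk|exact: cvg_cst].
    by rewrite expr2; under eq_fun do rewrite expr2; apply: cvgM.
  apply: le_addgt0 => d d0; move/cvgrPdist_lt : yl => /(_ _ d0) yl.
  have [y [xy yd]] : exists y : h2space, ball x e y /\
      `|psum (fun k => `|l k - x k| ^+ 2 / gamma R k) J -
        psum (fun k => `|y k - x k| ^+ 2 / gamma R k) J| < d.
    by have [y []] := filter_ex (filterI Fx yl); exists y.
  have r0 (u : I -> E) : 0 <= psum (fun k => `|u k - x k| ^+ 2 / gamma R k) J.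
    by rewrite sumr_ge0// => k _; rewrite mulr_ge0 ?gamma_inv_ge0// exprn_ge0.
  rewrite -(subrK (psum (fun k => `|y k - x k| ^+ 2 / gamma R k) J)
    (psum (fun k => `|l k - x k| ^+ 2 / gamma R k) J)) addrC lerD//.
    apply: le_trans (h2_psum_le (y - x) J) _; rewrite ler_pXn2r ?nnegrE ?(ltW e0)//.
    by move: xy; rewrite -ball_normE/= distrC => /ltW.
  apply: le_trans (ltW yd); apply: real_ler_norm.
  by rewrite rpredB// ger0_real.
have [x0 Fx0] := Fc 1 ltr01.
have bl (x : h2space) e : 0 < e -> F (ball x e) -> h2_bounded (fun k => l k - x k).
  by move=> e0 Fx; apply/asboolP; exists (e ^+ 2); exact: est.
(* Square summability is known for the difference [l - x0], so the limit is assembled from it by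
   adding [x0] back. *)
pose ll : h2space := H2Space (bl x0 1 ltr01 Fx0) + x0.
have llE k : ll k = l k by exact: subrK.
apply/cvg_ex; exists ll; apply/cvgrPdist_lt => e e0.
have e2 : 0 < e / 2 by rewrite divr_gt0.
have [x Fx] := Fc _ e2; apply: filterS (Fx) => y; rewrite -ball_normE/= => xy.
rewrite -(subrK x ll) -addrA (le_lt_trans (ler_normD _ _))// [e]splitr ler_ltD//.
apply: h2_norm_le => [|J]; first exact: ltW.
apply: le_trans (est _ x e2 Fx J); apply: ler_sum => k _.
by have -> : (ll - x) k = l k - x k by rewrite -llE.
Qed.
HB.instance Definition _ := Uniform_isComplete.Build h2space h2_complete.

End H2Space.

(** * Evaluation and reproducing kernels *)

Section H2Functions.
Context (R : realType) (n : nat) (E : hilbertType R).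
Local Notation C := R[i].
Local Notation I := (multiindex n).
Implicit Types (f g : 'rV[R[i]]_n -> E) (u v : I -> E) (J : {fset I}) (k l : I) (a b : h2space n E) (z w : 'rV[C]_n) (eta : E).
Local Notation psum a J := (\sum_(i <- enum_fset J) a i).

Definition h2_eval a z : E := summability.sum (fun k => monomial z k *: a k).

Lemma gamma_inv_sqr_ge0 (v : E) k : 0 <= `|v| ^+ 2 / gamma R k.
Proof. by rewrite mulr_ge0 ?gamma_inv_ge0// exprn_ge0. Qed.

(** Substituting [|z_i|^2] for the variables turns the Euclidean ball into the domain of
    [gamma_monomial_bounded]. *)
Lemma gamma_monomial_sqr_bounded z : unit_ball z ->
  exists M : C, forall J, psum (fun k => gamma R k * `|monomial z k| ^+ 2) J <= M.
Proof.
rewrite /unit_ball /= => z1.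
exists (1 - \sum_(i < n) `|z 0 i| ^+ 2)^-1 => J.
pose x : 'rV[C]_n := \row_i (`|z 0 i| ^+ 2).
have -> : psum (fun k => gamma R k * `|monomial z k| ^+ 2) J =
    psum (fun k => gamma R k * monomial x k) J.
  apply: eq_bigr => k _; congr (_ * _); rewrite /monomial normr_prod -prodrXl.
  by apply: eq_bigr => i _; rewrite mxE normrX exprAC.
apply: gamma_monomial_bounded => // [i|]; first by rewrite mxE exprn_ge0.
by rewrite le_eqVlt; apply/orP; left; apply/eqP/eq_bigr => i _; rewrite mxE.
Qed.

Lemma mul_le_sqrD (x y : C) : 0 <= x -> 0 <= y -> x * y <= x ^+ 2 + y ^+ 2.
Proof.
move=> x0 y0; have [xy|yx] : x <= y \/ y <= x.
- by apply/orP; rewrite real_leVge// ger0_real.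
- by apply: (@le_trans _ _ (y ^+ 2)); rewrite ?lerDr ?exprn_ge0// expr2 ler_wpM2r.
- by apply: (@le_trans _ _ (x ^+ 2)); rewrite ?lerDl ?exprn_ge0// expr2 ler_wpM2l.
Qed.

Lemma h2_eval_has_sum a z : unit_ball z -> has_sum (fun k => monomial z k *: a k) (h2_eval a z).
Proof.
move=> z1; suff [s hs] : exists s, has_sum (fun k => monomial z k *: a k) s.
  by rewrite /h2_eval (sum_has_sum hs).
have [M HM] := gamma_monomial_sqr_bounded z1.
apply: (@abs_has_sum_hilbert _ _ _ _ (M + `|a| ^+ 2)) => J.
apply: le_trans (lerD (HM J) (h2_psum_le a J)); rewrite -big_split.
apply: ler_sum => k _ /=; have g0 := gamma_gt0 R k.
have gn : sqrtC (gamma R k) != 0 by rewrite sqrtC_eq0 gt_eqF.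
(* Distributing [sqrtC (gamma R k)] over the two factors separates the kernel of [z] from the norm
   of [a]. *)
have := @mul_le_sqrD (sqrtC (gamma R k) * `|monomial z k|) (`|a k| / sqrtC (gamma R k)).
rewrite !exprMn exprVn sqrtCK normrZ => h.
have h1 : 0 <= sqrtC (gamma R k) by rewrite sqrtC_ge0 ltW.
apply: le_trans (h _ _); [|exact: mulr_ge0|by rewrite mulr_ge0// invr_ge0].
by rewrite le_eqVlt; apply/orP; left; apply/eqP; field.
Qed.

Lemma h2_evalE a z s :
  has_sum (fun k => monomial z k *: a k) s -> h2_eval a z = s.
Proof. exact: sum_has_sum. Qed.

Lemma h2_eval_lin c a b z : unit_ball z ->
  h2_eval (c *: a + b) z = c *: h2_eval a z + h2_eval b z.
Proof.
move=> z1; apply: h2_evalE.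
have := has_sum_lin (c := c) (h2_eval_has_sum (a := a) z1) (h2_eval_has_sum (a := b) z1).
apply: eq_has_sum => k.
have -> : (c *: a + b) k = c *: a k + b k by [].
by rewrite scalerDr !scalerA mulrC.
Qed.

Lemma power_expansion_unique (f : 'rV[C]_n -> E) (u v : I -> E) :
  power_expansion f u -> power_expansion f v -> u = v.
Proof.
move=> fu fv; apply/funext => k; apply/eqP; rewrite -subr_eq0; apply/eqP.
move: k; apply: power_series_unique => z /l1_ball_unit z1.
have := has_sum_lin (c := -1) (fv z z1) (fu z z1); rewrite scaleN1r addNr.
by apply: eq_has_sum => k; rewrite scaleN1r scalerBr addrC.
Qed.

(** The bridge to the function-level notions [H2], [H2dot] and [H2norm]; agreement is required on
    the ball only. *)
Definition h2_repr (f : 'rV[C]_n -> E) a := forall z, unit_ball z -> f z = h2_eval a z.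

Lemma h2_repr_expansion f a : h2_repr f a -> power_expansion f a.
Proof. by move=> fa z z1; rewrite fa//; exact: h2_eval_has_sum. Qed.

Lemma coefE (f : 'rV[C]_n -> E) (u : I -> E) : power_expansion f u -> coef f = u.
Proof.
move=> fu; rewrite /coef; case: xgetP => [v ->|/(_ u)//].
by move=> fv; exact: power_expansion_unique fv fu.
Qed.

Lemma h2_repr_coef f a : h2_repr f a -> coef f = a.
Proof. by move=> /h2_repr_expansion /coefE. Qed.

Lemma H2_repr f : H2 f <-> exists a, h2_repr f a.
Proof.
split=> [[[u fu] [s]]|[a fa]].
  rewrite (coefE fu) => hs.
  have ub : h2_bounded u.
    apply/asboolP; exists s => J; apply: has_sum_ge hs J => k.
    exact: gamma_inv_sqr_ge0.
  by exists (H2Space ub) => z z1; exact/esym/h2_evalE/fu.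
split; first by exists a; exact: h2_repr_expansion.
by exists (`|a| ^+ 2); rewrite (h2_repr_coef fa); exact: h2_norm_has_sum.
Qed.

Lemma H2dot_repr f g a b : h2_repr f a -> h2_repr g b -> H2dot f g = dotp a b.
Proof. by move=> fa gb; rewrite /H2dot (h2_repr_coef fa) (h2_repr_coef gb). Qed.

Lemma H2norm_repr f a : h2_repr f a -> H2norm f = `|a|.
Proof. by move=> fa; rewrite /H2norm (H2dot_repr fa fa) dot_norm sqrCK. Qed.

Lemma h2_repr_eval a : h2_repr (h2_eval a) a.
Proof. by []. Qed.

Lemma h2_eval_inj a b : (forall z, unit_ball z -> h2_eval a z = h2_eval b z) -> a = b.
Proof.
move=> ab; apply: h2P => k; have ha := h2_repr_coef (h2_repr_eval a).
have hb : h2_repr (h2_eval a) b by [].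
by rewrite -ha (h2_repr_coef hb).
Qed.

Lemma kernel_subproof z eta : unit_ball z ->
  h2_bounded ((fun k => (gamma R k * (monomial z k)^*) *: eta) : I -> E).
Proof.
move=> /gamma_monomial_sqr_bounded[M HM]; apply/asboolP; exists (M * `|eta| ^+ 2) => J.
apply: le_trans (ler_wpM2r (exprn_ge0 2 (normr_ge0 eta)) (HM J)); rewrite mulr_suml.
apply: ler_sum => k _; have g0 := gamma_gt0 R k.
rewrite normrZ; move: (gamma R k) g0 => g g0.
rewrite normrM norm_conjC (ger0_norm (ltW g0)) le_eqVlt.
by apply/orP; left; apply/eqP; field; rewrite gt_eqF.
Qed.

(** The kernel function [k_z eta], with value [0] off the ball so that the term carries no proof of
    [unit_ball z]. *)
Definition kernel z eta : h2space n E :=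
  if pselect (unit_ball z) is left z1 then H2Space (kernel_subproof eta z1) else 0.

Lemma kernelE z eta k : unit_ball z ->
  kernel z eta k = (gamma R k * (monomial z k)^*) *: eta.
Proof. by move=> z1; rewrite /kernel; case: pselect. Qed.

Lemma dot_kernel a z eta : unit_ball z -> dotp a (kernel z eta) = dotp (h2_eval a z) eta.
Proof.
move=> z1; apply: h2dotE.
have := has_sum_dotl (v := eta) (h2_eval_has_sum (a := a) z1); apply: eq_has_sum => k.
rewrite kernelE// dotZl dotZr rmorphM /= conjCK; have g0 := gamma_gt0 R k.
rewrite (@conj_Creal _ (gamma R k)) ?ger0_real ?ltW//.
by field; rewrite gt_eqF.
Qed.

(* The scalar kernel s = sum_k gamma_k w^k conj(z^k) satisfies s = 1 + <w,z> s by
   Pascal's rule for gamma; in particular 1 - <w,z> is not zero. *)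
Lemma h2_eval_kernel z w eta : unit_ball z -> unit_ball w ->
  (1 - ball_ip z w) *: h2_eval (kernel z eta) w = eta.
Proof.
move=> z1 w1.
have hs := h2_eval_has_sum (a := kernel z eta) w1; set s := h2_eval _ w in hs *.
have hi i := has_sum_shift i (has_sumZ (c := (z 0 i)^* * w 0 i) hs).
suff e : s = eta + \sum_(i < n) ((z 0 i)^* * w 0 i) *: s.
  by rewrite scalerBl scale1r {1}e -scaler_suml addrK.
apply: has_sum_unique hs _.
have := has_sumD (@has_sum_single R n E [ffun=> 0%N] eta) (has_sum_sum hi).
apply: eq_has_sum => l /=.
have [l0|l0] := posnP (mdeg l).
  rewrite (mdeg_eq0 l0) eqxx kernelE// monomial0 gamma0 monomial0 rmorph1 mul1r !scale1r.
  by rewrite big1 ?addr0// => i _; rewrite ffunE.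
have -> : (l == [ffun=> 0%N]) = false.
  by apply/negbTE; apply: contraL l0 => /eqP ->; rewrite mdeg0.
rewrite add0r kernelE// [in RHS](gamma_pascal R l0) mulr_suml scaler_suml scaler_sumr.
apply: eq_bigr => i _; case: ltnP => li; last by rewrite mul0r scale0r scaler0.
rewrite kernelE// !scalerA (monomial_decr z li) (monomial_decr w li) rmorphM.
by congr (_ *: _); ring.
Qed.

End H2Functions.

(** * Coordinate multiplications and backward shifts *)

Section Shifts.
Context (R : realType) (n : nat) (E : hilbertType R).
Local Notation C := R[i].
Local Notation I := (multiindex n).
Implicit Types (J : {fset I}) (k l : I) (a b : h2space n E) (z w : 'rV[C]_n) (eta : E)
  (i j : 'I_n).
Local Notation psum a J := (\sum_(i <- enum_fset J) a i).

(** Summing [2 |z_i| |w_i| <= |z_i|^2 + |w_i|^2] gives [|<w, z>| < 1], without reference to any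
    coefficient space. *)
Lemma ball_ip_neq1 z w : unit_ball z -> unit_ball w -> 1 - ball_ip z w != 0.
Proof.
move=> z1 w1; rewrite subr_eq0; apply/eqP => e.
suff : `|ball_ip z w| < 1 by rewrite -e normr1 ltxx.
apply: (@le_lt_trans _ _ ((\sum_(i < n) `|z 0 i| ^+ 2 + \sum_(i < n) `|w 0 i| ^+ 2) / 2)).
  rewrite -big_split /= mulr_suml (le_trans (ler_norm_sum _ _ _))// ler_sum// => i _.
  rewrite normrM norm_conjC ler_pdivlMr// -subr_ge0.
  have -> : `|z 0 i| ^+ 2 + `|w 0 i| ^+ 2 - `|z 0 i| * `|w 0 i| * 2 =
    (`|z 0 i| - `|w 0 i|) ^+ 2 by ring.
  by rewrite real_exprn_even_ge0// rpredB// normr_real.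
by rewrite ltr_pdivrMr// mul1r -[2]/(1 + 1) ltrD.
Qed.

Definition fwd_coef i (u : I -> E) l := if (0 < l i)%N then u (decr l i) else 0.
(** The weight is [gamma_k / gamma_(k + e_i)], which makes this the adjoint of multiplication by
    [z_i]. *)
Definition bwd_coef i (u : I -> E) k := ((k i).+1%:R / (mdeg k).+1%:R : C) *: u (incr k i).

Lemma gamma_decr_le l i : (0 < l i)%N -> (gamma R l)^-1 <= (gamma R (decr l i))^-1.
Proof.
move=> li; rewrite lef_pV2 ?posrE ?gamma_gt0//.
have l0 := mdeg_gt0 li.
rewrite gamma_decr// -mulrA ler_piMr ?(ltW (gamma_gt0 _ _))//.
by rewrite ler_pdivrMr ?ltr0n// mul1r ler_nat /mdeg (bigD1 i)//= leq_addr.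
Qed.

Lemma fwd_subproof i a : h2_bounded (fwd_coef i a).
Proof.
apply/asboolP; exists (`|a| ^+ 2) => J.
have hs := has_sum_shift i (h2_norm_has_sum (a := a)).
apply: le_trans (has_sum_ge _ hs J); last first.
  by move=> l; case: ifP => // _; exact: gamma_inv_sqr_ge0.
apply: ler_sum => l _; rewrite /fwd_coef; case: ltnP => li.
  by rewrite ler_wpM2l ?exprn_ge0// gamma_decr_le.
by rewrite normr0 expr0n mul0r.
Qed.

Lemma bwd_term i (u : I -> E) k : `|bwd_coef i u k| ^+ 2 / gamma R k =
  (k i).+1%:R / (mdeg k).+1%:R * (`|u (incr k i)| ^+ 2 / gamma R (incr k i)).
Proof.
rewrite /bwd_coef normrZ exprMn ger0_norm ?divr_ge0//.
have := gamma_incr R k i; have g0 := gamma_gt0 R k; have g1 := gamma_gt0 R (incr k i).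
move: (gamma R k) (gamma R (incr k i)) g0 g1 => g g' g0 g1 e.
have -> : g = g' * (k i).+1%:R / (mdeg k).+1%:R by rewrite -e mulfK// pnatr_eq0.
by field; rewrite gt_eqF//= !nat1r !pnatr_eq0.
Qed.

Lemma bwd_psum i a J : psum (fun k => `|bwd_coef i a k| ^+ 2 / gamma R k) J <= `|a| ^+ 2.
Proof.
apply: (@le_trans _ _ (psum (fun k => `|a (incr k i)| ^+ 2 / gamma R (incr k i)) J)).
  apply: ler_sum => k _; rewrite bwd_term ler_piMl ?gamma_inv_sqr_ge0//.
  by rewrite ler_pdivrMr// mul1r ler_nat ltnS /mdeg (bigD1 i)//= leq_addr.
apply: le_trans (h2_psum_le a ((fun k => incr k i) @` J)%fset).
rewrite [leRHS]big_imfset//= => k l _ _ /(congr1 (fun v => decr v i)).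
by rewrite !incrK.
Qed.

Lemma bwd_subproof i a : h2_bounded (bwd_coef i a).
Proof. by apply/asboolP; exists (`|a| ^+ 2); exact: bwd_psum. Qed.

Definition fwd i a := H2Space (fwd_subproof i a).
Definition bwd_fun i a := H2Space (bwd_subproof i a).

(** The backward shift is the one packaged as an operator, because the model tuple is defined as the
    adjoint of its restriction. *)
Lemma bwd_exists i : exists B : bop (h2space n E) (h2space n E), forall a, B a = bwd_fun i a.
Proof.
apply: (@bop_exists _ _ _ (bwd_fun i) 1) => [c a b|a].
  apply: h2P => k.
  change ((k i).+1%:R / (mdeg k).+1%:R *: (c *: a (incr k i) + b (incr k i)) =
    c *: ((k i).+1%:R / (mdeg k).+1%:R *: a (incr k i)) +
    ((k i).+1%:R / (mdeg k).+1%:R *: b (incr k i))).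
  by rewrite scalerDr !scalerA mulrC.
rewrite mul1r; apply: h2_norm_le => // J; exact: bwd_psum.
Qed.

Definition bwd i : bop (h2space n E) (h2space n E) := sval (cid (bwd_exists i)).

Lemma bwdE i a k : bwd i a k = bwd_coef i a k.
Proof. by rewrite /bwd; case: cid => B /= ->. Qed.

Lemma h2_eval_fwd i a z : unit_ball z -> h2_eval (fwd i a) z = z 0 i *: h2_eval a z.
Proof.
move=> z1; apply: h2_evalE.
have := has_sum_shift i (has_sumZ (c := z 0 i) (h2_eval_has_sum (a := a) z1)).
apply: eq_has_sum => l /=; rewrite /fwd_coef; case: ltnP => li; last by rewrite scaler0.
by rewrite (monomial_decr z li) scalerA.
Qed.

Lemma dot_fwd i a b : dotp (fwd i a) b = dotp a (bwd i b).
Proof.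
apply: h2dotE; have := has_sum_shift i (h2dotP (a := a) (b := bwd i b)).
apply: eq_has_sum => l /=; rewrite /fwd_coef; case: ltnP => li; last by rewrite dot0l mul0r.
rewrite bwdE /bwd_coef decrK// gamma_decr// dotZr.
have -> : (decr l i i).+1 = l i by rewrite ffunE eqxx subn1 prednK.
rewrite -(mdeg_incr _ i) decrK// conj_Creal; last by rewrite rpred_div// realn.
have g0 := gamma_gt0 R l; have l0 := mdeg_gt0 li.
by move: (gamma R l) g0 => g g0; field; rewrite gt_eqF//= !pnatr_eq0 -!lt0n li l0.
Qed.

(** Dual to the commutation of the coordinate multiplications, which is visible on values. *)
Lemma bwd_comm i j a : bwd i (bwd j a) = bwd j (bwd i a).
Proof.
apply: dot_injr => b; rewrite -!dot_fwd; congr (dotp _ a).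
apply: h2_eval_inj => z z1; rewrite !h2_eval_fwd// !scalerA; congr (_ *: _).
by rewrite mulrC.
Qed.

Lemma unit_ball0 : unit_ball (0 : 'rV[C]_n).
Proof.
rewrite /unit_ball /= big1 ?ltr01// => i _.
by rewrite mxE normr0 expr0n.
Qed.

Lemma ball_ip0 w : ball_ip 0 w = 0.
Proof. by rewrite /ball_ip big1// => i _; rewrite mxE rmorph0 mul0r. Qed.

Lemma h2_eval_const eta w : unit_ball w -> h2_eval (kernel 0 eta) w = eta.
Proof.
by move=> w1; rewrite -[RHS](h2_eval_kernel eta unit_ball0 w1) ball_ip0 subr0 scale1r.
Qed.

Lemma h2_eval_sum m (c : 'I_m -> C) (a : 'I_m -> h2space n E) z : unit_ball z ->
  h2_eval (\sum_(i < m) c i *: a i) z = \sum_(i < m) c i *: h2_eval (a i) z.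
Proof.
move=> z1; elim: m c a => [|m IH] c a.
  rewrite !big_ord0; apply: h2_evalE.
  by apply: eq_has_sum (@has_sum0 R n E) => k; exact/esym/scaler0.
by rewrite !big_ord_recl h2_eval_lin// IH.
Qed.

(** The identity [k_z = 1 + <w, z> k_z] as an equation between vectors, with [w_i] acting as a
    shift. *)
Lemma kernel_shift z eta : unit_ball z ->
  kernel z eta = kernel 0 eta + \sum_(i < n) (z 0 i)^* *: fwd i (kernel z eta).
Proof.
move=> z1; apply: h2_eval_inj => w w1.
have := h2_eval_lin 1 (kernel 0 eta) (\sum_(i < n) (z 0 i)^* *: fwd i (kernel z eta)) w1.
rewrite !scale1r h2_eval_sum// h2_eval_const// => ->.
rewrite -{1}[eta in eta + _](h2_eval_kernel eta z1 w1) scalerBl scale1r.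
rewrite -[LHS]addr0 -addrA; congr (_ + _); apply/esym/eqP.
rewrite addrC subr_eq0 /ball_ip scaler_suml; apply/eqP/eq_bigr => i _.
by rewrite h2_eval_fwd// scalerA.
Qed.

(** The adjoint form of [kernel_shift]: both sides are paired with the kernel function at [z]. *)
Lemma h2_eval_bwd a z : unit_ball z ->
  h2_eval a z = h2_eval a 0 + \sum_(i < n) z 0 i *: h2_eval (bwd i a) z.
Proof.
move=> z1; apply: dot_inj => eta; have z0 := unit_ball0.
rewrite dotDl -!dot_kernel// {1}(kernel_shift eta z1) dotDr; congr (_ + _).
rewrite dot_sumr dot_suml; apply: eq_bigr => i _.
rewrite dotZr conjCK dotZl -dot_kernel//; congr (_ * _).
by rewrite -dot_conj dot_fwd dot_conj.
Qed.

(** Multiplying the backward shifts back by their coordinates and summing recovers everything except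
    the constant term. *)
Lemma bwd_dot a b :
  dotp a b = dotp (h2_eval a 0) (h2_eval b 0) + \sum_(i < n) dotp (bwd i a) (bwd i b).
Proof.
have z0 := unit_ball0.
have e : a = kernel 0 (h2_eval a 0) + \sum_(i < n) 1 *: fwd i (bwd i a).
  apply: h2_eval_inj => z z1.
  have := h2_eval_lin 1 (kernel 0 (h2_eval a 0)) (\sum_(i < n) 1 *: fwd i (bwd i a)) z1.
  rewrite !scale1r h2_eval_sum// h2_eval_const// => ->.
  rewrite h2_eval_bwd//; congr (_ + _); apply: eq_bigr => i _.
  by rewrite scale1r h2_eval_fwd.
rewrite {1}e dotDl -[dotp (kernel _ _) b]dot_conj dot_kernel// dot_conj; congr (_ + _).
by rewrite dot_suml; apply: eq_bigr => i _; rewrite scale1r dot_fwd.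
Qed.

(** The squared norm of the part of degree at least [m]. On the model it is the quadratic form of
    the [m]-th iterate of [conj_op], so that purity becomes convergence of the norm series. *)
Definition h2_tail m a : C :=
  @summability.sum _ _ C^o (fun k => if (m <= mdeg k)%N then `|a k| ^+ 2 / gamma R k else 0).

Lemma h2_tail_has_sum m a :
  @has_sum R n C^o (fun k => if (m <= mdeg k)%N then `|a k| ^+ 2 / gamma R k else 0) (h2_tail m a).
Proof.
have [||s hs _] := @ge0_has_sum R n
    (fun k => if (m <= mdeg k)%N then `|a k| ^+ 2 / gamma R k else 0) (`|a| ^+ 2).
- by move=> k; case: ifP => // _; exact: gamma_inv_sqr_ge0.
- move=> J; apply: le_trans (h2_psum_le a J); apply: ler_sum => k _.
  by case: ifP => // _; exact: gamma_inv_sqr_ge0.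
by rewrite /h2_tail (sum_has_sum hs).
Qed.

Lemma h2_tail0 a : h2_tail 0 a = `|a| ^+ 2.
Proof. exact: has_sum_unique (h2_tail_has_sum (m := 0) (a := a)) (h2_norm_has_sum (a := a)). Qed.

(** The coefficient at [l] is redistributed with weights [l_i / mdeg l], of total [1], and each
    backward shift lowers the degree by one. *)
Lemma h2_tail_bwd m a : \sum_(i < n) h2_tail m (bwd i a) = h2_tail m.+1 a.
Proof.
have h i := has_sum_shift i (h2_tail_has_sum (m := m) (a := bwd i a)).
apply: has_sum_unique (h2_tail_has_sum (m := m.+1) (a := a)).
apply: eq_has_sum (has_sum_sum h) => l.
have [l0|l0] := posnP (mdeg l).
  by rewrite l0 ltn0 big1// => i _; rewrite (mdeg_eq0 l0) ffunE.
transitivity (\sum_(i < n) (if (m < mdeg l)%N then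
    (l i)%:R / (mdeg l)%:R * (`|a l| ^+ 2 / gamma R l) else 0)).
  apply: eq_bigr => i _; case: ltnP => li; last first.
    by move: li; rewrite leqn0 => /eqP ->; rewrite mul0r mul0r; case: ifP.
  have -> : mdeg l = (mdeg (decr l i)).+1 by rewrite -(mdeg_incr _ i) decrK.
  rewrite ltnS; case: ifP => // _; rewrite bwdE bwd_term decrK//.
  by rewrite ffunE eqxx subn1 prednK.
case: ifP => _; last by rewrite big1.
rewrite -mulr_suml -mulr_suml -natr_sum -/(mdeg l) mulfV ?mul1r//.
by rewrite pnatr_eq0 -lt0n.
Qed.

Lemma h2_tail_small a (e : C) : 0 < e ->
  exists N, forall m, (N <= m)%N -> h2_tail m a <= e.
Proof.
move=> e0.
have t0 k : 0 <= `|a k| ^+ 2 / gamma R k := gamma_inv_sqr_ge0 (a k) k.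
have [J0 HJ] := bounded_tail t0 (h2_psum_le a) e0.
(* Beyond the largest degree in [J0] every index lies outside [J0]. *)
exists (\max_(k <- enum_fset J0) mdeg k).+1 => m Nm.
apply: has_sum_le (h2_tail_has_sum (m := m) (a := a)) _ => [k|J].
  by case: ifP.
apply: le_trans (ltW (HJ (J0 `|` J)%fset (fsubsetUl _ _))).
rewrite -big_mkcond big_fset_condE; apply: psum_le => //.
apply/fsubsetP => k; rewrite !inE /= => /andP[kJ mk]; rewrite kJ orbT andbT.
apply: contraL mk => kJ0; rewrite -ltnNge; apply: leq_trans Nm; rewrite ltnS.
by apply: (@leq_bigmax_seq (multiindex n : choiceType) (enum_fset J0) predT (fun k => mdeg k) k).
Qed.

End Shifts.

(** * Uniqueness *)

Section Powers.
Context (R : realType) (n : nat) (K : hilbertType R) (S : 'I_n -> bop K K).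
Local Notation C := R[i].
Local Notation I := (multiindex n).
Hypothesis Scc : commuting_contractive S.
Implicit Types (k l : I) (z w : 'rV[C]_n) (v : K) (i j : 'I_n).

Lemma contractive_adj h : \sum_(i < n) `|adj (S i) h| ^+ 2 <= `|h| ^+ 2.
Proof. by have [_ /le_opP] := Scc. Qed.

Lemma contractive_coord i v : `|S i v| <= `|v|.
Proof.
rewrite -[leRHS]mul1r; apply: adj_norm_le => // y; rewrite mul1r.
apply: norm_le_sqr => //; apply: le_trans (contractive_adj y).
by rewrite (bigD1 i)//= lerDl sumr_ge0// => j _; rewrite exprn_ge0.
Qed.

Lemma tuple_comm i j v : S i (S j v) = S j (S i v).
Proof. by have [/(_ i j) /bopP h _] := Scc; exact: h. Qed.

(** The power [S^k], composed in the order of [enum 'I_n]; commutativity makes this order immaterial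
    in [tuple_pow_incr]. *)
Definition tuple_pow k v := foldr (fun i => iter (k i) (S i)) v (enum 'I_n).

Lemma tuple_pow0 v : tuple_pow [ffun=> 0%N] v = v.
Proof. by rewrite /tuple_pow; elim: (enum 'I_n) => //= i s IH; rewrite ffunE. Qed.

Lemma tuple_pow_incr k i v : tuple_pow (incr k i) v = S i (tuple_pow k v).
Proof.
have itc j m x : iter m (S j) (S i x) = S i (iter m (S j) x).
  by elim: m => //= m ->; exact: tuple_comm.
have h s : uniq s -> foldr (fun j => iter (incr k i j) (S j)) v s =
    if i \in s then S i (foldr (fun j => iter (k j) (S j)) v s)
    else foldr (fun j => iter (k j) (S j)) v s.
  elim: s => //= j s IH /andP[js us]; rewrite IH// ffunE inE.
  case: (eqVneq j i) => [ji|ji]; first by rewrite ji in js *; rewrite (negbTE js) addn1.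
  by rewrite addn0 /=; case: ifP => // _; exact: itc.
by rewrite /tuple_pow h ?enum_uniq// mem_enum.
Qed.

Lemma tuple_pow_norm k v : `|tuple_pow k v| <= `|v|.
Proof.
rewrite /tuple_pow; elim: (enum 'I_n) => //= i s IH.
elim: (k i) => //= m IHm; exact: le_trans (contractive_coord _ _) IHm.
Qed.

(** The series converges absolutely since the powers are contractive, and Pascal's rule shows that
    its sum [s] satisfies [s = v + sum_i conj(z_i) S_i s], the equation of the resolvent. *)
Lemma resolvent_has_sum z v : l1_ball z ->
  has_sum (fun k => monomial (\row_i (z 0 i)^*) k *: (gamma R k *: tuple_pow k v))
    (resolvent S z v).
Proof.
move=> z1; pose c : 'rV[C]_n := \row_i (z 0 i)^*.
pose p k := monomial c k *: (gamma R k *: tuple_pow k v).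
have [s hs] : exists s, has_sum p s.
  pose x : 'rV[C]_n := \row_i `|z 0 i|.
  apply: (@abs_has_sum_hilbert _ _ _ _ ((1 - \sum_(i < n) `|z 0 i|)^-1 * `|v|)) => J.
  apply: (@le_trans _ _ (\sum_(k <- enum_fset J) gamma R k * monomial x k * `|v|)).
    apply: ler_sum => k _; rewrite /p !normrZ (ger0_norm (ltW (gamma_gt0 R k))).
    rewrite mulrA [gamma R k * _]mulrC.
    have -> : `|monomial c k| = monomial x k.
      rewrite /monomial normr_prod; apply: eq_bigr => i _.
      by rewrite !mxE normrX norm_conjC.
    rewrite ler_wpM2l ?tuple_pow_norm// mulr_ge0 ?(ltW (gamma_gt0 R k))//.
    by apply: monomial_ge0 => i; rewrite mxE.
  rewrite -mulr_suml ler_wpM2r//; apply: gamma_monomial_bounded => // [i|].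
    by rewrite mxE.
  by rewrite le_eqVlt; apply/orP; left; apply/eqP/eq_bigr => i _; rewrite mxE.
suff -> : resolvent S z v = s by [].
apply/esym/resolvent_eq; [exact: contractive_adj|exact: l1_ball_unit|].
have ec i : c 0 i = (z 0 i)^* by rewrite mxE.
suff e : s = v + \sum_(i < n) c 0 i *: S i s.
  rewrite {1}e row_opE adj_scalar_rowE.
  rewrite [X in _ - X](eq_bigr (fun i => c 0 i *: S i s)) ?addrK// => i _.
  by rewrite ffunE bopZ ec.
apply: has_sum_unique (hs) _.
have hi i := has_sum_shift i (has_sumZ (c := c 0 i) (has_sum_bop (A := S i) hs)).
have := has_sumD (@has_sum_single R n K [ffun=> 0%N] v) (has_sum_sum hi).
apply: eq_has_sum => l /=.
have [l0|l0] := posnP (mdeg l).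
  rewrite (mdeg_eq0 l0) eqxx /p monomial0 gamma0 tuple_pow0 !scale1r.
  by rewrite big1 ?addr0// => i _; rewrite ffunE.
have -> : (l == [ffun=> 0%N]) = false.
  by apply/negbTE; apply: contraL l0 => /eqP ->; rewrite mdeg0.
rewrite add0r /p [in RHS](gamma_pascal R l0) scaler_suml scaler_sumr.
apply: eq_bigr => i _; case: ltnP => li; last by rewrite scale0r scaler0.
rewrite !bopZ -tuple_pow_incr decrK// !scalerA (monomial_decr c li).
by congr (_ *: _); ring.
Qed.

Lemma conj_op_dot (X : bop K K) h :
  dotp (conj_op S X h) h = \sum_(i < n) dotp (X (adj (S i) h)) (adj (S i) h).
Proof.
rewrite /conj_op bop_sumE dot_suml; apply: eq_bigr => i _.
by rewrite !bop_compE adjP.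
Qed.

Hypothesis Spure : pure_tuple S.

(* On a subspace N that is invariant under the adjoints and killed by the defect
   operator, h |-> (S_i^* h)_i is isometric, which contradicts purity unless N = 0. *)
Lemma pure_total (N : set K) :
  (forall h i, N h -> N (adj (S i) h)) -> (forall h, N h -> defect_adj S h = 0) ->
  forall h, N h -> h = 0.
Proof.
move=> Ninv ND h Nh.
have iso g : N g -> \sum_(i < n) `|adj (S i) g| ^+ 2 = `|g| ^+ 2.
  move=> /ND Dg; have := defect_adj_norm contractive_adj g.
  by rewrite Dg normr0 expr0n /= => /esym/eqP; rewrite subr_eq0 => /eqP ->.
have it m : forall g, N g -> dotp (iter m (conj_op S) (bop_id K) g) g = `|g| ^+ 2.
  elim: m => [|m IH] g Ng; first by rewrite /= dot_norm.
  rewrite iterS conj_op_dot -iso//; apply: eq_bigr => i _.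
  by rewrite IH//; exact: Ninv.
apply/eqP; rewrite -normr_eq0 -sqrf_eq0; apply/eqP.
apply: (@eps_eq0 _ R[i]^o _ `|h|) => // e e0.
have pc : (fun m => iter m (conj_op S) (bop_id K) h) @ \oo --> (0 : K) := @Spure h.
move/cvgrPdist_lt : pc => /(_ _ e0)[m _ /(_ m (leqnn _))/=].
rewrite sub0r normrN => hm.
rewrite -(it m h Nh) (le_trans (cauchy_schwarz _ _))// mulrC.
by rewrite ler_wpM2l// ltW.
Qed.

End Powers.

(** The resolvent is a power series in the conjugate of [z]; evaluating it at the conjugate point
    gives a series in [z]. *)
Lemma l1_ball_conj (R : realType) (n : nat) (z : 'rV[R[i]]_n) : l1_ball z ->
  l1_ball (\row_i (z 0 i)^*) /\ \row_i ((\row_i (z 0 i)^*) 0 i)^* = z.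
Proof.
move=> z1; split; last by apply/rowP => i; rewrite !mxE conjCK.
by rewrite /l1_ball; under eq_bigr do rewrite mxE norm_conjC.
Qed.

Section Uniqueness.
Context (R : realType) (n : nat) (E Es : hilbertType R).
Variable theta : 'rV[R[i]]_n -> bop E Es.

Section KernelVectors.
Context (K : hilbertType R) (S : 'I_n -> bop K K).
Hypothesis Scc : commuting_contractive S.
Hypothesis Spure : pure_tuple S.
Variable tau : bop Es (cs_sort (defect_adj_space S)).
Hypothesis tauU : unitary_op tau.

Definition defect_vec eta : K := defect_adj S (val (tau eta)).
(** Indexing by points of the ball and vectors of [Es], independently of [S], makes the families of
    two tuples comparable. *)
Definition kernel_vec (p : {z : 'rV[R[i]]_n | unit_ball z} * Es) : K :=
  resolvent S (sval p.1) (defect_vec p.2).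

(** [tau] being onto, [defect_adj S h] is itself some [tau eta]; pairing [h] with that [defect_vec]
    gives [|defect_adj S h|^2 = 0], and purity applies. *)
Lemma defect_vec_total (N : set K) :
  (forall h i, N h -> N (adj (S i) h)) ->
  (forall h eta, N h -> dotp h (defect_vec eta) = 0) ->
  forall h, N h -> h = 0.
Proof.
move=> Ninv ND; apply: (pure_total Scc Spure Ninv) => h Nh.
apply: dot_eq0.
have Dh : defect_adj S h \in cs_pred (defect_adj_space S).
  by rewrite inE; apply: subset_closure; exists h.
pose d : cs_sort (defect_adj_space S) := Sub (defect_adj S h) Dh.
have -> : defect_adj S h = val (tau (adj tau d)).
  by have [_ /bopP/(_ d)] := tauU; rewrite bop_compE => ->.
rewrite {1}(_ : val _ = defect_adj S h); last first.
  by have [_ /bopP/(_ d)] := tauU; rewrite bop_compE => ->.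
rewrite (defect_adj_sa (contractive_adj Scc)); exact: ND.
Qed.

Lemma tuple_pow_total h :
  (forall k eta, dotp h (tuple_pow S k (defect_vec eta)) = 0) -> h = 0.
Proof.
apply: (@defect_vec_total [set h | forall k eta, dotp h (tuple_pow S k (defect_vec eta)) = 0]).
  by move=> g i Ng k eta; rewrite adjPr -tuple_pow_incr.
by move=> g eta /(_ [ffun=> 0%N] eta); rewrite tuple_pow0.
Qed.

(** Orthogonality to all kernel vectors makes a scalar power series vanish, hence its coefficients,
    the pairings with [S^k D eta] up to [gamma]. *)
Lemma kernel_vec_total h : (forall p, dotp h (kernel_vec p) = 0) -> h = 0.
Proof.
move=> h0; apply: tuple_pow_total => k eta; rewrite -dot_conj.
have gk : gamma R k != 0 by rewrite gt_eqF// gamma_gt0.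
suff /eqP : gamma R k * dotp (tuple_pow S k (defect_vec eta)) h = 0.
  by rewrite mulf_eq0 (negbTE gk)/= => /eqP ->; rewrite rmorph0.
move: k {gk}; apply: (@scalar_power_series_unique _ _
  (fun k => gamma R k * dotp (tuple_pow S k (defect_vec eta)) h)) => z z1.
have [zc1 zcc] := l1_ball_conj z1.
have := has_sum_dotl (v := h) (resolvent_has_sum Scc (v := defect_vec eta) zc1).
have -> : dotp (resolvent S (\row_i (z 0 i)^*) (defect_vec eta)) h = 0.
  rewrite -dot_conj.
  have := h0 (exist _ _ (l1_ball_unit zc1), eta); rewrite /kernel_vec /= => ->.
  by rewrite rmorph0.
by apply: eq_has_sum => k; rewrite zcc !dotZl.
Qed.

Hypothesis coin : forall z w, unit_ball z -> unit_ball w ->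
  char_fun S w ** adj (char_fun S z) = tau ** theta w ** adj (theta z) ** adj tau.

(** The right-hand side depends on [theta] alone, so two tuples coinciding weakly with [theta] share
    their Gram matrix. *)
Lemma kernel_vec_dot p q : (1 - ball_ip (sval p.1) (sval q.1)) *
    dotp (kernel_vec p) (kernel_vec q) =
  dotp p.2 q.2 - dotp (adj (theta (sval p.1)) p.2) (adj (theta (sval q.1)) q.2).
Proof.
case: p q => [[z z1] eta] [[w w1] zeta] /=.
have [tau1 tau2] := tauU; have [td _] := unitary_dot tauU.
have tt x : adj tau (tau x) = x by rewrite -[LHS]/((adj tau ** tau) x) tau1.
have e1 := char_fun_gram (contractive_adj Scc) (tau eta) (tau zeta) z1 w1.
have e2 : dotp (adj (char_fun S z) (tau eta)) (adj (char_fun S w) (tau zeta)) =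
    dotp (adj (theta z) eta) (adj (theta w) zeta).
  rewrite -adjP -[LHS]/(dotp ((char_fun S w ** adj (char_fun S z)) (tau eta)) (tau zeta)).
  by rewrite coin// !bop_compE tt td adjP.
by rewrite e2 td in e1; rewrite e1 subKr.
Qed.

End KernelVectors.

Lemma coincide_unitarily_equivalent (H K : hilbertType R)
    (T : 'I_n -> bop H H) (S : 'I_n -> bop K K) :
  commuting_contractive T -> pure_tuple T -> coincide_weakly theta (char_fun T) ->
  commuting_contractive S -> pure_tuple S -> coincide_weakly theta (char_fun S) ->
  unitarily_equivalent T S.
Proof.
move=> Tcc Tp [tT tTU cT] Scc Sp [tS tSU cS].
have [|||U UU HU] := @gram_unitary R K H _ (kernel_vec tS) (kernel_vec tT).
- move=> p q; apply: (mulfI (ball_ip_neq1 (svalP p.1) (svalP q.1))).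
  by rewrite !kernel_vec_dot.
- exact: kernel_vec_total.
- exact: kernel_vec_total.
have Upow k eta : U (tuple_pow S k (defect_vec tS eta)) = tuple_pow T k (defect_vec tT eta).
  have gk : gamma R k != 0 by rewrite gt_eqF// gamma_gt0.
  apply/eqP; rewrite -subr_eq0; apply/eqP/(scalerI gk); rewrite scaler0.
  move: k {gk}; apply: (@power_series_unique _ _ _ (fun k => gamma R k *:
    (U (tuple_pow S k (defect_vec tS eta)) - tuple_pow T k (defect_vec tT eta)))) => z z1.
  have [zc1 zcc] := l1_ball_conj z1.
  have hS := has_sum_bop (A := U) (resolvent_has_sum Scc (v := defect_vec tS eta) zc1).
  have hT := resolvent_has_sum Tcc (v := defect_vec tT eta) zc1.
  have := HU (exist _ _ (l1_ball_unit zc1), eta); rewrite /kernel_vec /= => e.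
  have := has_sum_lin (c := -1) hT hS; rewrite e scaleN1r addNr zcc.
  apply: eq_has_sum => k.
  by rewrite !bopZ scaleN1r addrC !scalerA -scalerBr.
exists U => // i; apply/bopP => h.
have [_ UU'] := UU.
have int x : U (S i x) = T i (U x).
  apply/eqP; rewrite -subr_eq0; apply/eqP.
  (* Passing to the adjoint replaces vanishing on the total family [S^k D eta] by orthogonality to
     it, which [tuple_pow_total] handles. *)
  suff AB : adj (U ** S i - T i ** U) = 0.
    have -> : U (S i x) - T i (U x) = adj (adj (U ** S i - T i ** U)) x by rewrite adjK.
    by rewrite AB; apply: dot_inj => y; rewrite adjPr dot0l dot0r.
  apply/bopP => y; apply: (tuple_pow_total Scc Sp tSU) => k eta.
  rewrite adjPr -[(U ** S i - T i ** U) _]/(U (S i _) - T i (U _)).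
  by rewrite -tuple_pow_incr// !Upow tuple_pow_incr// subrr dot0r.
by rewrite !bop_compE int -[U (adj U h)]/((U ** adj U) h) UU'.
Qed.

End Uniqueness.

(** * Existence *)

Section Model.
Context (R : realType) (n : nat) (E Es : hilbertType R).
Variable theta : 'rV[R[i]]_n -> bop E Es.
Hypothesis theta_mult : multiplier theta.
Hypothesis theta_pc : purely_contractive theta.
Hypothesis theta_inner : inner theta.
Local Notation C := R[i].
Implicit Types (z w : 'rV[C]_n) (i : 'I_n) (eta zeta : Es).

Lemma multiplication_exists : exists M : h2space n E -> h2space n Es,
  forall g z, unit_ball z -> h2_eval (M g) z = theta z (h2_eval g z).
Proof.
suff /choice[M HM] : forall g, exists f, forall z, unit_ball z ->
    h2_eval f z = theta z (h2_eval g z) by exists M.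
move=> g; have [_ tm] := theta_mult.
have /tm /H2_repr[f hf] : H2 (h2_eval g) by apply/H2_repr; exists g.
by exists f => z z1; rewrite -hf.
Qed.

(** Multiplication by [theta] on coefficient families; the choice is determined because [h2_eval] is
    injective on the ball. *)
Definition mult_h2 := sval (cid multiplication_exists).

Lemma h2_eval_mult g z : unit_ball z -> h2_eval (mult_h2 g) z = theta z (h2_eval g z).
Proof. exact: svalP (cid multiplication_exists) g z. Qed.

Lemma mult_h2_linear : linear mult_h2.
Proof.
move=> c f g; apply: h2_eval_inj => z z1.
by rewrite h2_eval_lin// !h2_eval_mult// h2_eval_lin// bopD bopZ.
Qed.

(** The kernel is closed as the annihilator of the vectors [k_z theta(z)^* eta], by the reproducing
    property. *)
Lemma mult_h2_kernel : exists N : closed_subspace (h2space n E),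
  forall g, cs_set N g <-> mult_h2 g = 0.
Proof.
have [N HN] := closed_orthogonal [set k : h2space n E |
  exists p : 'rV[C]_n * Es, unit_ball p.1 /\ k = kernel p.1 (adj (theta p.1) p.2)].
exists N => g; rewrite HN; split=> [h|g0 _ [[z eta] [/= z1 ->]]].
  apply: h2_eval_inj => z z1; apply: dot_inj => eta.
  rewrite h2_eval_mult// adjP -dot_kernel// -dot_kernel// dot0l.
  by apply: h; exists (z, eta).
by rewrite dot_kernel// -adjP -h2_eval_mult// g0 -dot_kernel// dot0l.
Qed.

(* Since ker M_theta is closed, every g splits along it, and M_theta is isometric
   on the complement; no a priori boundedness of M_theta is involved. *)
Lemma mult_h2_dot (u g : h2space n E) :
  (forall f, mult_h2 f = 0 -> dotp u f = 0) ->
  dotp (mult_h2 u) (mult_h2 g) = dotp u g.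
Proof.
move=> uN; have [N HN] := mult_h2_kernel.
have [y Ny gy] := projection_exists N g.
have mB : mult_h2 (g - y) = mult_h2 g.
  by rewrite addrC -scaleN1r mult_h2_linear (HN y).1// scaler0 add0r.
rewrite -mB; have -> : dotp u g = dotp u (g - y).
  by rewrite dotBr (uN y) ?subr0//; exact/HN.
pose P := [set v : h2space n E | forall f, mult_h2 f = 0 -> dotp v f = 0].
apply: (@isometry_dot _ _ _ P mult_h2) => //; last by move=> f /HN; exact: gy.
- by move=> a v v' Pv Pv' f f0; rewrite dotDl dotZl Pv// Pv'// mulr0 addr0.
- exact: mult_h2_linear.
move=> v Pv.
have rv : h2_repr (mult_op theta (h2_eval v)) (mult_h2 v).
  by move=> z z1; rewrite h2_eval_mult.
have := theta_inner ((H2_repr _).2 (ex_intro _ v (h2_repr_eval v))).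
rewrite (H2norm_repr rv) (H2norm_repr (h2_repr_eval v)); apply.
move=> f /H2_repr[b fb] f0; rewrite (H2dot_repr (h2_repr_eval v) fb); apply: Pv.
apply: h2_eval_inj => z z1; rewrite h2_eval_mult// -fb//.
have -> : theta z (f z) = 0 by exact: f0.
by apply: dot_inj => eta; rewrite -dot_kernel// !dot0l.
Qed.

Lemma model_exists : exists S : closed_subspace (h2space n Es),
  forall f, cs_set S f <-> forall g, dotp f (mult_h2 g) = 0.
Proof.
have [S HS] := closed_orthogonal (range mult_h2).
exists S => f; rewrite HS; split=> [h g|h _ [g _ <-]//].
by apply: h; exists g.
Qed.

Definition model := sval (cid model_exists).

Lemma modelP f : cs_set model f <-> forall g, dotp f (mult_h2 g) = 0.
Proof. exact: svalP (cid model_exists) f. Qed.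

Local Notation H := (cs_sort model).

Lemma model_val (f : H) g : dotp (val f) (mult_h2 g) = 0.
Proof. by have := valP f; rewrite inE => /modelP. Qed.

Definition model_kernel z eta : h2space n Es :=
  kernel z eta - mult_h2 (kernel z (adj (theta z) eta)).

(** [k_z theta(z)^* eta] is orthogonal to the kernel of [mult_h2], so [mult_h2_dot] applies to it;
    both pairings with [mult_h2 g] are then the conjugate of [dotp (theta z (g z)) eta]. *)
Lemma model_kernel_subproof z eta : unit_ball z ->
  model_kernel z eta \in cs_pred model.
Proof.
move=> z1; rewrite inE; apply/modelP => g.
rewrite dotBl mult_h2_dot.
  rewrite -dot_conj -[X in _ - X]dot_conj !dot_kernel// h2_eval_mult//.
  by rewrite adjP subrr.
move=> f f0; rewrite -dot_conj dot_kernel// -adjP -h2_eval_mult// f0.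
by rewrite -dot_kernel// dot0l rmorph0.
Qed.

Lemma dot_model_kernel (f : H) z eta : unit_ball z ->
  dotp (val f) (model_kernel z eta) = dotp (h2_eval (val f) z) eta.
Proof. by move=> z1; rewrite dotBr model_val subr0 dot_kernel. Qed.

Lemma h2_eval_model_kernel z w eta : unit_ball z -> unit_ball w ->
  (1 - ball_ip z w) *: h2_eval (model_kernel z eta) w =
  eta - theta w (adj (theta z) eta).
Proof.
move=> z1 w1.
have -> : model_kernel z eta =
    -1 *: mult_h2 (kernel z (adj (theta z) eta)) + kernel z eta.
  by rewrite scaleN1r addrC.
rewrite h2_eval_lin// scaleN1r.
rewrite h2_eval_mult// scalerDr scalerN -bopZ !h2_eval_kernel//.
by rewrite addrC.
Qed.

Definition model_bwd i : bop H H := restrict_op model model (bwd Es i).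

(** [mult_h2] commutes with the coordinate multiplications, so the complement of its range is
    invariant under their adjoints. *)
Lemma val_model_bwd i (f : H) : val (model_bwd i f) = bwd Es i (val f).
Proof.
apply: val_restrict_op => {}f /modelP h; apply/modelP => g.
rewrite -dot_conj -dot_fwd.
have -> : fwd i (mult_h2 g) = mult_h2 (fwd i g).
  apply: h2_eval_inj => z z1.
  by rewrite h2_eval_fwd// !h2_eval_mult// h2_eval_fwd// bopZ.
by rewrite dot_conj h.
Qed.

(** The compression of multiplication by [z_i], written as an adjoint so that no projection operator
    has to be formed. *)
Definition model_tuple i : bop H H := adj (model_bwd i).
Local Notation T := model_tuple.

Lemma adj_model_tuple i : adj (T i) = model_bwd i.
Proof. exact: adjK. Qed.

Lemma cs_dotE (K : hilbertType R) (S : closed_subspace K) (f g : cs_sort S) :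
  dotp f g = dotp (val f) (val g).
Proof. by []. Qed.

Lemma model_dot (f g : H) : dotp f g = dotp (h2_eval (val f) 0) (h2_eval (val g) 0) +
  \sum_(i < n) dotp (adj (T i) f) (adj (T i) g).
Proof.
rewrite cs_dotE bwd_dot; congr (_ + _); apply: eq_bigr => i _.
by rewrite adj_model_tuple cs_dotE !val_model_bwd.
Qed.

Lemma model_commuting : commuting_contractive T.
Proof.
split=> [i j|].
  apply/bopP => f; apply: dot_injr => g.
  have e a b : dotp g (T a (T b f)) = dotp (model_bwd b (model_bwd a g)) f.
    by rewrite -(adjP (model_bwd a)) -(adjP (model_bwd b)).
  have be : model_bwd j (model_bwd i g) = model_bwd i (model_bwd j g).
    by apply: val_inj; rewrite 4!val_model_bwd bwd_comm.
  exact: etrans (e i j) (etrans (congr1 (fun u => dotp u f) be) (esym (e j i))).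
apply/le_opP => f.
rewrite -[leRHS]dot_norm model_dot dot_norm.
under eq_bigr do rewrite -dot_norm.
by rewrite lerDr exprn_ge0.
Qed.

Lemma model_tail m (f : H) :
  dotp (iter m (conj_op T) (bop_id H) f) f = h2_tail m (val f).
Proof.
elim: m f => [|m IH] f; first by rewrite /= h2_tail0 dot_norm cs_normE.
rewrite iterS conj_op_dot -h2_tail_bwd; apply: eq_bigr => i _.
by rewrite IH adj_model_tuple val_model_bwd.
Qed.

(** The iterates lie between [0] and the identity, so [selfadj_norm_le] upgrades the decay of their
    quadratic forms, the tails, to strong convergence. *)
Lemma model_pure : pure_tuple T.
Proof.
move=> f; apply/cvgrPdist_lt => e e0.
have [|N HN] := h2_tail_small (val f) (e := e ^+ 2 / 2).
  by rewrite divr_gt0// exprn_gt0.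
exists N => // m /HN hm; rewrite /= sub0r normrN.
apply: norm_lt_sqr; first exact: ltW.
have tl (g : h2space n Es) : 0 <= h2_tail m g <= `|g| ^+ 2.
  pose c (k : multiindex n) : C^o := if (m <= mdeg k)%N then `|g k| ^+ 2 / gamma R k else 0.
  have t0 k : 0 <= c k by rewrite /c; case: ifP => // _; exact: gamma_inv_sqr_ge0.
  rewrite (has_sum_ge0 t0 (h2_tail_has_sum (m := m) (a := g)))/=.
  apply: (has_sum_le t0 (h2_tail_has_sum (m := m) (a := g))) => J.
  apply: le_trans (h2_psum_le g J); apply: ler_sum => k _.
  by rewrite /c; case: ifP => // _; exact: gamma_inv_sqr_ge0.
apply: le_lt_trans (selfadj_norm_le _ _ _) _.
- by move=> g; rewrite model_tail; have /andP[] := tl (val g).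
- move=> g; rewrite bop_addE bop_oppE dotBl model_tail dot_norm subr_ge0 cs_normE.
  by have /andP[] := tl (val g).
rewrite model_tail; apply: le_lt_trans hm _.
by rewrite ltr_pdivrMr// ltr_pMr ?exprn_gt0// ltr1n.
Qed.

Lemma model_defect_dot (f g : H) :
  dotp (defect_adj T f) (defect_adj T g) = dotp (h2_eval (val f) 0) (h2_eval (val g) 0).
Proof.
have c := contractive_adj model_commuting.
rewrite (defect_adj_sa c) (defect_adj_sqr c) dotBr -[dotp f (row_op _ _)]adjPr.
rewrite !adj_row_opE l2sum_dotE model_dot.
under [X in _ - X]eq_bigr do rewrite !ffunE.
by rewrite addrK.
Qed.

(** The model kernel at [0] gives [|eta| = |xi|] for [xi = theta(0)^* eta]. If [xi] were nonzero,
    pure contractivity would give [|xi|^2 = dotp eta (theta 0 xi) <= |eta| |theta 0 xi| <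
    |xi|^2]. *)
Lemma model_eval0_total eta : (forall f : H, dotp eta (h2_eval (val f) 0) = 0) -> eta = 0.
Proof.
move=> h; have z0 := unit_ball0 R n.
have := h (Sub (model_kernel 0 eta) (model_kernel_subproof eta z0)).
have := h2_eval_model_kernel eta z0 z0; rewrite ball_ip0 subr0 scale1r /= => ->.
rewrite dotBr -adjPr => /eqP; rewrite subr_eq0 => /eqP e.
set xi := adj (theta 0) eta in e.
have en : `|eta| = `|xi|.
  by apply/eqP; rewrite -(@eqrXn2 _ 2)// -!dot_norm e.
have [x0|x0] := eqVneq xi 0; first by apply: dot_eq0; rewrite e x0 dot0l.
have xp : 0 < `|xi| by rewrite normr_gt0.
have : `|xi| ^+ 2 < `|xi| ^+ 2; last by rewrite ltxx.
rewrite -{1}dot_norm {1}/xi adjPr; apply: (@le_lt_trans _ _ (`|eta| * `|theta 0 xi|)).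
  apply: real_norm_le (cauchy_schwarz _ _).
  by rewrite -adjPr -/xi dot_norm exprn_ge0.
by rewrite en expr2 ltr_pM2l// theta_pc.
Qed.

Lemma closure_range_total (F K : hilbertType R) (A : bop F K)
    (h : cs_sort (closure_range A)) :
  (forall x, dotp (val h) (A x) = 0) -> h = 0.
Proof.
move=> h0; apply: val_inj; change (val h = 0 :> K); apply: dot_eq0.
apply: (@eps_eq0 _ R[i]^o _ `|val h|) => // e e0.
have : closure (range A) (val h) by have := valP h; rewrite inE.
move=> /closureP/(_ e e0)[_ [x _ <-] hx].
have -> : dotp (val h) (val h) = dotp (val h) (val h - A x) by rewrite dotBr h0 subr0.
by rewrite (le_trans (cauchy_schwarz _ _))// ler_wpM2l// ltW.
Qed.

Lemma model_coincide : coincide_weakly theta (char_fun T).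
Proof.
have c := contractive_adj model_commuting.
have vP (f : H) : defect_adj T f \in cs_pred (defect_adj_space T).
  by rewrite inE; apply: subset_closure; exists f.
pose v f : cs_sort (defect_adj_space T) := Sub (defect_adj T f) (vP f).
(* [tau] maps [f(0)] to the defect operator applied to [f]; the Gram matrices agree by
   [model_defect_dot]. *)
have [|||tau tU Ht] := @gram_unitary R Es (cs_sort (defect_adj_space T)) _
    (fun f : H => h2_eval (val f) 0) v.
- by move=> f g; rewrite [RHS]cs_dotE /= model_defect_dot.
- exact: model_eval0_total.
- by move=> h hv; apply: closure_range_total => x; exact: hv.
exists tau => // z w z1 w1.
have [td td'] := unitary_dot tU; have [_ tt] := tU.
(* The resolvent equation tested against [f]: the value [f(x)] minus [sum_i x_i] times the values of
   the backward shifts at [x] is [f(0)], and [tau] carries its pairing with [eta] to the defect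
   space. *)
have res x eta (x1 : unit_ball x) : Sub (model_kernel x eta) (model_kernel_subproof eta x1) =
    resolvent T x (defect_adj T (val (tau eta))) :> H.
  apply: resolvent_eq => //; set p : H := Sub _ _.
  apply: dot_injr => f; rewrite dotBr -(defect_adj_sa c).
  rewrite -[dotp (defect_adj T f) _]/(dotp (v f) (tau eta)) -Ht td.
  rewrite dot_row_adj_scalar.
  rewrite [dotp f p]cs_dotE dot_model_kernel// (h2_eval_bwd (val f) x1) dotDl.
  rewrite dot_suml; set s1 := \sum_(i < n) _; set s2 := \sum_(i < n) _.
  suff -> : s1 = s2 by rewrite addrK.
  apply: eq_bigr => i _; rewrite dotZl adj_model_tuple.
  by rewrite [dotp _ p]cs_dotE dot_model_kernel// val_model_bwd.
apply/bopP => y; apply: dot_inj => x.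
have tK u : tau (adj tau u) = u by rewrite -[LHS]/((tau ** adj tau) u) tt.
rewrite !bop_compE -[y]tK -[x]tK; move: (adj tau y) (adj tau x) => eta zeta {x y}.
have [tt' _] := tU.
have tK' u : adj tau (tau u) = u by rewrite -[LHS]/((adj tau ** tau) u) tt'.
rewrite tK' td (adjP (char_fun T w)) (adjP (theta w)).
apply: (etrans (char_fun_gram c (tau eta) (tau zeta) z1 w1)); rewrite td.
have rd : dotp (resolvent T z (defect_adj T (val (tau eta))))
      (resolvent T w (defect_adj T (val (tau zeta)))) =
    dotp (h2_eval (model_kernel z eta) w) zeta.
  apply: etrans (congr2 (fun a b : H => dotp a b) (esym (res z eta z1)) (esym (res w zeta w1))) _.
  pose p : H := Sub (model_kernel z eta) (model_kernel_subproof eta z1).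
  exact: (@dot_model_kernel p w zeta w1).
apply: (etrans (congr1 (fun r => dotp eta zeta - (1 - ball_ip z w) * r) rd)).
by rewrite -dotZl h2_eval_model_kernel// dotBl subKr (adjP (theta w)).
Qed.

End Model.

Theorem theorem4p5 (R : realType) (n : nat) (n_gt0 : (0 < n)%N)
    (E Es : hilbertType R) (theta : 'rV[R[i]]_n -> bop E Es)
    (theta_mult : multiplier theta)
    (theta_pc : purely_contractive theta)
    (theta_inner : inner theta) :
  exists (H : hilbertType R) (T : 'I_n -> bop H H),
    [/\ commuting_contractive T, pure_tuple T,
        coincide_weakly theta (char_fun T) &
        forall (K : hilbertType R) (S : 'I_n -> bop K K),
          commuting_contractive S -> pure_tuple S ->
          coincide_weakly theta (char_fun S) ->
          unitarily_equivalent T S].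
Proof.
exists (cs_sort (model theta_mult)), (@model_tuple _ _ _ _ _ theta_mult).
have cc := model_commuting theta_mult.
have tp := @model_pure _ _ _ _ _ theta_mult.
have co := model_coincide theta_mult theta_pc theta_inner.
split=> // K S Scc Sp Sco; exact: coincide_unitarily_equivalent cc tp co Scc Sp Sco.
Qed.
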